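(* Let $\boldsymbol{Z}$ be a $(\boldsymbol{\zeta},\boldsymbol{\mu},\boldsymbol{\varphi})$-MSPD with intensity $\boldsymbol{\lambda}$, let $T\ge0$ and $1\le i\le d$. Then $\boldsymbol{Z}^i_T$ admits the pseudo-chaotic representation ($\mathbb{P}$-almost surely) $$\boldsymbol{Z}^i_T=\lim_{M\to\infty}\sum_{n=1}^{+\infty}\frac1{n!}\,\boldsymbol{\mathcal I}_n\!\left(\mathcal{T}^n_{(\mathbf{x}_1,\dots,\mathbf{x}_n)}\boldsymbol{Z}^i_T\;\mathbf{1}_{([0,T]\times[0,M])^n}\right),$$ where the indicator $\mathbf{1}_{([0,T]\times[0,M])^n}$ means that $(t_j,\theta_j)\in[0,T]\times[0,M]$ for all $j=1,\dots,n$. Moreover, for every $n\ge1$ and all $(\mathbf{x}_1,\dots,\mathbf{x}_n)\in(\mathbf{X}_T)^n$ (pairwise distinct, $\mathbf{x}_j=(k_j,t_j,\theta_j,y_j)$, ordered in time, $t_1\le\dots\le t_n$), $$\mathcal{T}^n_{(\mathbf{x}_1,\dots,\mathbf{x}_n)}\boldsymbol{Z}^i_T=\boldsymbol{\zeta}^{i,k_n}(T-t_n,y_n)\;\mathcal{T}^{n-1}_{(\mathbf{x}_1,\dots,\mathbf{x}_{n-1})}\mathbf{1}_{\{\theta_n\le\boldsymbol{\lambda}^{k_n}_{t_n}\}}.$$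
   Context: Fix $d\in\mathbb{N}^*=\{1,2,\dots\}$ and probability measures $\boldsymbol{\nu}^1,\dots,\boldsymbol{\nu}^d$ on $\mathbb{R}_+=[0,\infty)$. Let $\mathbf{X}=\{1,\dots,d\}\times\mathbb{R}_+^3$ with its Borel $\sigma$-field, points written $\mathbf{x}=(k,t,\theta,y)$, and $\mathbf{X}_T=\{1,\dots,d\}\times[0,T]\times\mathbb{R}_+^2$. Let $\mathfrak{m}$ be the measure on $\mathbf{X}$ given by $\int f\,d\mathfrak{m}=\sum_{k=1}^d\int_{\mathbb{R}_+^3}f(k,t,\theta,y)\,\boldsymbol{\nu}^k(dy)\,d\theta\,dt$. Let $\Omega$ be the space of configurations $\boldsymbol{\omega}=\sum_{j=1}^n\delta_{\mathbf{x}_j}$, $n\in\mathbb{N}\cup\{+\infty\}$, on $\mathbf{X}$ and $\mathbb{P}$ the probability on $\Omega$ under which the canonical evaluation $\mathbf{N}$ is a Poisson random measure with intensity measure $\mathfrak{m}$; $\mathbb{F}^{\mathbf{N}}$ is its natural filtration in the time coordinate $t$. All functions are tacitly Borel measurable. A $d$-kernel is a map $\boldsymbol{\zeta}:\mathbb{R}_+^2\to\mathcal{M}_{d,d}(\mathbb{R}_+)$ with $\int_{\mathbb{R}_+}\boldsymbol{\zeta}^{i,k}(t,y)\boldsymbol{\nu}^k(dy)<\infty$ for all $t\ge0$, $1\le i,k\le d$; put $\overline{\boldsymbol{\zeta}}(t)=\big(\int\boldsymbol{\zeta}^{i,k}(t,y)\boldsymbol{\nu}^k(dy)\big)_{i,k}$.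 It is non-explosive if $\int_0^\infty\overline{\boldsymbol{\zeta}}(t)dt$ has finite entries and spectral radius $<1$. A self-excitation $d$-kernel $\boldsymbol{\varphi}$ is a non-explosive $d$-kernel with $\boldsymbol{\varphi}^{i,k}(0,y)=0$ for all $i,k,y$; by convention $\boldsymbol{\varphi}(\tau,\cdot)=0$ for $\tau<0$. Given a $d$-kernel $\boldsymbol{\zeta}$, a self-excitation $d$-kernel $\boldsymbol{\varphi}$ and functions $\boldsymbol{\mu}^i:\mathbb{R}_+\to\mathbb{R}_+$ $(1\le i\le d)$, a $(\boldsymbol{\zeta},\boldsymbol{\mu},\boldsymbol{\varphi})$-MSPD (multidimensional self-exciting process with dependencies) is the $\mathbb{R}^d$-valued process $\boldsymbol{Z}$ such that for all $i$ and $T\ge0$ $$\boldsymbol{Z}^i_T=\int_{\mathbf{X}_T}\boldsymbol{\zeta}^{i,k}(T-t,y)\mathbf{1}_{\{\theta\le\boldsymbol{\lambda}^k_t\}}\mathbf{N}(dk,dt,d\theta,dy),\qquad \boldsymbol{\lambda}^i_T=\boldsymbol{\mu}^i(T)+\int_{\mathbf{X}_T}\boldsymbol{\varphi}^{i,k}(T-t,y)\mathbf{1}_{\{\theta\le\boldsymbol{\lambda}^k_t\}}\mathbf{N}(dk,dt,d\theta,dy),$$ with $\boldsymbol{\lambda}$ ($\mathbb{F}^{\mathbf{N}}$-predictable) the intensity. Operators $\mathcal{T}^n$: for a measurable $F:\Omega\to\mathbb{R}$, $\mathcal{T}^0F=F(\emptyset)$ (value at the empty configuration), and for $n\ge1$,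 $\mathcal{T}^n_{(\mathbf{x}_1,\dots,\mathbf{x}_n)}F=\sum_{J\subset\{\mathbf{x}_1,\dots,\mathbf{x}_n\}}(-1)^{n-|J|}F(\varpi_J)$ with $\varpi_J=\sum_{\mathbf{x}\in J}\delta_{\mathbf{x}}$ (a deterministic real number, symmetric in the points). Convention: the points are always listed in increasing order of their time component. Factorial measures: $\mathbf{N}^{(1)}=\mathbf{N}$ and $\mathbf{N}^{(n+1)}(A)=\int_{\mathbf{X}^n}\big[\int_{\mathbf{X}}\mathbf{1}_{\{(\mathbf{x}_1,\dots,\mathbf{x}_{n+1})\in A\}}\mathbf{N}(d\mathbf{x}_{n+1})-\sum_{j=1}^n\mathbf{1}_{\{(\mathbf{x}_1,\dots,\mathbf{x}_n,\mathbf{x}_j)\in A\}}\big]\mathbf{N}^{(n)}(d\mathbf{x}_1,\dots,d\mathbf{x}_n)$. For symmetric $f_n$, $\boldsymbol{\mathcal I}_n(f_n)=\int_{\mathbf{X}^n}f_n\,d\mathbf{N}^{(n)}$ (pathwise). *)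

(* Defs.v *)
(* MathComp-Analysis, over an arbitrary realType R. *)
From HB Require Import structures.
From mathcomp Require Export all_boot all_order all_algebra.
From mathcomp Require Export all_classical all_reals all_analysis.
From mathcomp Require Export measurable_realfun.
From mathcomp Require Import complex.

Set Implicit Arguments.
Unset Strict Implicit.
Unset Printing Implicit Defensive.
Import Order.TTheory GRing.Theory Num.Theory.
Export numFieldNormedType.Exports.

Local Open Scope classical_set_scope.
Local Open Scope ring_scope.

(* The dimension, which is positive, is written d.+1; 'I_d.+1 plays the role of
   the index set {1, ..., d} and carries the discrete sigma-algebra. *)
HB.instance Definition _ (d : nat) := isPointed.Build 'I_d.+1 ord0.
HB.instance Definition _ (d : nat) :=
  @isMeasurable.Build default_measure_display 'I_d.+1
    discrete_measurable discrete_measurable0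
    discrete_measurableC discrete_measurableU.

Section state_space.
Context (R : realType) (d : nat).

Definition quadrant (x : 'I_d.+1 * R * R * R) : bool :=
  [&& 0 <= x.1.1.2, 0 <= x.1.2 & 0 <= x.2].

Definition point := {x : 'I_d.+1 * R * R * R | quadrant x}.

Lemma quadrant0 : quadrant (ord0, 0, 0, 0).
Proof. by rewrite /quadrant/= lexx. Qed.

HB.instance Definition _ := Choice.on point.
HB.instance Definition _ :=
  isPointed.Build point (exist (fun x => quadrant x) _ quadrant0).

(* The space {1, ..., d} x R_+^3 of points (k, t, theta, y); its sigma-algebra
   is the trace of the Borel sigma-algebra of {1, ..., d} x R^3. *)
Definition X := g_sigma_algebra_preimageType
  (sval : point -> 'I_d.+1 * R * R * R).

HB.instance Definition _ := Measurable.on X.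

Definition kind (x : X) : 'I_d.+1 := (sval x).1.1.1.
Definition time (x : X) : R := (sval x).1.1.2.
Definition level (x : X) : R := (sval x).1.2.
Definition mark (x : X) : R := (sval x).2.

Definition upto (T : R) : set X := [set x | time x <= T].

(* The probability measures nu k live on R and are later required to be
   carried by [0, +oo[. *)
Definition intensity_measure (nu : 'I_d.+1 -> probability R R) (A : set X) :
    \bar R :=
  (\sum_(k < d.+1)
    \int[lebesgue_measure]_(t in `[0%R, +oo[)
    \int[lebesgue_measure]_(th in `[0%R, +oo[)
    \int[nu k]_(y in `[0%R, +oo[)
      (\1_([set sval x | x in A]) (k, t, th, y))%:E)%E.

(* sum_{j : s j = Some x} delta_x: a sequence with values in option encodes a
   finite or countable family of points, possibly with repetitions. *)
Definition sum_dirac (s : nat -> option X) : {measure set X -> \bar R} :=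
  mseries (fun j => if s j is Some x then (\d_x : {measure set X -> \bar R})
                    else (mzero : {measure set X -> \bar R})) 0.

Record config := Config {
  config_fun : set X -> \bar R ;
  config_sum_dirac : exists s, config_fun = sum_dirac s }.

HB.instance Definition _ := gen_eqMixin config.
HB.instance Definition _ := gen_choiceMixin config.

Definition finite_config (s : seq X) : config :=
  @Config (sum_dirac (onth s)) (ex_intro _ (onth s) erefl).

HB.instance Definition _ := isPointed.Build config (finite_config [::]).

Section config_measure.
Variable w : config.

Let config_fun0 : config_fun w set0 = 0%E.
Proof. by case: w => N [s /= ->]; exact: measure0. Qed.

Let config_fun_ge0 A : (0 <= config_fun w A)%E.
Proof. by case: w => N [s /= ->]; exact: measure_ge0. Qed.

Let config_fun_semi_sigma_additive : semi_sigma_additive (config_fun w).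
Proof. by case: w => N [s /= ->]; exact: measure_semi_sigma_additive. Qed.

HB.instance Definition _ := isMeasure.Build _ _ _ (config_fun w)
  config_fun0 config_fun_ge0 config_fun_semi_sigma_additive.

End config_measure.

(* The random measure N: the canonical evaluation. *)
Definition N (w : config) : {measure set X -> \bar R} := config_fun w.

Definition evaluation_sets (D : set X) : set (set config) :=
  [set [set w | B (N w A)] |
     A in [set A : set X | measurable A /\ A `<=` D] &
     B in [set B : set (\bar R) | measurable B]].

Definition Omega := g_sigma_algebraType (evaluation_sets setT).

HB.instance Definition _ := Measurable.on Omega.

Definition poisson_random_measure (P : probability Omega R)
    (m : set X -> \bar R) : Prop :=
  [/\ (* the last argument 0%N of poisson_prob is not used by the library *)
      forall (A : set X) n, measurable A -> (m A < +oo)%E ->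
        P [set w | N w A = n%:R%:E] = poisson_prob (fine (m A)) 0%N [set n],
      forall A : set X, measurable A -> m A = +oo%E ->
        P [set w | N w A = +oo%E] = 1%E &
      forall n (A : 'I_n -> set X), (forall j, measurable (A j)) ->
        trivIset setT A ->
        forall B : 'I_n -> set (\bar R), (forall j, measurable (B j)) ->
        P (\bigcap_j [set w | B j (N w (A j))]) =
          (\prod_(j < n) P [set w | B j (N w (A j))])%E].

Definition filtration (t : R) : set (set Omega) :=
  <<s evaluation_sets (upto t) >>.

Definition predictable_sets : set (set (Omega * R)) :=
  <<s setT `*` `[0, +oo[,
      [set A `*` [set 0] | A in filtration 0] `|`
      [set W | exists (s t : R) A, [/\ 0 <= s, filtration s A &
                                 W = A `*` `]s, t] ] ] >>.

Definition predictable (Y : R -> Omega -> R) : Prop :=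
  forall B : set R, measurable B ->
    predictable_sets
      ((setT `*` `[0, +oo[) `&` [set wt : Omega * R | B (Y wt.2 wt.1)]).

Definition spectral_radius n (A : 'M[R]_n) : R :=
  sup [set complex.Re `|z| | z in
         [set z : R[i]%C | eigenvalue (map_mx (real_complex R) A) z]].

Section kernels.
Variable nu : 'I_d.+1 -> probability R R.

Definition kernel_mean (zeta : 'I_d.+1 -> 'I_d.+1 -> R -> R -> R)
    (t : R) (i k : 'I_d.+1) : \bar R :=
  (\int[nu k]_(y in `[0%R, +oo[) (zeta i k t y)%:E)%E.

(* Only the values of a kernel on R_+^2 are relevant. *)
Definition is_kernel (zeta : 'I_d.+1 -> 'I_d.+1 -> R -> R -> R) : Prop :=
  forall i k,
    [/\ measurable_fun [set ty : R * R | 0 <= ty.1 /\ 0 <= ty.2]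
          (fun ty : R * R => zeta i k ty.1 ty.2),
        forall t y : R, 0 <= t -> 0 <= y -> 0 <= zeta i k t y &
        forall t : R, 0 <= t -> (kernel_mean zeta t i k < +oo)%E].

Definition kernel_mass (zeta : 'I_d.+1 -> 'I_d.+1 -> R -> R -> R)
    (i k : 'I_d.+1) : \bar R :=
  (\int[lebesgue_measure]_(t in `[0%R, +oo[) kernel_mean zeta t i k)%E.

Definition non_explosive (zeta : 'I_d.+1 -> 'I_d.+1 -> R -> R -> R) : Prop :=
  (forall i k, (kernel_mass zeta i k < +oo)%E) /\
  spectral_radius (\matrix_(i, k) fine (kernel_mass zeta i k)) < 1.

Definition is_self_excitation_kernel
    (phi : 'I_d.+1 -> 'I_d.+1 -> R -> R -> R) : Prop :=
  [/\ is_kernel phi, non_explosive phi &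
      forall i k (y : R), 0 <= y -> phi i k 0 y = 0].

End kernels.

(* int_{X_T} g^{i,k}(T - t, y) 1_{theta <= lambda^k_t} N(dk, dt, dtheta, dy)
   at the configuration w; on X_T one has T - t >= 0. *)
Definition excitation (g : 'I_d.+1 -> 'I_d.+1 -> R -> R -> R)
    (lambda : 'I_d.+1 -> R -> Omega -> R) (i : 'I_d.+1) (T : R) (w : Omega) :
    \bar R :=
  (\int[N w]_(x in upto T)
     (g i (kind x) (T - time x) (mark x) *
      (level x <= lambda (kind x) (time x) w)%R%:R)%:E)%E.

Definition MSPD_equations zeta (mu : 'I_d.+1 -> R -> R) phi
    (lambda Z : 'I_d.+1 -> R -> Omega -> R) (w : Omega) : Prop :=
  forall i (T : R), 0 <= T ->
    (Z i T w)%:E = excitation zeta lambda i T w /\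
    (lambda i T w)%:E = ((mu i T)%:E + excitation phi lambda i T w)%E.

(* The finite configurations are P-negligible, but the functionals
   T^n evaluate processes there: the equations hold P-almost surely and at
   every finite configuration. *)
Record is_MSPD (P : probability Omega R) zeta mu phi
    (lambda Z : 'I_d.+1 -> R -> Omega -> R) : Prop := {
  MSPD_predictable : forall k, predictable (lambda k) ;
  MSPD_measurable : forall i (T : R), 0 <= T -> measurable_fun setT (Z i T) ;
  MSPD_ae : {ae P, forall w, MSPD_equations zeta mu phi lambda Z w} ;
  MSPD_finite : forall s,
    MSPD_equations zeta mu phi lambda Z (finite_config s) }.

(* T^n_(x_1, ..., x_n) F; for n = 0 this is F at the empty configuration.
   The subsets J are sets of indices. *)
Definition Top n (x : n.-tuple X) (F : Omega -> R) : R :=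
  \sum_(J : {set 'I_n})
    (-1) ^+ (n - #|J|) * F (finite_config [seq tnth x j | j in J]).

(* factorial_measure w n is N^(n+1) at the configuration w. *)
Fixpoint factorial_measure (w : Omega) n : set (n.+1.-tuple X) -> \bar R :=
  match n return set (n.+1.-tuple X) -> \bar R with
  | 0%N => fun A => N w [set x | A [tuple x]]
  | m.+1 => fun A =>
      (\int[@factorial_measure w m]_x
         (\int[N w]_z (\1_A [tuple of rcons x z])%:E -
          \sum_(j < m.+1) (\1_A [tuple of rcons x (tnth x j)])%:E))%E
  end.

(* I_(n+1) (f), pathwise. *)
Definition factorial_integral n (f : n.+1.-tuple X -> R) (w : Omega) : \bar R :=
  (\int[@factorial_measure w n]_x (f x)%:E)%E.

(* The integrand T^n_x F 1_{([0, T] x [0, M])^n}. *)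
Definition truncated_Top (T M : R) (F : Omega -> R) n (x : n.-tuple X) : R :=
  Top x F * [forall j, (time (tnth x j) <= T) && (level (tnth x j) <= M)]%:R.

End state_space.

(* Main.v *)
(* On a configuration truncated to finitely many points, the integrals I_n are
   finite sums over n-tuples of distinct points, and Moebius inversion over the
   subsets of these points turns the series into Z at the truncated
   configuration (Z vanishes at the empty one).  For finite configurations the
   intensity at time t only sees points before t, as phi(0, .) = 0; hence
   removing or adding the last point changes Z only through its own term, which
   is the formula for T^n Z.

   It remains to let M tend to infinity.  The points accepted after truncation
   at M increase with M and are accepted by the full process; let D be the set
   of the points accepted by the latter only.  By monotone convergence,
   it suffices that D is almost surely empty.  At time t, the levels of D of
   kind k fill a set of length at most the sum of phi^{k,.} over the points of
   D before t: the intensity equation is subtracted from its truncations.  As D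
   is predictable, the compensation formula gives, on a time window of length
   eps, E|D^k| <= sum_j b_kj E|D^j| where b_kj is the mean mass of phi^{k,j} on
   [0, eps].  For eps small this forces E|D| = 0 if E|D| is finite, and the
   windows are treated one after the other.  Finiteness requires a stopping
   argument: since the intensity is finite at every time, only finitely many
   points of D carry a mark which makes phi non-negligible on [0, eps]; stopping
   when K of these have been seen bounds their expected number by K + 1, and the
   expected number of all points of D is proportional to it because marks are
   independent of D. *)
Require Import Defs.
From HB Require Import structures.
From mathcomp Require Import ring lra.

Set Implicit Arguments.
Unset Strict Implicit.
Unset Printing Implicit Defensive.

Local Open Scope classical_set_scope.
Local Open Scope ring_scope.
Import Order.TTheory GRing.Theory Num.Theory.

(** * Configurations *)

(** The base intensity [mu] is a finite measurable function and nothing more, so the expected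
    intensity may be infinite and no moment bound is available at the start. The only a priori bound
    is pathwise: [lambda i t w] is a real number at each time. Lebesgue measure converts it into a
    bound on a count: off a set of times of small measure the intensity is bounded, while every
    heavy point raises it for longer than that. Truncation always means restricting the
    configuration to a box. The result is a finite configuration, where the equations hold by
    assumption, so that exceptional events concern the full configuration only and never depend on
    the level of truncation. The compensation formula is an equality of two measures on a
    predictable sigma-algebra of Omega x X which sees levels and marks. That sigma-algebra carries
    no information at time 0; this is why the defect is restricted to positive times and the points
    at time 0, almost surely absent, are treated apart. *)

Section configurations.
Context (R : realType) (d : nat).
Local Notation XX := (X R d).
Local Notation Om := (Omega R d).
Implicit Types (A B C D : set XX) (w : Om) (s : seq XX) (g : XX -> \bar R).

Lemma config_eq (w w' : Om) : (forall A, N w A = N w' A) -> w = w'.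
Proof.
case: w => f ef; case: w' => f' ef' /= e.
have {}e : f = f' by apply/funext => A; exact: (e A).
by rewrite e in ef *; congr Config; exact: Prop_irrelevance.
Qed.

Lemma config_seqE w : exists s : nat -> option XX,
  (forall A, N w A = \sum_(n <oo) oapp (fun x => (\d_x : {measure set XX -> \bar R}) A) 0%E (s n))%E.
Proof.
case: w => f [s es]; exists s => A /=.
rewrite /N /= es /sum_dirac /mseries; apply: congr_lim; apply/funext => n.
by apply: eq_bigr => i _; case: (s i).
Qed.

Lemma N_integralE w (s : nat -> option XX) :
  (forall A, N w A = \sum_(n <oo) oapp (fun x => (\d_x : {measure set XX -> \bar R}) A) 0%E (s n))%E ->
  forall D g, measurable D -> (forall x, D x -> 0 <= g x)%E ->
   measurable_fun D g ->
  (\int[N w]_(x in D) g x = \sum_(n <oo) oapp (g \_ D) 0%E (s n))%E.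
Proof.
move=> es D g mD g0 mg.
rewrite (@eq_measure_integral _ _ _ _ (sum_dirac s)); last first.
  move=> A _ _; rewrite es /sum_dirac /= /mseries; apply: congr_lim.
  by apply/funext => n; apply: eq_bigr => i _; case: (s i).
rewrite /sum_dirac ge0_integral_measure_series//.
apply: congr_lim; apply/funext => n; apply: eq_bigr => i _.
case: (s i) => [x|] /=; last by rewrite integral_measure_zero.
rewrite integral_dirac// diracE patchE.
by case: (x \in D); rewrite ?mul1e ?mul0e.
Qed.

Lemma nneseries_finE (f : nat -> \bar R) (m : nat) :
  (forall i, (m <= i)%N -> f i = 0%E) ->
  (\sum_(n <oo) f n = \sum_(0 <= n < m) f n)%E.
Proof.
move=> f0; apply/cvg_lim => //; apply: cvg_near_cst; exists m => // n /= mn.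
rewrite (big_cat_nat (n := m)) //= [X in (_ + X)%E]big1_seq ?adde0//.
by move=> i /=; rewrite mem_index_iota => /andP[/f0].
Qed.

Lemma sum_onthE T (f : T -> \bar R) (s : seq T) :
  (\sum_(n <oo) oapp f 0%E (onth s n) = \sum_(x <- s) f x)%E.
Proof.
rewrite (@nneseries_finE _ (size s)); last first.
  by move=> i si; rewrite onth_default.
elim: s => [|x s IHs] /=; first by rewrite big_nil big_geq.
by rewrite big_nat_recl//= big_cons IHs.
Qed.

Lemma N_finiteE s A :
  N (finite_config s : Om) A = (\sum_(x <- s) (\d_x : {measure set XX -> \bar R}) A)%E.
Proof.
rewrite -sum_onthE /N /= /sum_dirac /= /mseries; apply: congr_lim.
by apply/funext => n; apply: eq_bigr => i _; case: (onth s i).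
Qed.

Lemma N_finite_integralE s D g : measurable D -> (forall x, D x -> 0 <= g x)%E ->
   measurable_fun D g ->
  (\int[N (finite_config s : Om)]_(x in D) g x = \sum_(x <- s | x \in D) g x)%E.
Proof.
move=> mD g0 mg; rewrite (@N_integralE _ (onth s))//; last first.
  by move=> A; rewrite sum_onthE N_finiteE.
by rewrite sum_onthE [RHS]big_mkcond/=; apply: eq_bigr => x _; rewrite patchE.
Qed.

Lemma finite_config_perm s s' : perm_eq s s' ->
  finite_config s = finite_config s' :> Om.
Proof.
by move=> ss; apply: config_eq => A; rewrite !N_finiteE; exact: perm_big.
Qed.

(** The restriction of [w] to [C]. It is a configuration because the points outside [C] can be
    erased from an enumeration of [w]. *)
Program Definition rconf C w : Om := @Config R d (fun A => N w (A `&` C)) _.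
Next Obligation.
move=> C w; have [s es] := config_seqE w.
exists (fun n => if s n is Some x then if x \in C then Some x else None else None).
apply/funext => A; rewrite es /sum_dirac /= /mseries; apply: congr_lim.
apply/funext => n; apply: eq_bigr => i _; case: (s i) => [x|] //=.
by rewrite diracE in_setI; case: (x \in C); rewrite ?andbT ?andbF// diracE.
Qed.

Lemma N_rconf C w A : N (rconf C w) A = N w (A `&` C).
Proof. by []. Qed.

Lemma rconf_integralE C w D g : measurable C -> measurable D ->
  (forall x, D x -> 0 <= g x)%E -> measurable_fun D g ->
  (\int[N (rconf C w)]_(x in D) g x = \int[N w]_(x in D `&` C) g x)%E.
Proof.
move=> mC mD g0 mg.
have [s es] := config_seqE w.
have es' A : N (rconf C w) A = (\sum_(n <oo) oapp (fun x => (\d_x : {measure set XX -> \bar R}) A) 0%E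
   (if s n is Some x then if x \in C then Some x else None else None))%E.
  rewrite N_rconf es; apply: congr_lim.
  apply/funext => n; apply: eq_bigr => i _; case: (s i) => [x|] //=.
  by rewrite diracE in_setI; case: (x \in C); rewrite ?andbT ?andbF// diracE.
rewrite (N_integralE es')// (N_integralE es)//; first last.
- exact: measurable_funS mg.
- by move=> x [/g0].
- exact: measurableI.
apply: congr_lim; apply/funext => n; apply: eq_bigr => i _.
case: (s i) => [x|] //=; rewrite patchE in_setI.
by case: (x \in C); rewrite ?andbT ?andbF//= patchE.
Qed.

Lemma rconf_finite C w : (N w C < +oo)%E ->
  exists s, rconf C w = finite_config s /\ {in s, forall x, C x}.
Proof.
move=> wC; have [s es] := config_seqE w.
pose f n : \bar R := oapp (fun x => (\d_x : {measure set XX -> \bar R}) C) 0%E (s n).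
have f0 n : (0 <= f n)%E by rewrite /f; case: (s n).
(* If points of the enumeration lay in [C] at arbitrarily large indices, the mass of [C] would
   exceed every integer. *)
have [m fm] : exists m, forall n, (m <= n)%N -> f n = 0%E.
  apply: contrapT => /forallNP nm.
  suff K k : ((k%:R)%:E <= N w C)%E.
    have : N w C \is a fin_num by rewrite ge0_fin_numE.
    move=> /fineK e; have := K (Num.truncn (fine (N w C))).+1.
    by rewrite -e lee_fin leNgt truncnS_gt.
  have [m km] : exists m, (k%:R%:E <= \sum_(0 <= i < m) f i)%E.
    elim: k => [|k [m km]]; first by exists 0%N; rewrite big_geq.
    move: (nm m) => /existsNP[n /not_implyP[mn fn]]; exists n.+1.
    rewrite (big_cat_nat (n := m)) ?(leq_trans mn)//= big_nat_recr//=.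
    rewrite -addn1 natrD EFinD leeD// -[leLHS]add0e leeD ?sume_ge0//.
    by move: fn; rewrite /f; case: (s n) => [x|] //=; rewrite diracE; case: (x \in C).
  rewrite es; apply: (le_trans km); rewrite -/(f _); exact: nneseries_lim_ge.
pose r := pmap (fun i => if s i is Some x then if x \in C then Some x else None else None)
  (iota 0 m).
exists r; split.
  apply: config_eq => A; rewrite N_finiteE N_rconf es (@nneseries_finE _ m); last first.
    move=> i /fm; rewrite /f; case: (s i) => //= x; rewrite !diracE in_setI.
    by case: (x \in C); rewrite ?andbF// => -[] /eqP; rewrite oner_eq0.
  rewrite /r /index_iota subn0; elim: (iota 0 m) => [|i t IHt] /=; first by rewrite !big_nil.
  rewrite big_cons IHt; case: (s i) => [x|] /=; last by rewrite add0e.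
  rewrite diracE in_setI; case: (x \in C) => /=; last by rewrite andbF add0e.
  by rewrite andbT big_cons diracE.
move=> x; rewrite mem_pmap => /mapP[i _]; case: (s i) => // y; case: ifPn => //.
by rewrite inE => Cy [->].
Qed.

End configurations.

Section finite_sums_of_diracs.
Context d (T : measurableType d) (R : realType).

Lemma integral_msum_dirac (x0 : T) (l : seq T) (g : T -> R) :
  measurable_fun setT g ->
  (\int[msum (fun i => \d_(nth x0 l i) : {measure set T -> \bar R}) (size l)]_x (g x)%:E =
   (\sum_(x <- l) g x)%:E)%E.
Proof.
move=> mg; have mEg : measurable_fun setT (EFin \o g) by exact/measurable_EFinP.
have H (h : T -> R) : measurable_fun setT h -> (forall x, 0 <= h x) ->
  (\int[msum (fun i => \d_(nth x0 l i) : {measure set T -> \bar R}) (size l)]_x (h x)%:E =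
   (\sum_(x <- l) h x)%:E)%E.
  move=> mh h0; rewrite ge0_integral_measure_sum//; first last.
  - exact/measurable_EFinP.
  - by move=> x _; rewrite lee_fin.
  rewrite (big_nth x0) big_mkord -sumEFin; apply: eq_bigr => i _.
  by rewrite integral_dirac ?diracT ?mul1e//; exact/measurable_EFinP.
have -> : \sum_(x <- l) g x = \sum_(x <- l) g^\+ x - \sum_(x <- l) g^\- x.
  by rewrite -sumrB; apply: eq_bigr => x _; rewrite -[in LHS](funrposBneg g).
rewrite integralE EFinB; congr (_ - _)%E.
  rewrite -H; [|exact: measurable_funrpos|exact: funrpos_ge0].
  by apply: eq_integral => x _; rewrite funeposE /= /funrpos EFin_max.
rewrite -H; [|exact: measurable_funrneg|exact: funrneg_ge0].
by apply: eq_integral => x _; rewrite funenegE /= /funrneg EFin_max EFinN.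
Qed.

End finite_sums_of_diracs.

(** * Moebius inversion and factorial measures *)

Section mobius.
Local Open Scope nat_scope.
Context (T : finType) (R : pzRingType).
Implicit Types (I J K S : {set T}) (F : {set T} -> R).

(** The Moebius transform on the lattice of subsets; on the points of a configuration it is the
    operator T^n, see [Top_select]. *)
Definition mobius F I : R := (\sum_(K : {set T} | K \subset I) (-1) ^+ (#|I| - #|K|) * F K)%R.

(** Adding a fixed element of [S] pairs the subsets which avoid it with those which contain it, and
    reverses the sign. *)
Lemma sum_subset_sign S : (\sum_(I : {set T} | I \subset S) (-1) ^+ #|I| = (S == finset.set0)%:R :> R)%R.
Proof.
have [->|] := eqVneq S finset.set0.
  under eq_bigl do rewrite finset.subset0.
  by rewrite big_pred1_eq cards0 expr0.
case/set0Pn => x xS.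
rewrite (bigID (fun I : {set T} => x \in I))/=.
rewrite [X in (X + _)%R](reindex_onto (fun I => x |: I) (fun I => I :\ x)); last first.
  by move=> I /andP[_ xI]; rewrite finset.setD1K.
rewrite -[RHS](subrr (\sum_(I : {set T} | (I \subset S) && (x \notin I)) (-1) ^+ #|I|)%R).
rewrite addrC; congr (_ + _)%R; rewrite -sumrN.
apply: eq_big => [I|I /andP[/andP[_ _] /eqP e]].
  rewrite finset.subUset finset.sub1set xS finset.setU11 /= andbT; congr (_ && _).
  by apply/eqP/idP => [<-|xI]; [rewrite !inE eqxx|rewrite finset.setU1K].
by rewrite cardsU1 -{1}e !inE eqxx /= exprS mulN1r.
Qed.

(** After exchanging the sums, the coefficient of [F K] is the signed sum over the subsets of the
    complement of [K], which vanishes unless [K] is everything. *)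
Lemma sum_mobius F : (\sum_(I : {set T}) mobius F I = F finset.setT)%R.
Proof.
rewrite /mobius (exchange_big_dep xpredT)//= (bigD1 finset.setT)//=.
rewrite [X in (_ + X)%R]big1 ?addr0; last first.
  move=> K KT; rewrite -big_distrl/=.
  rewrite (reindex_onto (fun I => K :|: I) (fun I => I :\: K)); last first.
    by move=> I KI; rewrite -{1}(finset.setIidPr KI) finset.setID.
  rewrite (eq_big (fun I : {set T} => I \subset ~: K) (fun I : {set T} => ((-1) ^+ #|I|)%R)).
  - rewrite sum_subset_sign; case: eqP => [e|]; last by rewrite mul0r.
    by move: KT; rewrite -(finset.setCK K) e finset.setC0 eqxx.
  - move=> I; rewrite finset.subsetUl /= finset.setDUl finset.setDv finset.set0U finset.eqEsubset finset.subsetDl /=.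
    by rewrite finset.subsetD subxx /= finset.disjoints_subset.
  - move=> I /andP[_ /eqP]; rewrite finset.setDUl finset.setDv finset.set0U => IK.
    suff -> : #|K :|: I| = #|K| + #|I| by rewrite addKn.
    have KI : K :&: I = finset.set0.
      by apply: disjoint_setI0; rewrite disjoint_sym; apply/finset.setDidPl.
    by rewrite -cardsUI KI cards0 addn0.
rewrite (big_pred1 finset.setT) ?subnn ?expr0 ?mul1r// => I.
by rewrite finset.subTset.
Qed.

(* Each set of size n is listed by exactly n! tuples without repetition. *)
Lemma sum_uniq_tuples n (m : {set T} -> R) :
  (\sum_(p : n.-tuple T | uniq p) m [set i in p] = (n`!)%:R * \sum_(I : {set T} | #|I| == n) m I)%R.
Proof.
rewrite (partition_big (fun p : n.-tuple T => [set i in p]) (fun I : {set T} => #|I| == n))/=; last first.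
  by move=> p up; rewrite cardsE (card_uniqP up) size_tuple.
rewrite mulr_sumr; apply: eq_bigr => I /eqP In.
rewrite (eq_bigr (fun=> m I)); last by move=> p /andP[_ /eqP ->].
rewrite sumr_const mulr_natl; congr (_ *+ _)%R.
rewrite -In -(ffactnn #|I|) -card_uniq_tuples In -cardsE; apply: eq_card => p; rewrite !inE.
apply/andP/andP => [[up /eqP pI]|[pI up]]; split => //.
  by apply/allP => x xp; change (x \in I); rewrite -pI inE.
rewrite eqEcard cardsE (card_uniqP up) size_tuple In leqnn andbT.
by apply/fintype.subsetP => x; rewrite inE => xp; exact: (allP pI).
Qed.

End mobius.

Section mobius_series.
Context (T : finType) (R : numFieldType).

(** The factorial cancels the number of orderings of a set of [n.+1] elements. Every nonempty set is
    reached as its size is at most [m]; the series omits the empty set, whose Moebius transform is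
    [F] there. *)
Lemma sum_mobius_series (F : {set T} -> R) (m : nat) : (#|T| <= m)%N ->
  \sum_(0 <= n < m) (n.+1`!%:R^-1 * \sum_(p : n.+1.-tuple T | uniq p) mobius F [set i in p]) =
  F finset.setT - F finset.set0.
Proof.
move=> Tm; under eq_bigr => n _ do rewrite sum_uniq_tuples mulKf ?pnatr_eq0 -?lt0n ?fact_gt0//.
rewrite big_mkord (exchange_big_dep (fun I : {set T} => I != finset.set0))/=; last first.
  by move=> n I _ /eqP In; rewrite -cards_eq0 In.
rewrite -(sum_mobius F) [in RHS](bigD1 finset.set0)//= {2}/mobius.
under [X in _ = X + _ - _]eq_bigl do rewrite finset.subset0.
rewrite big_pred1_eq cards0 expr0 mul1r addrC addKr.
apply: eq_bigr => I; rewrite -cards_eq0 -lt0n => I0.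
have Im : (#|I|.-1 < m)%N by rewrite (leq_trans _ Tm)// prednK// max_card.
rewrite (big_pred1 (Ordinal Im))// => n /=; rewrite -(inj_eq val_inj) /=.
by rewrite -[in LHS](prednK I0) eqSS eq_sym.
Qed.

End mobius_series.

Section set_function_integral.
Context d (T : measurableType d) (R : realType).
Import HBNNSimple.

(* The factorial measures are only known to be set functions a priori, hence
   the absence of a measure structure on m1 and m2. *)
Lemma eq_set_function_integral (D : set T) (m1 m2 : set T -> \bar R) (f : T -> \bar R) :
  (forall A, measurable A -> A `<=` D -> m1 A = m2 A) ->
  integral m1 D f = integral m2 D f.
Proof.
move=> m12.
(* Meant for the positive and negative parts of [f] cut off outside [D]: a simple function below
   them has its nonzero level sets in [D], where the two set functions agree. *)
have H (g : T -> \bar R) : (forall x, ~ D x -> g x = 0%E) ->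
    forall h : {nnsfun T >-> R}, (forall x, ((h x)%:E <= g x)%E) ->
    sintegral m1 h = sintegral m2 h.
  move=> g0 h hg; rewrite /sintegral; apply: eq_fsbigr => r _.
  have [->|r0] := eqVneq r 0; first by rewrite !mul0e.
  rewrite m12// => x /= hx; apply: contrapT => /g0 gx; move: (hg x) r0.
  by rewrite gx hx lee_fin -hx => h0; rewrite eq_le h0 fun_ge0.
rewrite /integral; congr (ereal_sup _ - ereal_sup _)%E; apply: eq_imagel => h /=.
  by apply: H => x Dx; rewrite funeposE patchE memNset// maxxx.
by apply: H => x Dx; rewrite funenegE patchE memNset// oppe0 maxxx.
Qed.

End set_function_integral.

(** * Factorial measures of finite and restricted configurations *)

Section factorial_measures.
Context (R : realType) (d : nat).
Local Notation XX := (X R d).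
Local Notation Om := (Omega R d).
Implicit Types (w : Om) (s : seq XX).

Lemma measurable_rcons d1 d2 (S : measurableType d1) (T : measurableType d2) n
    (f : S -> n.-tuple T) (g : S -> T) :
  measurable_fun setT f -> measurable_fun setT g ->
  measurable_fun setT (fun z => [tuple of rcons (f z) (g z)]).
Proof.
move=> mf mg; apply/measurable_fun_tnthP => i.
have [ni|ni] := ltnP i n.
  rewrite (_ : _ \o _ = (fun t => tnth t (Ordinal ni)) \o f); last first.
    apply/funext => z /=; rewrite (tnth_nth (g z)) (tnth_nth (g z)) /=.
    by rewrite nth_rcons size_tuple ni.
  by apply: measurableT_comp mf; exact: measurable_tnth.
rewrite (_ : _ \o _ = g) //.
apply/funext => z /=; rewrite (tnth_nth (g z)) /=.
by rewrite nth_rcons size_tuple ltnNge ni /=; case: ifP.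
Qed.

Definition select s n (p : n.-tuple 'I_(size s)) : n.-tuple XX :=
  [tuple of map (tnth (in_tuple s)) p].

Lemma select_rcons s n (p : n.-tuple 'I_(size s)) j :
  select [tuple of rcons p j] = [tuple of rcons (select p) (tnth (in_tuple s) j)].
Proof. by apply: val_inj; rewrite /= map_rcons. Qed.

(** Indices are distinct, points need not be: a point repeated in [s] occurs with its multiplicity,
    as in the factorial measures. *)
Definition injections s n :=
  [seq select p | p : n.-tuple 'I_(size s) <- enum {: n.-tuple 'I_(size s)} & uniq p].

Lemma sum_injections (V : nmodType) s n (F : n.-tuple XX -> V) :
  \sum_(x <- injections s n) F x = \sum_(p : n.-tuple 'I_(size s) | uniq p) F (select p).
Proof. by rewrite /injections big_map big_filter big_enum_cond. Qed.

Lemma sum_uniq_rcons (V : nmodType) (T : finType) n (F : n.+1.-tuple T -> V) :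
  \sum_(q : n.+1.-tuple T | uniq q) F q =
  \sum_(p : n.-tuple T | uniq p) \sum_(j | j \notin val p) F [tuple of rcons p j].
Proof.
rewrite pair_big_dep/=.
pose h (pj : n.-tuple T * T) : n.+1.-tuple T := [tuple of rcons pj.1 pj.2].
pose k (q : n.+1.-tuple T) : n.-tuple T * T := ([tuple of belast (thead q) (behead q)], last (thead q) (behead q)).
rewrite (reindex h) /=; last first.
  exists k => [[p j] _|q _]; rewrite /k /h /=.
    congr pair; last by rewrite /thead; case: p => -[|a l] //= il; rewrite ?last_rcons.
    apply: val_inj => /=; case: p => -[|a l] //= il; rewrite /thead (tnth_nth j) /=.
    by rewrite belast_rcons.
  by apply: val_inj; rewrite /= -lastI [in RHS](tuple_eta q).
by apply: eq_bigl => -[p j] /=; rewrite rcons_uniq andbC.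
Qed.

Lemma sum_tnth (V : nmodType) T n (F : T -> V) (x : n.-tuple T) :
  \sum_(j < n) F (tnth x j) = \sum_(y <- x) F y.
Proof. by rewrite big_tuple. Qed.

Lemma factorial_measure0 w (A : set (1.-tuple XX)) :
  factorial_measure w A = N w [set x | A [tuple x]].
Proof. by []. Qed.

Lemma factorial_measureS w n (A : set (n.+2.-tuple XX)) :
  factorial_measure w A = (\int[@factorial_measure _ _ w n]_x
     (\int[N w]_z (\1_A [tuple of rcons x z])%:E -
      \sum_(j < n.+1) (\1_A [tuple of rcons x (tnth x j)])%:E))%E.
Proof. by []. Qed.

(** By induction the measure of order n is a finite sum of Dirac masses. The sum subtracted in the
    recursion cancels the indices already used, which leaves the injective extensions. *)
Lemma factorial_measure_finite s n (A : set (n.+1.-tuple XX)) : measurable A ->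
  factorial_measure (finite_config s : Om) A =
  (\sum_(x <- injections s n.+1) (\1_A x : R))%:E.
Proof.
elim: n A => [|n IHn] A mA.
  rewrite factorial_measure0 N_finiteE sum_injections sum_uniq_rcons /=.
  rewrite (big_pred1 [tuple])/=; last by move=> p; rewrite tuple0.
  rewrite big_tnth /= -sumEFin; apply: eq_bigr => j _.
  rewrite diracE indicE; congr (_%:R%:E); congr nat_of_bool.
  rewrite (_ : select _ = [tuple tnth (in_tuple s) j]); last exact: val_inj.
  by apply/idP/idP; rewrite !inE.
pose x0 : n.+1.-tuple XX := nseq_tuple _ classical_sets.point.
rewrite factorial_measureS.
rewrite (@eq_set_function_integral _ _ _ _ _
  (msum (fun i => \d_(nth x0 (injections s n.+1) i) : {measure set _ -> \bar R}) (size (injections s n.+1)))); last first.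
  move=> B mB _; rewrite IHn// /msum (big_nth x0) big_mkord -sumEFin.
  by apply: eq_bigr => i _.
pose G (x : n.+1.-tuple XX) : R := \sum_(z <- s) \1_A [tuple of rcons x z] -
  \sum_(j < n.+1) \1_A [tuple of rcons x (tnth x j)].
have mr (x : n.+1.-tuple XX) : measurable_fun setT (fun z : XX => \1_A [tuple of rcons x z] : R).
  apply: (measurableT_comp (measurable_indic mA)).
  by apply: measurable_rcons.
transitivity (\int[msum (fun i => \d_(nth x0 (injections s n.+1) i) : {measure set _ -> \bar R}) (size (injections s n.+1))]_x (G x)%:E)%E.
  apply: eq_integral => x _; rewrite N_finite_integralE//; last first.
    by apply/measurable_EFinP; exact: mr.
  rewrite /G EFinB -!sumEFin; congr (_ - _)%E.
  by apply: eq_bigl => z; rewrite in_setT.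
rewrite integral_msum_dirac; last first.
  apply: measurable_funB; apply: measurable_sum => z.
    by apply: (measurableT_comp (measurable_indic mA)); exact: measurable_rcons.
  apply: (measurableT_comp (measurable_indic mA)); apply: measurable_rcons => //.
  exact: measurable_tnth.
congr (_%:E); rewrite !sum_injections [RHS]sum_uniq_rcons; apply: eq_bigr => p up.
rewrite /G (sum_tnth (fun y => \1_A [tuple of rcons (select p) y])).
rewrite big_tnth (bigID (mem (val p)))/= big_map.
rewrite -[X in X + _ - _](big_uniq _ up)/= addrC addKr.
by apply: eq_bigr => j _; rewrite select_rcons.
Qed.

(** For [A] made of tuples with entries in [C], the inner integrand vanishes when the last point
    leaves [C] and the outer one when another does. This brings the integrals of truncated functions
    down to a finite configuration. *)
Lemma factorial_measure_rconf w C n (A : set (n.+1.-tuple XX)) :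
  (A `<=` [set x | forall j, C (tnth x j)]) ->
  factorial_measure (rconf C w) A = factorial_measure w A.
Proof.
elim: n A => [|n IHn] A AC.
  rewrite !factorial_measure0 N_rconf setIidl// => x /AC /(_ ord0).
  by rewrite (tnth_nth x).
rewrite !factorial_measureS.
have C1 (x : n.+1.-tuple XX) z : A [tuple of rcons x z] -> C z.
  by move=> /AC /(_ ord_max); rewrite (tnth_nth z) /= nth_rcons size_tuple ltnn eqxx.
have C2 (x : n.+1.-tuple XX) z : A [tuple of rcons x z] -> forall j, C (tnth x j).
  move=> /AC + j => /(_ (widen_ord (leqnSn _) j)).
  by rewrite !(tnth_nth z) /= nth_rcons size_tuple ltn_ord.
transitivity (\int[@factorial_measure _ _ (rconf C w) n]_x
         (\int[N w]_z (\1_A [tuple of rcons x z])%:E -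
          \sum_(j < n.+1) (\1_A [tuple of rcons x (tnth x j)])%:E))%E.
  congr (integral _ _ _); apply/funext => x; congr (_ - _)%E.
  have e : (fun z => (\1_A [tuple of rcons x z])%:E : \bar R) =
           (fun z => (\1_A [tuple of rcons x z])%:E) \_ C.
    apply/funext => z; rewrite patchE; case: ifPn => // /negP zC.
    by rewrite indicE memNset//; apply: contra_not zC => /C1; rewrite inE.
  rewrite e -!integral_mkcond; apply: eq_measure_integral => B _ BC.
  by rewrite N_rconf setIidl.
set G := (X in integral _ _ X).
have e : G = G \_ [set x | forall j, C (tnth x j)].
  apply/funext => x; rewrite patchE; case: ifPn => // /negP xC.
  have nA z : A [tuple of rcons x z] = False.
    apply/propext; split => // /C2; apply: contra_not xC; by rewrite inE.
  rewrite /G integral0_eq; last by move=> z _; rewrite indicE memNset// nA.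
  by rewrite big1 ?sube0// => j _; rewrite indicE memNset// nA.
have h (mu : set (n.+1.-tuple XX) -> \bar R) :
    integral mu setT G = integral mu [set x | forall j, C (tnth x j)] G.
  by rewrite /integral patch_setT -e.
by rewrite !h; apply: eq_set_function_integral => B _; exact: IHn.
Qed.

End factorial_measures.

Section state_space_measurability.
Context (R : realType) (d : nat).
Local Notation XX := (X R d).
Local Notation Om := (Omega R d).

Lemma measurable_sval : measurable_fun setT (sval : XX -> 'I_d.+1 * R * R * R).
Proof. by move=> _ A mA; rewrite setTI; exists A => //; rewrite setTI. Qed.

Lemma measurable_kind : measurable_fun setT (@kind R d).
Proof.
rewrite (_ : @kind R d = fst \o fst \o fst \o sval)//.
by apply: (measurableT_comp _ measurable_sval); do 2!apply: measurableT_comp => //.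
Qed.

Lemma measurable_time : measurable_fun setT (@time R d).
Proof.
rewrite (_ : @time R d = snd \o fst \o fst \o sval)//.
by apply: (measurableT_comp _ measurable_sval); do 2!apply: measurableT_comp => //.
Qed.

Lemma measurable_level : measurable_fun setT (@level R d).
Proof.
rewrite (_ : @level R d = snd \o fst \o sval)//.
by apply: (measurableT_comp _ measurable_sval); apply: measurableT_comp.
Qed.

Lemma measurable_mark : measurable_fun setT (@mark R d).
Proof.
rewrite (_ : @mark R d = snd \o sval)//.
exact: (measurableT_comp _ measurable_sval).
Qed.

Lemma time_ge0 (x : XX) : 0 <= time x.
Proof. by have /and3P[] := svalP x. Qed.

Lemma level_ge0 (x : XX) : 0 <= level x.
Proof. by have /and3P[] := svalP x. Qed.

Lemma mark_ge0 (x : XX) : 0 <= mark x.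
Proof. by have /and3P[] := svalP x. Qed.

Definition box (T M : R) : set XX := [set x | (time x <= T) && (level x <= M)].

Lemma measurable_upto T : measurable (upto T : set XX).
Proof.
rewrite [upto T](_ : _ = @time R d @^-1` `]-oo, T]); last first.
  by apply/seteqP; split => x /=; rewrite in_itv.
by rewrite -[X in measurable X]setTI; exact: measurable_time.
Qed.

Lemma measurable_box T M : measurable (box T M).
Proof.
rewrite (_ : box T M = upto T `&` @level R d @^-1` `]-oo, M]); last first.
  by apply/seteqP; split => x /=; rewrite /upto /= in_itv /= => /andP.
apply: measurableI; first exact: measurable_upto.
by rewrite -[X in measurable X]setTI; exact: measurable_level.
Qed.

Lemma measurable_N (A : set XX) : measurable A ->
  measurable_fun setT (fun w : Om => N w A).
Proof.
move=> mA _ B mB; rewrite setTI; apply: sub_sigma_algebra.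
by exists A => //; exists B.
Qed.

Lemma measurable_finite_config n (J : {set 'I_n}) :
  measurable_fun setT (fun x : n.-tuple XX => finite_config [seq tnth x j | j in J] : Om).
Proof.
apply: (@measurability _ _ (n.-tuple XX) Om setT _ (evaluation_sets setT) erefl).
move=> _ [_ [A [mA _]] [B mB] <-] <-; rewrite setTI.
have e (x : n.-tuple XX) : N (finite_config [seq tnth x j | j in J] : Om) A =
    (\sum_(j <- enum J) (\1_A (tnth x j))%:E)%E by rewrite N_finiteE big_map.
rewrite [X in measurable X](_ : _ =
  (fun x : n.-tuple XX => \sum_(j <- enum J) (\1_A (tnth x j))%:E)%E @^-1` B); last first.
  by apply/seteqP; split => x /=; rewrite e.
rewrite -[X in measurable X]setTI; apply: emeasurable_sum => // j; apply/measurable_EFinP.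
apply: (measurableT_comp (measurable_indic mA)); exact: measurable_tnth.
Qed.

Lemma measurable_Top n (F : Om -> R) : measurable_fun setT F ->
  measurable_fun setT (fun x : n.-tuple XX => Top x F).
Proof.
move=> mF; apply: measurable_sum => J; apply: measurable_funM => //.
apply: (measurableT_comp mF); exact: measurable_finite_config.
Qed.

(** As [p] is injective, sets of positions in [p] correspond to the subsets of the set of indices
    listed by [p], with the same cardinals. *)
Lemma Top_select (F : Om -> R) (s : seq XX) n (p : n.-tuple 'I_(size s)) : uniq p ->
  Top (select p) F =
  mobius (fun K : {set 'I_(size s)} => F (finite_config [seq tnth (in_tuple s) i | i in K]))
    [set i in p].
Proof.
move=> up; rewrite /Top /mobius.
have ip : injective (tnth p) by apply/tuple_uniqP.
pose h (J : {set 'I_n}) := (tnth p @: J)%SET.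
have pE : [set i in p] = h finset.setT.
  apply/setP => i; rewrite inE; apply/idP/imsetP => [/tnthP[j ->]|[j _ ->]].
    by exists j.
  exact: mem_tnth.
rewrite (reindex_onto h (fun K => tnth p @^-1: K))%SET /=; last first.
  move=> K Kp; apply/setP => i; apply/imsetP/idP => [[j]|iK].
    by rewrite inE => ? ->.
  have : i \in [set i in p] by apply: (fintype.subsetP Kp).
  by rewrite inE => /tnthP[j ij]; exists j => //; rewrite inE -ij.
apply: eq_big => [J|J _].
  rewrite pE /h imsetS ?finset.subsetT//=; apply/esym/eqP/setP => j.
  by rewrite !inE mem_imset.
rewrite pE /h !card_imset// cardsT card_ord; congr (_ * F _).
apply: finite_config_perm; rewrite /image_mem.
rewrite (eq_map (g := tnth (in_tuple s) \o tnth p)); last first.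
  by move=> j; rewrite tnth_map.
rewrite map_comp; apply: perm_map; apply: uniq_perm.
- by rewrite map_inj_uniq// enum_uniq.
- exact: enum_uniq.
move=> i; rewrite mem_enum; apply/mapP/imsetP => -[j]; rewrite ?mem_enum => jJ ->;
  by exists j; rewrite ?mem_enum.
Qed.

Lemma factorial_integral_finite n (f : n.+1.-tuple XX -> R) s : measurable_fun setT f ->
  factorial_integral f (finite_config s : Om) =
  (\sum_(p : n.+1.-tuple 'I_(size s) | uniq p) f (select p))%:E.
Proof.
move=> mf; pose x0 : n.+1.-tuple XX := nseq_tuple _ classical_sets.point.
rewrite -sum_injections -(integral_msum_dirac x0)//.
apply: eq_set_function_integral => B mB _; rewrite factorial_measure_finite//.
by rewrite /msum (big_nth x0) big_mkord -sumEFin.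
Qed.

Lemma factorial_integral_truncated (T M : R) n (F : Om -> R) w :
  factorial_integral (@truncated_Top R d T M F n.+1) w =
  factorial_integral (@truncated_Top R d T M F n.+1) (rconf (box T M) w).
Proof.
pose D := [set x : n.+1.-tuple XX | forall j, box T M (tnth x j)].
pose f x := (@truncated_Top R d T M F n.+1 x)%:E.
have fD : f = f \_ D.
  apply/funext => x; rewrite patchE; case: ifPn => //= xD.
  rewrite /f /truncated_Top; case: forallP => [jD|_]; last by rewrite mulr0.
  by move: xD; rewrite notin_setE.
have h (mu : set (n.+1.-tuple XX) -> \bar R) : integral mu setT f = integral mu D f.
  by rewrite /integral patch_setT -fD.
rewrite /factorial_integral -/f !h; apply: eq_set_function_integral => A _ AD.
by rewrite factorial_measure_rconf.
Qed.

Lemma measurable_truncated_Top (T M : R) n (F : Om -> R) : measurable_fun setT F ->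
  measurable_fun setT (@truncated_Top R d T M F n).
Proof.
move=> mF; apply: measurable_funM; first exact: measurable_Top.
rewrite (_ : (fun _ => _) = \1_(\bigcap_(j in [set: 'I_n]) ((fun x => tnth x j) @^-1` box T M))); last first.
  apply/funext => x; rewrite indicE; congr (nat_of_bool _)%:R.
  apply/forallP/idP => [xb|]; first by rewrite inE => j _; exact: xb.
  by rewrite inE => xb j; exact: xb.
apply: measurable_indic; apply: fin_bigcap_measurable => // j _.
by rewrite -[X in measurable X]setTI; apply: measurable_tnth => //; exact: measurable_box.
Qed.

(** For any functional the partial sums are stationary as soon as [m] reaches the number of points
    of [w] in the box. *)
Lemma pseudo_chaotic_expansion (T M : R) (F : Om -> R) w : measurable_fun setT F ->
  (N w (box T M) < +oo)%E ->
  (fun m => \sum_(0 <= n < m) ((n.+1)`!%:R^-1)%:E *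
     factorial_integral (@truncated_Top R d T M F n.+1) w)%E @ \oo -->
  (F (rconf (box T M) w) - F (finite_config [::]))%:E.
Proof.
move=> mF /rconf_finite[s [sE sb]].
apply: cvg_near_cst; exists (size s) => // m /= sm.
pose G (K : {set 'I_(size s)}) := F (finite_config [seq tnth (in_tuple s) i | i in K]).
rewrite (_ : F _ - F _ = G finset.setT - G finset.set0); last first.
  rewrite /G sE; congr (F _ - F _).
    congr finite_config; rewrite /image_mem (eq_enum (B := predT)); last by move=> i; rewrite inE.
    by rewrite -[LHS](map_tnth_enum (in_tuple s)).
  by congr finite_config; rewrite /image_mem enum_set0.
rewrite -(@sum_mobius_series _ _ _ m) ?card_ord// -sumEFin; apply: eq_bigr => n _.
rewrite factorial_integral_truncated sE factorial_integral_finite; last exact: measurable_truncated_Top.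
rewrite -EFinM; congr (_ * _)%:E; apply: eq_bigr => p up.
rewrite /truncated_Top Top_select//.
have -> : [forall j, (time (tnth (select p) j) <= T) && (level (tnth (select p) j) <= M)].
  by apply/forallP => j; apply: sb; rewrite tnth_map mem_tnth.
by rewrite mulr1.
Qed.

End state_space_measurability.

Section predictable_sections.
Context (R : realType) (d : nat).
Local Notation XX := (X R d).
Local Notation Om := (Omega R d).

Lemma predictable_sets_section (W : set (Om * R)) (w : Om) :
  predictable_sets W -> measurable [set t : R | W (w, t)].
Proof.
pose H := [set W : set (Om * R) | measurable [set t : R | W (w, t)]].
suff : @predictable_sets R d `<=` H by apply.
have mD : measurable [set t : R | ((setT : set Om) `*` `[0%R, +oo[) (w, t)].
  rewrite (_ : [set _ | _] = `[0%R, +oo[%classic) //.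
  by apply/seteqP; split => t /= => [[]|].
apply: smallest_sub; [split|].
- rewrite /H /= (_ : [set _ | _] = set0)//; exact: measurable0.
- by move=> A HA; rewrite /H /=; apply: measurableD.
- by move=> A HA; rewrite /H /=; apply: bigcupT_measurable.
- move=> _ [[A _ <-]|[s [t [A [_ _ ->]]]]]; rewrite /H /=.
    have [Aw|Aw] := pselect (A w).
      rewrite (_ : [set _ | _] = [set 0]); first exact: measurable_set1.
      by apply/seteqP; split => u /= => [[]|].
    rewrite (_ : [set _ | _] = set0); first exact: measurable0.
    by apply/seteqP; split => u /= => [[]|].
  have [Aw|Aw] := pselect (A w).
    rewrite (_ : [set _ | _] = `]s, t]%classic); first exact: measurable_itv.
    by apply/seteqP; split => u /= => [[]|].
  rewrite (_ : [set _ | _] = set0); first exact: measurable0.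
  by apply/seteqP; split => u /= => [[]|].
Qed.

Lemma measurable_predictable (Y : R -> Om -> R) (w : Om) : predictable Y ->
  measurable_fun [set t : R | 0 <= t] (Y ^~ w).
Proof.
move=> pY _ B mB; have := predictable_sets_section w (pY B mB).
rewrite [X in measurable X -> _](_ : _ = [set t : R | 0 <= t] `&` (Y ^~ w) @^-1` B)//.
by apply/seteqP; split => t /=; rewrite in_itv /= andbT => -[]; [case|].
Qed.

Definition accepted (lambda : 'I_d.+1 -> R -> Om -> R) (w : Om) : set XX :=
  [set x | level x <= lambda (kind x) (time x) w].

Definition kern (g : 'I_d.+1 -> 'I_d.+1 -> R -> R -> R) i T (x : XX) : R :=
  g i (kind x) (T - time x) (mark x).

Lemma measurable_fun_kind D (f : 'I_d.+1 -> XX -> R) :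
  (forall k, measurable_fun D (f k)) -> measurable_fun D (fun x => f (kind x) x).
Proof.
move=> mf; rewrite (_ : (fun x => _) =
  (fun x => \sum_(k < d.+1) \1_(@kind R d @^-1` [set k]) x * f k x)).
  apply: measurable_sum => k; apply: measurable_funM => //.
  apply: measurable_indic; rewrite -[X in measurable X]setTI.
  exact: measurable_kind.
apply/funext => x; rewrite (bigD1 (kind x))//= big1 ?addr0.
  by rewrite indicE mem_set ?mul1r.
by move=> k /eqP kx; rewrite indicE memNset ?mul0r//= => /esym.
Qed.

Lemma measurable_accepted lambda (w : Om) : (forall k, predictable (lambda k)) ->
  measurable (accepted lambda w).
Proof.
move=> pl; rewrite -[accepted _ _]setTI.
apply: measurable_fun_le => //; first exact: measurable_level.
apply: (measurable_fun_kind (f := fun k x => lambda k (time x) w)) => k.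
apply: (@measurable_comp _ _ _ _ _ _ [set t : R | 0 <= t] (fun t => lambda k t w) setT (@time R d)).
- rewrite (_ : [set _ | _] = `[0, +oo[%classic)//.
  by apply/seteqP; split => t /=; rewrite in_itv /= andbT.
- by move=> _ [x _ <-]; exact: time_ge0.
- exact: measurable_predictable.
- exact: measurable_time.
Qed.

Context (nu : 'I_d.+1 -> probability R R).

Lemma measurable_kern g i T : is_kernel nu g -> measurable_fun (upto T) (kern g i T).
Proof.
move=> kg; apply: (measurable_fun_kind (f := fun k x => g i k (T - time x) (mark x))) => k; have [mg _ _] := kg i k.
apply: (@measurable_comp _ _ _ _ _ _ [set ty : R * R | 0 <= ty.1 /\ 0 <= ty.2] (fun ty => g i k ty.1 ty.2) (upto T) (fun x : XX => (T - time x, mark x))) mg _.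
- rewrite (_ : [set _ | _] = `[0, +oo[%classic `*` `[0, +oo[%classic).
    by apply: measurableX.
  by apply/seteqP; split => t /=; rewrite !in_itv /= !andbT.
- by move=> _ [x xT <-] /=; rewrite subr_ge0; split=> //; exact: mark_ge0.
- apply: measurable_funTS; apply: measurable_fun_pair; last exact: measurable_mark.
  by apply: measurable_funB => //; exact: measurable_time.
Qed.

Lemma kern_ge0 g i T x : is_kernel nu g -> upto T x -> 0 <= kern g i T x.
Proof.
move=> kg xT; have [_ + _] := kg i (kind x); apply; last exact: mark_ge0.
by rewrite subr_ge0.
Qed.

Lemma excitationE lambda g i T w : (forall k, predictable (lambda k)) -> is_kernel nu g ->
  excitation g lambda i T w =
  (\int[N w]_(x in upto T `&` accepted lambda w) (kern g i T x)%:E)%E.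
Proof.
move=> pl kg; rewrite integral_mkcondr; apply: eq_integral => x _.
rewrite patchE; case: ifPn => [|/negP]; rewrite inE /accepted /=.
  by move=> ->; rewrite mulr1.
by move=> /negP/negbTE ->; rewrite mulr0.
Qed.

End predictable_sections.

(** * The process at finite configurations *)

Section finite_configurations.
Context (R : realType) (d : nat).
Local Notation XX := (X R d).
Local Notation Om := (Omega R d).
Context (nu : 'I_d.+1 -> probability R R) (P : probability Om R)
  (zeta phi : 'I_d.+1 -> 'I_d.+1 -> R -> R -> R) (mu : 'I_d.+1 -> R -> R)
  (lambda Z : 'I_d.+1 -> R -> Om -> R).
Hypothesis kernel_zeta : is_kernel nu zeta.
Hypothesis kernel_phi : is_self_excitation_kernel nu phi.
Hypothesis MSPD_Z : is_MSPD P zeta mu phi lambda Z.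

Let kphi : is_kernel nu phi. Proof. by case: kernel_phi. Qed.
Let plambda : forall k, predictable (lambda k). Proof. by case: MSPD_Z. Qed.

Lemma kern_phi_diag i T x : time x = T -> kern phi i T x = 0.
Proof.
by move=> xT; rewrite /kern xT subrr; case: kernel_phi => _ _; apply; exact: mark_ge0.
Qed.

Let mE T (w : Om) : measurable (upto T `&` accepted lambda w).
Proof. by apply: measurableI; [exact: measurable_upto|exact: measurable_accepted]. Qed.

Lemma filter_past (u : seq XX) (a t : R) : a < t ->
  [seq x <- u | time x < a] = [seq x <- [seq x <- u | time x < t] | time x < a].
Proof.
move=> at_; rewrite -filter_predI; apply: eq_filter => y /=.
by apply/idP/andP => [ya|[]//]; split => //; exact: lt_trans at_.
Qed.

Lemma size_past (s : seq XX) x (t : R) : x \in s -> time x < t ->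
  (size [seq y <- s | (time y < time x)%R] < size [seq y <- s | (time y < t)%R])%N.
Proof.
move=> xs xt; rewrite (filter_past _ xt).
have : x \in [seq y <- s | time y < t] by rewrite mem_filter xt.
move: [seq y <- s | time y < t] => v xv; rewrite size_filter.
rewrite -(count_predC (fun y => (time y < time x)%R) v) -[X in (X < _)%N]addn0 ltn_add2l.
by rewrite -has_count; apply/hasP; exists x => //=; rewrite ltxx.
Qed.

Let mkern g i T (A : set XX) : is_kernel nu g ->
  measurable_fun (upto T `&` A) (fun x => (kern g i T x)%:E).
Proof.
move=> kg; apply/measurable_EFinP.
apply: (measurable_funS _ _ (measurable_kern i kg)); [exact: measurable_upto|exact: subIsetl].
Qed.

Lemma intensity_finite i t s : 0 <= t ->
  lambda i t (finite_config s) = mu i t +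
  \sum_(x <- [seq x <- s | time x < t] | level x <= lambda (kind x) (time x) (finite_config s)) kern phi i t x.
Proof.
move=> t0; have [_] := MSPD_finite MSPD_Z s i t0.
rewrite (excitationE _ _ _ plambda kphi) N_finite_integralE//; first last.
- exact: mkern.
- by move=> x [xt _]; rewrite lee_fin (kern_ge0 _ kphi).
rewrite sumEFin -EFinD => -[->]; congr (_ + _).
rewrite big_filter_cond [LHS](bigID (fun x => time x < t))/= [X in _ + X]big1 ?addr0; last first.
  move=> x /andP[]; rewrite in_setI => /andP[/set_mem xt _] xt'.
  by apply: kern_phi_diag; apply/eqP; rewrite eq_le xt /= leNgt.
apply: eq_bigl => x; rewrite in_setI andbC; have [xt|//] := boolP (time x < t).
rewrite /= [X in X && _](_ : _ = true); last by apply/mem_set/ltW.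
by apply/idP/idP => [/set_mem|/mem_set].
Qed.

Lemma process_finite i T s : 0 <= T ->
  Z i T (finite_config s) =
  \sum_(x <- s | (time x <= T) && (level x <= lambda (kind x) (time x) (finite_config s)))
     kern zeta i T x.
Proof.
move=> T0; have [+ _] := MSPD_finite MSPD_Z s i T0.
rewrite (excitationE _ _ _ plambda kernel_zeta) N_finite_integralE//; first last.
- exact: mkern.
- by move=> x [xt _]; rewrite lee_fin (kern_ge0 _ kernel_zeta).
rewrite sumEFin => -[->]; apply: eq_bigl => x.
by apply/idP/andP => [/set_mem[]|/mem_set].
Qed.

(** Induction on the number of points before [t]: whether such a point is accepted depends on the
    intensity at its own time, before which there are strictly fewer points. *)
Lemma intensity_causal i t s s' : 0 <= t ->
  [seq x <- s | time x < t] = [seq x <- s' | time x < t] ->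
  lambda i t (finite_config s) = lambda i t (finite_config s').
Proof.
move=> t0; move: {2}(size _) (leqnn (size [seq x <- s | time x < t])) => n.
elim: n => [|n IHn] in i t t0 *.
  rewrite leqn0 size_eq0 => /eqP e e'; rewrite !intensity_finite// -e' e.
  by rewrite !big_nil.
move=> sn e; rewrite !intensity_finite// -e.
apply: congr1; rewrite big_seq_cond [RHS]big_seq_cond; apply: eq_bigl => x.
have [|//] := boolP (x \in _); rewrite mem_filter => /andP[xt xs] /=; congr (_ <= _).
apply: IHn; [exact: time_ge0| |by rewrite (filter_past _ xt) e -filter_past].
by rewrite -ltnS; apply: leq_trans sn; exact: size_past.
Qed.

(** Since [phi] is nonnegative, further points can only raise the intensity, so by induction the
    points accepted under [s] are accepted under [w]. Here [w] may be the full configuration or a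
    larger truncation. *)
Lemma intensity_le i t s (w : Om) : 0 <= t -> MSPD_equations zeta mu phi lambda Z w ->
  (forall A, measurable A -> N (finite_config s : Om) A <= N w A)%E ->
  lambda i t (finite_config s) <= lambda i t w.
Proof.
move=> t0 eqw sw; move: {2}(size _) (leqnn (size [seq x <- s | time x < t])) => n.
elim: n => [|n IHn] in i t t0 *.
  rewrite leqn0 size_eq0 => /eqP e; rewrite intensity_finite// e big_nil addr0.
  have [_ eqt] := eqw i t t0; rewrite -lee_fin eqt leeDl// integral_ge0// => x xt.
  by rewrite lee_fin mulr_ge0// (kern_ge0 _ kphi).
move=> sn; have [_ eqt] := eqw i t t0; rewrite -lee_fin eqt.
rewrite intensity_finite// EFinD leeD2l//.
rewrite (excitationE _ _ _ plambda kphi).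
have k0 x : (0 <= ((EFin \o kern phi i t) \_ (upto t `&` accepted lambda w)) x)%E.
  rewrite patchE; case: ifPn => // /set_mem[xt _].
  by rewrite lee_fin (kern_ge0 _ kphi).
have mk : measurable_fun (upto t `&` accepted lambda w) (EFin \o kern phi i t).
  exact: mkern.
apply: (@le_trans _ _ (\int[N (finite_config s : Om)]_(x in upto t `&` accepted lambda w) (kern phi i t x)%:E)%E); last first.
  rewrite integral_mkcond [leRHS]integral_mkcond.
  apply: ge0_le_measure_integral => //.
  exact/(measurable_restrictT _ _).1.
rewrite N_finite_integralE//; last first.
  by move=> x [xt _]; rewrite lee_fin (kern_ge0 _ kphi).
rewrite -sumEFin big_filter_cond big_seq_cond [leRHS]big_seq_cond.
rewrite big_mkcond [leRHS]big_mkcond; apply: lee_sum => x _.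
have [xs /=|//] := boolP (x \in s).
case: ifPn => [/andP[xt xl]|_]; last first.
  by case: ifPn => // /set_mem[xt _]; rewrite lee_fin (kern_ge0 _ kphi).
rewrite mem_set//; split; first exact: ltW.
rewrite /accepted /=; apply: (le_trans xl); apply: IHn; first exact: time_ge0.
by rewrite -ltnS; apply: leq_trans sn; exact: size_past.
Qed.

(** The subsets of the n + 1 indices are grouped in pairs, without and with the last index, which
    have opposite signs: one application of T is the difference operator that adds [xn]. *)
Lemma Top_rcons n (x : n.-tuple XX) xn (F : Om -> R) :
  Top [tuple of rcons x xn] F =
  \sum_(J : {set 'I_n}) (-1) ^+ (n - #|J|) *
    (F (finite_config (rcons [seq tnth x j | j in J] xn)) -
     F (finite_config [seq tnth x j | j in J])).
Proof.
pose l := lift (@ord_max n); have li : injective l by exact: lift_inj.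
have tl j : tnth [tuple of rcons x xn] (l j) = tnth x j.
  rewrite !(tnth_nth xn) /= /bump leqNgt ltn_ord add0n nth_rcons size_tuple.
  by rewrite ltn_ord.
have tm : tnth [tuple of rcons x xn] ord_max = xn.
  by rewrite (tnth_nth xn) /= nth_rcons size_tuple ltnn eqxx.
have pl (J : {set 'I_n}) : perm_eq [seq tnth [tuple of rcons x xn] j | j in (l @: J)%SET]
    [seq tnth x j | j in J].
  rewrite /image_mem [X in perm_eq _ X](eq_map (g := tnth [tuple of rcons x xn] \o l)); last first.
    by move=> j /=; rewrite tl.
  rewrite map_comp; apply: perm_map; apply: uniq_perm; rewrite ?enum_uniq//.
    by rewrite map_inj_uniq// enum_uniq.
  move=> j; rewrite mem_enum; apply/imsetP/mapP => -[k]; rewrite ?mem_enum => kJ ->;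
    by exists k; rewrite ?mem_enum.
have ml (J : {set 'I_n}) : ord_max \notin (l @: J)%SET.
  by apply/imsetP => -[j _ /eqP]; rewrite (negbTE (neq_lift _ _)).
rewrite /Top (bigID (fun J : {set 'I_n.+1} => ord_max \in J))/=.
rewrite (reindex_onto (fun J : {set 'I_n} => ord_max |: l @: J) (fun K => l @^-1: K))%SET /=; last first.
  move=> K mK; apply/setP => j; rewrite !inE.
  have [->|jm] := eqVneq j ord_max; first by rewrite mK.
  apply/imsetP/idP => [[k]|jK]; first by rewrite inE => ? ->.
  rewrite eq_sym in jm; have [k jk _] := unlift_some jm; exists k; last by [].
  by rewrite inE /l -jk.
rewrite [X in _ + X](reindex_onto (fun J : {set 'I_n} => l @: J) (fun K => l @^-1: K))%SET /=; last first.
  move=> K mK; apply/setP => j; apply/imsetP/idP => [[k]|jK].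
    by rewrite inE => ? ->.
  have jm : ord_max != j by apply: contraNneq mK => ->.
  have [k jk _] := unlift_some jm; exists k; last by [].
  by rewrite inE /l -jk.
have e1 (J : {set 'I_n}) : (ord_max \in ord_max |: l @: J) && (l @^-1: (ord_max |: l @: J) == J)%SET.
  rewrite setU11 /=; apply/eqP/setP => j; rewrite !inE mem_imset//.
  by rewrite eq_sym (negbTE (neq_lift _ _)).
have e2 (J : {set 'I_n}) : (ord_max \notin l @: J)%SET && (l @^-1: (l @: J) == J)%SET.
  by rewrite ml /=; apply/eqP/setP => j; rewrite !inE mem_imset.
rewrite (eq_bigl xpredT); last by move=> J; rewrite e1.
rewrite [X in _ + X](eq_bigl xpredT); last by move=> J; rewrite e2.
rewrite -big_split /=; apply: eq_bigr => J _; rewrite mulrBr; congr (_ + _).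
  rewrite cardsU1 ml card_imset// add1n subSS; congr (_ * F _).
  apply: finite_config_perm; rewrite perm_sym perm_rcons perm_sym.
  apply: (@perm_trans _ (map (tnth [tuple of rcons x xn]) (ord_max :: enum (l @: J)%SET))).
    apply: perm_map; apply: uniq_perm; rewrite ?enum_uniq//=.
      by rewrite mem_enum ml enum_uniq.
    by move=> j; rewrite mem_enum !inE mem_enum.
  by rewrite /= tm perm_cons; exact: pl.
have Jn : (#|J| <= n)%N by rewrite -[X in (_ <= X)%N]card_ord max_card.
rewrite card_imset// (subSn Jn) exprS mulN1r mulNr.
by congr (- (_ * F _)); apply: finite_config_perm; exact: pl.
Qed.

Lemma Top_process_rcons i T n (x : n.-tuple XX) xn : 0 <= T ->
  all (fun z => time z <= T) (rcons x xn) ->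
  sorted (fun a b => time a <= time b) (rcons x xn) ->
  Top [tuple of rcons x xn] (Z i T) =
  zeta i (kind xn) (T - time xn) (mark xn) *
    Top x (fun w => (level xn <= lambda (kind xn) (time xn) w)%R%:R).
Proof.
move=> T0; rewrite all_rcons => /andP[xnT _].
rewrite sorted_pairwise; last by move=> ? ? ?; exact: le_trans.
rewrite pairwise_rcons => /andP[/allP xxn _].
rewrite Top_rcons /Top mulr_sumr; apply: eq_bigr => J _.
rewrite mulrCA; congr (_ * _); set u := [seq tnth x j | j in J].
have uxn : {in u, forall y, time y <= time xn}.
  by move=> y /mapP[j _ ->]; apply: xxn; exact: mem_tnth.
(* This includes t = [time xn], because the intensity at [t] only sees strictly earlier points; ties
   with [xn] are therefore harmless. *)
have lu k t : 0 <= t -> t <= time xn ->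
    lambda k t (finite_config (rcons u xn)) = lambda k t (finite_config u).
  by move=> t0 txn; apply: intensity_causal => //; rewrite filter_rcons ltNge txn.
rewrite !process_finite//; set w' : Om := finite_config (rcons u xn) in lu *.
rewrite -cats1 big_cat [X in _ + X - _]big_mkcond big_seq1 xnT lu//=; last exact: time_ge0.
have -> : \sum_(y <- u | (time y <= T) && (level y <= lambda (kind y) (time y) w')) kern zeta i T y
   = \sum_(y <- u | (time y <= T) && (level y <= lambda (kind y) (time y) (finite_config u))) kern zeta i T y.
  rewrite big_seq_cond [RHS]big_seq_cond; apply: eq_bigl => y.
  have [yu|//] := boolP (y \in u); congr (_ && (_ && _)).
  by rewrite lu ?uxn// time_ge0.
rewrite addrAC subrr add0r; case: ifP => _; first by rewrite mulr1.
by rewrite mulr0.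
Qed.

End finite_configurations.

(** * Poisson random measures *)

Lemma ae_probability1 d (T : measurableType d) (R : realType) (P : probability T R) (A : set T) :
  measurable A -> P A = 1%E -> {ae P, forall w, A w}.
Proof.
move=> mA PA; exists (~` A); split => //; first exact: measurableC.
by rewrite probability_setC// PA subee.
Qed.

Section poisson_measure.
Context (R : realType) (d : nat).
Local Notation XX := (X R d).
Local Notation Om := (Omega R d).
Context (P : probability Om R) (m : set XX -> \bar R).
Hypothesis m_ge0 : forall A, (0 <= m A)%E.
Hypothesis P_poisson : poisson_random_measure P m.

Lemma N_nat (w : Om) A : N w A = +oo%E \/ exists n, N w A = n%:R%:E.
Proof.
have := leey (N w A); rewrite le_eqVlt => /orP[/eqP->|]; first by left.
move=> /rconf_finite[s [e sA]]; right; exists (size s).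
rewrite -[in LHS](setIid A) -N_rconf e N_finiteE.
rewrite (eq_big_seq (fun=> 1%E)); first by rewrite sumEFin big_const_seq count_predT iter_addr_0.
by move=> x xs /=; rewrite diracE mem_set//; exact: sA.
Qed.

Lemma measurable_N_preimage (A : set XX) (B : set (\bar R)) : measurable A ->
  measurable B -> measurable [set w : Om | B (N w A)].
Proof. by move=> mA mB; rewrite -[X in measurable X]setTI; exact: measurable_N. Qed.

Lemma measurable_N_eq (A : set XX) (v : \bar R) : measurable A ->
  measurable [set w : Om | N w A = v].
Proof. by move=> mA; exact: (measurable_N_preimage mA (emeasurable_set1 v)). Qed.

Lemma poisson_lty (A : set XX) : measurable A -> (m A < +oo)%E ->
  {ae P, forall w, (N w A < +oo)%E}.
Proof.
have [P1 _ _] := P_poisson => mA mAoo.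
have mE n : measurable [set w : Om | N w A = n%:R%:E] by exact: measurable_N_eq.
have U1 : P (\bigcup_n [set w : Om | N w A = n%:R%:E]) = 1%E.
  rewrite measure_bigcup//; last first.
    move=> i j _ _ [w [/= ->]] [] /eqP; by rewrite eqr_nat => /eqP.
  rewrite -(@probability_setT _ _ _ (poisson_prob (fine (m A)) 0)).
  rewrite [in RHS](_ : setT = \bigcup_n [set n]); last first.
    by apply/seteqP; split => // n _; exists n.
  rewrite measure_bigcup//; last first.
    by move=> i j _ _ [n [/= -> ->]].
  by apply: eq_eseriesr => n _; exact: P1.
apply: filterS (ae_probability1 _ U1); last exact: bigcup_measurable.
by move=> w [n _ /= ->]; exact: ltry.
Qed.

(** The Poisson weights satisfy (n + 1) p(n + 1) = r p(n), so the series is [r] times their total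
    mass. For r = 0 the law is the Dirac mass at 0. *)
Lemma poisson_mean_series (r : R) : 0 <= r ->
  (\sum_(n <oo) (n%:R%:E * poisson_prob r 0 [set n]) = r%:E)%E.
Proof.
rewrite le_eqVlt => /predU1P[<-|r0].
  rewrite eseries0// => n _ _; rewrite /poisson_prob ltxx diracE.
  have [->|n0] := eqVneq n 0%N; first by rewrite mul0e.
  by rewrite memNset ?mule0//= => /esym/eqP; exact/negP.
have pE n : poisson_prob r 0 [set n] = (poisson_pmf r n)%:E.
  by rewrite /poisson_prob r0 esum_set1// lee_fin poisson_pmf_ge0.
rewrite nneseries_recl//; last by move=> n _; rewrite mule_ge0// lee_fin.
rewrite mul0e add0e.
transitivity (\sum_(n <oo) (r%:E * poisson_prob r 0 [set n]))%E.
  rewrite -(@nneseries_addn _ (fun n => n%:R%:E * poisson_prob r 0 [set n])%E 1)//; last first.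
    by move=> n; rewrite mule_ge0// lee_fin.
  apply: eq_eseriesr => n _; rewrite !pE addn1 -!EFinM; congr (_%:E).
  rewrite /poisson_pmf r0 factS natrM invfM exprS.
  by field; rewrite nat1r !pnatr_eq0 -lt0n fact_gt0.
rewrite nneseriesZl//.
have /esym := @probability_setT _ _ _ (poisson_prob r 0).
rewrite [in X in X -> _](_ : setT = \bigcup_n [set n]); last first.
  by apply/seteqP; split => // n _; exists n.
rewrite measure_bigcup//; last by move=> i j _ _ [n [/= -> ->]].
by rewrite (eq_eseriesl (Q := xpredT)) => [<-|n]; rewrite ?mule1// in_setT.
Qed.

Lemma poisson_mean (A : set XX) : measurable A -> (\int[P]_w N w A = m A)%E.
Proof.
move=> mA; have [P1 P2 _] := P_poisson.
have [mAoo|] := ltP (m A) +oo%E; last first.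
  rewrite leye_eq => /eqP mAoo; rewrite mAoo.
  have Poo := P2 A mA mAoo.
  transitivity (\int[P]_w (cst +oo%E w))%E; last by rewrite integral_cst// [X in (_ * X)%E]probability_setT mule1.
  apply: ge0_ae_eq_integral => //; [exact: measurable_N|by move=> w _; exact: leey|].
  by apply: filterS (ae_probability1 (measurable_N_eq _ mA) Poo) => w /= ->.
have mE n : measurable [set w : Om | N w A = n%:R%:E] by exact: measurable_N_eq.
transitivity (\int[P]_w (\sum_(n <oo) (n%:R%:E * (\1_[set w : Om | N w A = n%:R%:E] w)%:E)))%E.
  have mt n : measurable_fun setT (fun w : Om => n%:R%:E * (\1_[set w : Om | N w A = n%:R%:E] w)%:E)%E.
    by apply: measurable_funeM; apply/measurable_EFinP; exact: measurable_indic.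
  have t0 n w : (0 <= n%:R%:E * (\1_[set w : Om | N w A = n%:R%:E] w)%:E :> \bar R)%E.
    by rewrite mule_ge0// lee_fin.
  apply: ge0_ae_eq_integral => //.
  - exact: measurable_N.
  - exact: ge0_emeasurable_sum.
  - by move=> w _; exact: nneseries_ge0.
  move: (poisson_lty mA mAoo); apply: (@filterS _ _ (ae_filter_ringOfSetsType P)) => w Nw _.
  have [e|[n Nn]] := N_nat w A; first by rewrite e ltxx in Nw.
  rewrite (@nneseriesD1 _ _ n xpredT)//= Nn indicE mem_set//= mule1 eseries0 ?adde0// => k _ kn.
  rewrite indicE memNset ?mule0//= Nn => -[] /eqP; rewrite eqr_nat => /eqP nk.
  by rewrite nk eqxx in kn.
rewrite integral_nneseries//; last first.
  move=> n; by apply: measurable_funeM; apply/measurable_EFinP; exact: measurable_indic.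
have mf : m A \is a fin_num by rewrite ge0_fin_numE.
rewrite -[RHS]fineK// -[RHS]poisson_mean_series ?fine_ge0//.
apply: eq_eseriesr => n _; rewrite ge0_integralZl//; last by apply/measurable_EFinP; exact: measurable_indic.
by rewrite integral_indic// setIT; congr (_ * _)%E; exact: P1.
Qed.

End poisson_measure.

Section independence_of_the_past.
Context (R : realType) (d : nat).
Local Notation XX := (X R d).
Local Notation Om := (Omega R d).
Context (P : probability Om R) (m : set XX -> \bar R).
Hypothesis P_poisson : poisson_random_measure P m.

Lemma poisson_independence (I : finType) (A : I -> set XX) (B : I -> set (\bar R)) :
  (forall i, measurable (A i)) -> trivIset setT A -> (forall i, measurable (B i)) ->
  P [set w | forall i, B i (N w (A i))] = (\prod_(i : I) P [set w | B i (N w (A i))])%E.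
Proof.
move=> mA tA mB; have [_ _ P3] := P_poisson.
have := P3 #|I| (fun j => A (enum_val j)) (fun j => mA _) _ (fun j => B (enum_val j)) (fun j => mB _).
move=> /(_ _)/wrap[].
  move=> j k _ _ [x jk]; by apply: enum_val_inj; apply: tA => //; exists x.
rewrite (reindex (@enum_val _ I))/=; last exact: onW_bij (enum_val_bij _).
move=> <-; congr (P _); apply/seteqP; split => w /= h.
  by move=> j _ /=; exact: h.
by move=> i; rewrite -(enum_rankK i); exact: h.
Qed.

(** The possible values of a count, [None] being infinity. There are countably many, so events about
    finitely many counts are countable unions over vectors of values. *)
Definition ev (v : option nat) : \bar R := if v is Some n then n%:R%:E else +oo%E.

Lemma ev_inj : injective ev.
Proof. by case=> [m1|] [n|] //= [] /eqP; rewrite eqr_nat => /eqP ->. Qed.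

Lemma N_ev (w : Om) A : exists v, N w A = ev v.
Proof. by have [->|[n ->]] := N_nat w A; [exists None|exists (Some n)]. Qed.

Section atoms.
Context (n : nat) (A : 'I_n -> set XX) (U : set XX).
Hypotheses (mU : measurable U) (mA : forall j, measurable (A j)) (AU : forall j, A j `<=` U).

(** An atom of the algebra generated by the [A j] inside [U]: the [A j] may overlap, whereas the
    Poisson property speaks of disjoint sets. *)
Definition atom (J : {set 'I_n}) : set XX := U `&` [set x | forall j, (j \in J) = `[< A j x >]].

Lemma measurable_atom J : measurable (atom J).
Proof.
apply: measurableI => //.
rewrite (_ : [set _ | _] = \bigcap_(j in [set: 'I_n]) (if j \in J then A j else ~` A j)).
  apply: fin_bigcap_measurable => // j _; case: ifP => _; [exact: mA|].
  by apply: measurableC; exact: mA.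
apply/seteqP; split => x /= h j; last first.
  have := h j I; case: (j \in J) => /= jx; first by apply/esym/asboolT.
  by apply/esym/asboolF.
move=> _; have := h j; case: (j \in J) => /esym; first by move/asboolP.
by move/asboolPn.
Qed.

Lemma trivIset_atom : trivIset setT atom.
Proof.
move=> J K _ _ [x [[_ xJ] [_ xK]]]; apply/setP => j.
by rewrite xJ xK.
Qed.

Lemma N_atoms w j : N w (A j) = (\sum_(J : {set 'I_n} | j \in J) N w (atom J))%E.
Proof.
pose r := enum (fun J : {set 'I_n} => j \in J).
have -> : A j = \bigcup_(J in [set` r]) atom J.
  apply/seteqP; split => x.
    move=> Ax; exists [set k | `[< A k x >]]%SET => /=.
      by rewrite mem_enum unfold_in inE; exact/asboolP.
    by split; [exact: AU Ax|move=> k; rewrite inE].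
  move=> [J /=]; rewrite mem_enum unfold_in => jJ [_ /(_ j)].
  by rewrite jJ => /esym/asboolP.
rewrite measure_fin_bigcup//.
- by rewrite -fsbig_seq ?enum_uniq// /r big_enum.
- by move=> J K _ _; exact: trivIset_atom.
- by move=> J _; exact: measurable_atom.
Qed.

(** Each [N w (A j)] is a sum of counts on atoms, which together with [C] are pairwise disjoint. The
    event is split according to the vector of counts on the atoms. *)
Lemma atoms_independence (C : set XX) (B : 'I_n -> set (\bar R)) (V : set (\bar R)) :
  measurable C -> C `&` U = set0 ->  measurable V -> (forall j, measurable (B j)) ->
  P ([set w | forall j, B j (N w (A j))] `&` [set w | V (N w C)]) =
  (P [set w | forall j, B j (N w (A j))] * P [set w | V (N w C)])%E.
Proof.
move=> mC CU mV mB.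
pose W := {ffun {set 'I_n} -> option nat}.
pose F (v : W) := [set w : Om | forall J, N w (atom J) = ev (v J)].
have mF v : measurable (F v).
  rewrite (_ : F v = \bigcap_(J in [set: {set 'I_n}]) [set w : Om | N w (atom J) = ev (v J)]).
    apply: fin_bigcap_measurable => // J _; apply: measurable_N_eq; exact: measurable_atom.
  by apply/seteqP; split => w /= h J; [move=> _|]; exact: h.
have indF v V' : measurable V' ->
    P (F v `&` [set w | V' (N w C)]) = (P [set w | V' (N w C)] *
      \prod_(J : {set 'I_n}) P [set w : Om | N w (atom J) = ev (v J)])%E.
  move=> mV'.
  pose A' (o : option {set 'I_n}) := if o is Some J then atom J else C.
  pose B' (o : option {set 'I_n}) := if o is Some J then [set ev (v J)] else V'.
  have := @poisson_independence _ A' B'.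
  move=> /(_ _ _ _)/wrap[].
  - by case=> [J|//]; exact: measurable_atom.
  - move=> [J|] [K|] _ _ //= [x].
    + by move=> xJK; congr Some; apply: trivIset_atom => //; exists x.
    + by move=> [[Ux _] Cx]; have : (C `&` U) x by []; rewrite CU.
    + by move=> [Cx [Ux _]]; have : (C `&` U) x by []; rewrite CU.
  - by case=> [J|//] /=; exact: emeasurable_set1.
  rewrite (bigD1 None)//= (reindex_omap Some id)/=; last by case.
  rewrite (eq_bigl xpredT); last by move=> J; rewrite eqxx.
  move=> <-; congr (P _); apply/seteqP; split => w /=.
    by move=> [h1 h2] [J|]; [exact: h1|exact: h2].
  by move=> h; split; [move=> J; exact: (h (Some J))|exact: (h None)].
have PFV v : P (F v `&` [set w | V (N w C)]) = (P (F v) * P [set w | V (N w C)])%E.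
  rewrite indF// muleC; congr (_ * _)%E; rewrite -[F v]setIT.
  rewrite (_ : [set: _] = [set w : Om | setT (N w C)])//.
  by rewrite indF// -[X in (X * _)%E]/(P setT) probability_setT mul1e.
pose good (v : W) := forall j, B j (\sum_(J : {set 'I_n} | j \in J) ev (v J))%E.
(* Vectors of values are enumerated by their codes, so that the union is a sequence; a code of no
   vector gives the empty set. *)
pose G k := if @pickle_inv W k is Some v then [set w | F v w /\ good v] else set0.
have mG k : measurable (G k).
  rewrite /G; case: (pickle_inv k) => [v|]//.
  have [gv|gv] := pselect (good v).
    by rewrite (_ : [set _ | _] = F v)//; apply/seteqP; split => w //= [].
  by rewrite (_ : [set _ | _] = set0)//; apply/seteqP; split => w //= [].
have tG : trivIset setT G.
  move=> k l _ _ [w []]; rewrite /G.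
  case ek : (pickle_inv k) => [v|//]; case el : (pickle_inv l) => [v'|//] /= [Fv _] [Fv' _].
  have vv' : v = v' by apply/ffunP => J; apply: ev_inj; rewrite -Fv -Fv'.
  have := @pickle_invK W k; have := @pickle_invK W l.
  by rewrite ek el /= vv' => -> .
have -> : [set w : Om | forall j, B j (N w (A j))] = \bigcup_k G k.
  apply/seteqP; split => w /=.
    move=> BA; have /choice[f fE] : forall J : {set 'I_n}, exists v, N w (atom J) = ev v.
      by move=> J; exact: N_ev.
    pose v : W := [ffun J => f J].
    exists (pickle v) => //; rewrite /G pickleK_inv; split.
      by move=> J; rewrite ffunE.
    move=> j; have := BA j; rewrite N_atoms; congr (B j _).
    by apply: eq_bigr => J _; rewrite ffunE.
  move=> [k _]; rewrite /G; case: pickle_inv => [v|//] [Fv gv] j.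
  rewrite N_atoms; have := gv j; congr (B j _).
  by apply: eq_bigr => J _; rewrite Fv.
have mE : measurable [set w : Om | V (N w C)] by exact: measurable_N_preimage.
rewrite setI_bigcupl measure_bigcup//; first last.
- exact: trivIset_setIr.
- by move=> k _; exact: measurableI.
rewrite [P (\bigcup_k G k)]measure_bigcup// muleC.
have pf : P [set w : Om | V (N w C)] = (fine (P [set w : Om | V (N w C)]))%:E.
  by rewrite fineK// fin_num_measure.
rewrite pf -nneseriesZl//.
apply: eq_eseriesr => k _; rewrite -pf /G; case: (pickle_inv k) => [v|].
  have [gv|gv] := pselect (good v).
    have -> : [set w | F v w /\ good v] = F v by apply/seteqP; split => w //= [].
    by rewrite muleC; exact: PFV.
  have -> : [set w | F v w /\ good v] = set0 by apply/seteqP; split => w //= [].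
  by rewrite set0I measure0 mule0.
by rewrite set0I measure0 mule0.
Qed.

End atoms.
End independence_of_the_past.

Section filtration_independence.
Context (R : realType) (d : nat).
Local Notation XX := (X R d).
Local Notation Om := (Omega R d).
Context (P : probability Om R) (m : set XX -> \bar R).
Hypothesis m_ge0 : forall A, (0 <= m A)%E.
Hypothesis P_poisson : poisson_random_measure P m.

Lemma evaluation_sets_sub (D : set XX) : @evaluation_sets R d D `<=` @evaluation_sets R d setT.
Proof. by move=> _ [A [mA _] [B mB <-]]; exists A => //; exists B. Qed.

Lemma filtration_sub s : @filtration R d s `<=` measurable.
Proof. by apply: sub_sigma_algebra2; exact: evaluation_sets_sub. Qed.

Lemma filtration_le s t : s <= t -> @filtration R d s `<=` @filtration R d t.
Proof.
move=> st; apply: sub_sigma_algebra2 => _ [A [mA As] [B mB <-]].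
exists A => /=; last by exists B.
by split => // x /As /= xs; exact: le_trans st.
Qed.

(** Monotone class argument: the events on finitely many counts before [s] are stable under
    intersection and generate the past, and [atoms_independence] settles them. *)
Lemma filtration_independence s A (C : set XX) V : @filtration R d s A ->
  measurable C -> C `&` upto s = set0 -> measurable V ->
  P (A `&` [set w | V (N w C)]) = (P A * P [set w | V (N w C)])%E.
Proof.
move=> sA mC Cs mV.
have mE : measurable [set w : Om | V (N w C)] by exact: measurable_N_preimage.
pose G := [set A : set Om | exists n (A_ : 'I_n -> set XX) (B_ : 'I_n -> set (\bar R)),
  (forall j, [/\ measurable (A_ j), A_ j `<=` upto s & measurable (B_ j)]) /\
  A = [set w : Om | forall j, B_ j (N w (A_ j))]].
pose H := [set A : set Om | measurable A /\
  P (A `&` [set w | V (N w C)]) = (P A * P [set w | V (N w C)])%E].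
suff GH : <<s G >> `<=` H.
  have : H A; last by case.
  apply: GH; move: A sA; apply: sub_sigma_algebra2 => _ [A [mA As] [B mB <-]].
  exists 1%N, (fun=> A), (fun=> B); split => //.
  by apply/seteqP; split => w /= h; [move=> _|]; [exact: h|exact: (h ord0)].
apply: lambda_system_subset => //.
- move=> A1 A2 [n1 [A_ [B_ [AB ->]]]] [n2 [A'_ [B'_ [AB' ->]]]].
  exists (n1 + n2)%N, (fun j => match fintype.split j with inl a => A_ a | inr b => A'_ b end),
    (fun j => match fintype.split j with inl a => B_ a | inr b => B'_ b end); split.
    by move=> j; case: (fintype.split j).
  apply/seteqP; split => w /=.
    by move=> [h1 h2] j; case: (fintype.split j) => k; [exact: h1|exact: h2].
  move=> h; split => j; first by have := h (lshift n2 j); rewrite (unsplitK (inl j : 'I_n1 + 'I_n2)).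
  by have := h (rshift n1 j); rewrite (unsplitK (inr j : 'I_n1 + 'I_n2)).
- apply/dynkin_lambda_system; split.
  + by split => //; rewrite setTI probability_setT mul1e.
  + move=> B [mB PB]; split; first exact: measurableC.
    rewrite setIC -setDE measureD//; last by rewrite ltey_eq fin_num_measure.
    rewrite probability_setC// muleBl ?fin_num_measure// mul1e; congr (_ - _)%E.
    by rewrite setIC.
  + move=> F tF HF; split; first by apply: bigcupT_measurable => k; case: (HF k).
    rewrite setI_bigcupl measure_bigcup//; first last.
    - exact: trivIset_setIr.
    - by move=> k _; apply: measurableI => //; case: (HF k).
    rewrite [P (\bigcup_k F k)]measure_bigcup//; last by move=> k _; case: (HF k).
    rewrite muleC.
    have pf : P [set w : Om | V (N w C)] = (fine (P [set w : Om | V (N w C)]))%:E.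
      by rewrite fineK// fin_num_measure.
    rewrite pf -nneseriesZl//.
    by apply: eq_eseriesr => k _; rewrite -pf muleC; case: (HF k).
- move=> _ [n [A_ [B_ [AB ->]]]]; split.
    rewrite (_ : [set _ | _] = \bigcap_(j in [set: 'I_n]) [set w : Om | B_ j (N w (A_ j))]).
      apply: fin_bigcap_measurable => // j _.
      by apply: measurable_N_preimage; case: (AB j).
    by apply/seteqP; split => w /= h j; [move=> _|]; exact: h.
  apply: (@atoms_independence _ _ P m P_poisson n A_ (upto s)) => //.
  + exact: measurable_upto.
  + by move=> j; case: (AB j).
  + by move=> j; case: (AB j).
  + by move=> j; case: (AB j).
Qed.

Lemma layer_cake_nat (v : option nat) :
  (\sum_(n <oo) ((n.+1%:R%:E <= ev R v)%E%:R)%:E = ev R v)%E.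
Proof.
case: v => [k|] /=; last first.
  rewrite (eq_eseriesr (g := fun=> 1%E)); last by move=> n _; rewrite leey.
  apply/eqyP => r r0; apply: (@le_trans _ _ (\sum_(0 <= i < (Num.truncn r).+1) 1)%E).
    by rewrite sumEFin big_const_nat subn0 iter_addr_0 lee_fin ltW// truncnS_gt.
  exact: (@nneseries_lim_ge _ (fun=> 1%E) xpredT 0).
rewrite (@nneseries_finE _ _ k); last by move=> n kn; rewrite lee_fin ler_nat ltnNge kn.
rewrite big_nat (eq_bigr (fun=> 1%E)); last first.
  by move=> n /andP[_ nk]; rewrite lee_fin ler_nat nk.
by rewrite -big_nat sumEFin big_const_nat subn0 iter_addr_0.
Qed.

(** Layer cake: [N w C] is the sum over n of the indicators of [N w C] being at least n + 1, and
    each of these events is independent of [A]. *)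
Lemma filtration_mean s A (C : set XX) : @filtration R d s A ->
  measurable C -> C `&` upto s = set0 ->
  (\int[P]_(w in A) N w C = P A * m C)%E.
Proof.
move=> sA mC Cs; have mA := filtration_sub sA.
rewrite -(poisson_mean m_ge0 P_poisson mC).
pose E n : set Om := [set w | (n.+1%:R%:E <= N w C)%E].
have mV n : measurable [set y : \bar R | (n.+1%:R%:E <= y)%E].
  rewrite (_ : [set _ | _] = `[n.+1%:R%:E, +oo[%classic); first exact: emeasurable_itv.
  by apply/seteqP; split => y; rewrite /= in_itv /= andbT.
have mE n : measurable (E n) by exact: (measurable_N_preimage mC (mV n)).
have H (B : set Om) : measurable B -> (\int[P]_(w in B) N w C = \sum_(n <oo) P (B `&` E n))%E.
  move=> mB; transitivity (\int[P]_(w in B) (\sum_(n <oo) (\1_(E n) w)%:E))%E.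
    apply: eq_integral => w _; have [v e] := N_ev w C; rewrite e -layer_cake_nat.
    apply: eq_eseriesr => n _; rewrite indicE -e; congr (_%:R%:E); congr nat_of_bool.
    by apply/idP/idP => [/mem_set|/set_mem].
  rewrite integral_nneseries//; last first.
    by move=> n; apply/measurable_EFinP; exact: measurable_indic.
  by apply: eq_eseriesr => n _; rewrite integral_indic// setIC.
rewrite !H// (_ : [set: Om] = setT)//.
have pA : P A = (fine (P A))%:E by rewrite fineK// fin_num_measure.
rewrite pA -nneseriesZl//; apply: eq_eseriesr => n _; rewrite -pA setTI.
exact: (filtration_independence sA mC Cs (mV n)).
Qed.

End filtration_independence.

Section intensity.
Context (R : realType) (d : nat).
Local Notation XX := (X R d).
Context (nu : 'I_d.+1 -> probability R R).
Hypothesis nu_ge0 : forall k, nu k `[0, +oo[%classic = 1%E.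

Lemma quadrant_abs (k : 'I_d.+1) (t th y : R) : quadrant (k, `|t|, `|th|, `|y|).
Proof. by rewrite /quadrant /= !normr_ge0. Qed.

(* The absolute values only serve to make the map total. *)
Definition inX (k : 'I_d.+1) (t th y : R) : XX :=
  exist (fun x => quadrant x) (k, `|t|, `|th|, `|y|) (quadrant_abs k t th y).

Lemma inX_indic (A : set XX) k t th y : 0 <= t -> 0 <= th -> 0 <= y ->
  \1_[set sval x | x in A] (k, t, th, y) = \1_A (inX k t th y) :> R.
Proof.
move=> t0 th0 y0; rewrite !indicE; congr (_%:R); congr nat_of_bool.
have e : sval (inX k t th y) = (k, t, th, y) by rewrite /= !ger0_norm.
apply/idP/idP => /set_mem.
  move=> [x Ax xe]; apply/mem_set; rewrite (_ : inX k t th y = x)//.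
  by apply: val_inj; rewrite /= -[RHS]/(sval x) xe !ger0_norm.
by move=> Ai; apply/mem_set; exists (inX k t th y).
Qed.

Lemma in_ge0 (t : R) : t \in `[0, +oo[%classic -> 0 <= t.
Proof. by rewrite inE /= in_itv /= andbT. Qed.

Lemma intensityE A : intensity_measure nu A =
  (\sum_(k < d.+1)
    \int[lebesgue_measure]_(t in `[0%R, +oo[)
    \int[lebesgue_measure]_(th in `[0%R, +oo[)
    \int[nu k]_(y in `[0%R, +oo[) (\1_A (inX k t th y))%:E)%E.
Proof.
apply: eq_bigr => k _; apply: eq_integral => t /in_ge0 t0.
apply: eq_integral => th /in_ge0 th0; apply: eq_integral => y /in_ge0 y0.
by rewrite inX_indic.
Qed.

Lemma intensity_ge0 A : (0 <= intensity_measure nu A)%E.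
Proof.
apply: sume_ge0 => k _; apply: integral_ge0 => t _; apply: integral_ge0 => th _.
by apply: integral_ge0 => y _; rewrite lee_fin.
Qed.

Lemma intensity_rect (I J : set R) : measurable I -> measurable J ->
  I `<=` `[0, +oo[%classic -> J `<=` `[0, +oo[%classic ->
  intensity_measure nu [set x | I (time x) /\ J (level x)] =
  (d.+1%:R%:E * (lebesgue_measure I * lebesgue_measure J))%E.
Proof.
move=> mI mJ I0 J0; rewrite intensityE (eq_bigr (fun=> (lebesgue_measure I * lebesgue_measure J)%E)).
  rewrite (eq_bigr (fun=> 1 * (lebesgue_measure I * lebesgue_measure J))%E); last first.
    by move=> k _; rewrite mul1e.
  by rewrite -ge0_sume_distrl// sumEFin sumr_const card_ord.
move=> k _.
transitivity (\int[lebesgue_measure]_(t in `[0%R, +oo[) ((\1_I t)%:E * lebesgue_measure J))%E.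
  apply: eq_integral => t /in_ge0 t0.
  transitivity (\int[lebesgue_measure]_(th in `[0%R, +oo[) ((\1_I t)%:E * (\1_J th)%:E))%E.
    apply: eq_integral => th /in_ge0 th0.
    transitivity (\int[nu k]_(y in `[0%R, +oo[) (cst ((\1_I t)%:E * (\1_J th)%:E) y))%E.
      apply: eq_integral => y /in_ge0 y0; rewrite /cst -EFinM !indicE -natrM mulnb.
      congr (_%:R%:E); congr nat_of_bool.
      rewrite -[in RHS](ger0_norm t0) -[in RHS](ger0_norm th0).
      by apply/idP/andP => [/set_mem[It Jth]|[/set_mem It /set_mem Jth]]; [split|]; exact/mem_set.
    by rewrite integral_cst//= [X in (_ * X)%E]nu_ge0 mule1.
  rewrite ge0_integralZl//; last by apply/measurable_EFinP; exact: measurable_indic.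
  by rewrite integral_indic// setIidl.
rewrite ge0_integralZr//; last by apply/measurable_EFinP; exact: measurable_indic.
by rewrite integral_indic// setIidl.
Qed.

Lemma intensity_box (T M : R) : 0 <= T -> 0 <= M ->
  intensity_measure nu (box T M) = (d.+1%:R * (T * M))%:E.
Proof.
move=> T0 M0; rewrite (_ : box T M = [set x | `[0, T]%classic (time x) /\ `[0, M]%classic (level x)]); last first.
  apply/seteqP; split => x; rewrite /box /= !in_itv /= time_ge0 level_ge0 /=; last by case=> -> ->.
  by move=> /andP.
rewrite intensity_rect//; last 2 first.
- by move=> t /=; rewrite !in_itv /= => /andP[->].
- by move=> t /=; rewrite !in_itv /= => /andP[->].
have L (a : R) : 0 <= a -> lebesgue_measure (`[0, a]%classic : set R) = a%:E.
  move=> a0; rewrite lebesgue_measure_itv /= lte_fin; case: ltP => [_|a0']; first by rewrite oppr0 adde0.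
  by congr (_%:E); apply/eqP; rewrite eq_le a0 a0'.
by rewrite !L// -!EFinM.
Qed.

Lemma measurable_slab (s t M : R) :
  measurable [set x : XX | (s < time x <= t) && (level x <= M)].
Proof.
rewrite (_ : [set _ | _] = (@time R d @^-1` `]s, t]) `&` (@level R d @^-1` `]-oo, M])).
  apply: measurableI; rewrite -[X in measurable X]setTI.
    exact: measurable_time.
  exact: measurable_level.
by apply/seteqP; split => x /=; rewrite !in_itv /= => /andP.
Qed.

Lemma intensity_slab (s t M : R) : 0 <= s -> s <= t -> 0 <= M ->
  intensity_measure nu [set x | (s < time x <= t) && (level x <= M)] =
  (d.+1%:R * ((t - s) * M))%:E.
Proof.
move=> s0 st M0.
rewrite (_ : [set _ | _] = [set x | `]s, t]%classic (time x) /\ `[0, M]%classic (level x)]); last first.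
  apply/seteqP; split => x; rewrite /= !in_itv /= level_ge0 /=; last by case=> -> ->.
  by move=> /andP.
rewrite intensity_rect//; last 2 first.
- by move=> u /=; rewrite !in_itv /= => /andP[/ltW su _]; rewrite (le_trans s0).
- by move=> u /=; rewrite !in_itv /= => /andP[->].
rewrite !lebesgue_measure_itv /= !lte_fin; case: ltP => [_|ts].
  case: ltP => [_|M0']; first by rewrite oppr0 adde0 -EFinB -!EFinM.
  have -> : M = 0 by apply/eqP; rewrite eq_le M0 M0'.
  by rewrite !mulr0 !mule0.
have -> : t = s by apply/eqP; rewrite eq_le ts st.
by rewrite mul0e mule0 subrr mul0r mulr0.
Qed.

End intensity.

(** * Absence of simultaneous points *)

Section simplicity.
Context (R : realType) (d : nat).
Local Notation XX := (X R d).
Local Notation Om := (Omega R d).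
Context (nu : 'I_d.+1 -> probability R R).
Hypothesis nu_ge0 : forall k, nu k `[0, +oo[%classic = 1%E.
Context (P : probability Om R).
Hypothesis P_poisson : poisson_random_measure P (intensity_measure nu).

Lemma poisson_two (A : set XX) (r : R) : measurable A -> intensity_measure nu A = r%:E ->
  (P (~` [set w : Om | N w A = 0%:E \/ N w A = 1%:E]) <= (r ^+ 2)%:E)%E.
Proof.
move=> mA Ar; have [P1 _ _] := P_poisson.
have r0 : 0 <= r by rewrite -lee_fin -Ar intensity_ge0.
have Aoo : (intensity_measure nu A < +oo)%E by rewrite Ar ltry.
have m0 : measurable [set w : Om | N w A = 0%:E] by exact: measurable_N_eq.
have m1 : measurable [set w : Om | N w A = 1%:E] by exact: measurable_N_eq.
rewrite (_ : [set w | _ \/ _] = [set w : Om | N w A = 0%:E] `|` [set w : Om | N w A = 1%:E])//.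
rewrite probability_setC; last exact: measurableU.
rewrite measureU//; last first.
  by apply/seteqP; split => w //= [-> [] /eqP]; rewrite eq_sym oner_eq0.
have := P1 A 0%N mA Aoo; rewrite Ar /= => ->.
have := P1 A 1%N mA Aoo; rewrite Ar /= => ->.
move: r0; rewrite le_eqVlt => /predU1P[<-|r0].
  rewrite /poisson_prob ltxx !diracE mem_set// memNset /=; last by move=> /eqP.
  by rewrite addr0 -EFinD subrr expr0n.
have pE n : poisson_prob r 0 [set n] = (poisson_pmf r n)%:E.
  by rewrite /poisson_prob r0 esum_set1// lee_fin poisson_pmf_ge0.
rewrite !pE; change ((1 - (poisson_pmf r 0 + poisson_pmf r 1))%:E <= (r ^+ 2)%:E)%E.
rewrite lee_fin /poisson_pmf r0 expr0 expr1 fact0 !invr1 !mulr1 !mul1r.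
(* The probability of two points or more is 1 - (1 + r) exp(- r), which is at most 1 - (1 + r)(1 -
   r) = r^2. *)
have : 1 - r <= expR (- r) by have := expR_ge1Dx (- r).
move=> h; have : (1 - r) * (1 + r) <= expR (- r) * (1 + r).
  by rewrite ler_wpM2r// addr_ge0// ltW.
by lra.
Qed.

Lemma measurable_simultaneous (T M t : R) :
  measurable [set x : XX | box T M x /\ time x = t].
Proof.
rewrite (_ : [set _ | _] = box T M `&` @time R d @^-1` [set t])//.
apply: measurableI; first exact: measurable_box.
by rewrite -[X in measurable X]setTI; exact: measurable_time.
Qed.

Lemma poisson_time0 (n : nat) :
  {ae P, forall w, N w [set x : XX | box n%:R n%:R x /\ time x = 0] = 0%E}.
Proof.
set A := [set x : XX | _]; have mA : measurable A by exact: measurable_simultaneous.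
have A0 : intensity_measure nu A = 0%E.
  rewrite (_ : A = [set x | [set 0] (time x) /\ `[0, n%:R]%classic (level x)]).
    rewrite intensity_rect//.
    - by rewrite lebesgue_measure_set1 mul0e mule0.
    - by move=> t /= ->; rewrite in_itv /= lexx.
    - by move=> t /=; rewrite !in_itv /= => /andP[->].
  apply/seteqP; split => x; rewrite /A /= in_itv /= level_ge0 /=.
    by move=> [/andP[_ ->] ->].
  by move=> [x0 xn]; rewrite /box /= x0 xn ler0n.
have [P1 _ _] := P_poisson.
have := P1 A 0%N mA; rewrite A0 ltry => /(_ isT).
rewrite /= /poisson_prob ltxx diracE mem_set//= => PA.
exact: (ae_probability1 (measurable_N_eq _ mA) PA).
Qed.

(** Cut [0, n] into p + 1 cells. Simultaneous points share a cell, and some cell holds two points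
    with probability at most the number of cells times the square of the mass of one, which is of
    order 1 / p. *)
Lemma poisson_simple (n : nat) :
  {ae P, forall w, forall t, (N w [set x : XX | box n%:R n%:R x /\ time x = t] <= 1)%E}.
Proof.
have n0 : (0 : R) <= n%:R by [].
pose cell p j : set XX := [set x | (j%:R * (n%:R / p.+1%:R) < time x <= j.+1%:R * (n%:R / p.+1%:R)) && (level x <= n%:R)].
have mcell p j : measurable (cell p j) by exact: measurable_slab.
pose bad p := \bigcup_(j in `I_p.+1) ~` [set w : Om | N w (cell p j) = 0%:E \/ N w (cell p j) = 1%:E].
have mtwo p j : measurable (~` [set w : Om | N w (cell p j) = 0%:E \/ N w (cell p j) = 1%:E]).
  by apply: measurableC; apply: measurableU; exact: measurable_N_eq.
have mbad p : measurable (bad p) by apply: fin_bigcup_measurable => //; exact: finite_II.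
(* The square of the mass of the whole box: each of the p + 1 cells has mass the square root of [c]
   divided by p + 1. *)
pose c : R := (d.+1%:R * (n%:R * n%:R)) ^+ 2.
have Pbad p : (P (bad p) <= (c / p.+1%:R)%:E)%E.
  have cellE j : intensity_measure nu (cell p j) = (d.+1%:R * (n%:R / p.+1%:R * n%:R))%:E.
    rewrite intensity_slab//.
    - by rewrite -mulrBl -natrB// subSnn mul1r.
    - by rewrite ler_wpM2r ?ler_nat// divr_ge0.
  apply: (@le_trans _ _ (\sum_(j < p.+1) P (~` [set w : Om | N w (cell p j) = 0%:E \/ N w (cell p j) = 1%:E]))%E).
    rewrite /bad bigcup_mkord.
    by apply: (Boole_inequality P (A := fun j => ~` [set w : Om | N w (cell p j) = 0%:E \/ N w (cell p j) = 1%:E])).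
  apply: (@le_trans _ _ (\sum_(j < p.+1) ((d.+1%:R * (n%:R / p.+1%:R * n%:R)) ^+ 2)%:E)%E).
    by apply: lee_sum => j _; apply: poisson_two.
  rewrite sumEFin sumr_const card_ord lee_fin -mulr_natr le_eqVlt; apply/orP; left; apply/eqP.
  by rewrite /c; field; rewrite nat1r pnatr_eq0.
have bad0 : P (\bigcap_p bad p) = 0%E.
  apply/eqP; rewrite eq_le measure_ge0 andbT; apply/lee_addgt0Pr => e e0; rewrite add0e.
  apply: (@le_trans _ _ (P (bad (Num.truncn (c / e))))).
    apply: le_measure; rewrite ?inE//; first exact: bigcapT_measurable.
    exact: bigcap_inf.
  apply: (le_trans (Pbad _)); rewrite lee_fin ler_pdivrMr// mulrC -ler_pdivrMr//.
  by rewrite ltW// truncnS_gt.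
have : {ae P, forall w, ~ (\bigcap_p bad p) w}.
  exists (\bigcap_p bad p); split => //; first exact: bigcapT_measurable.
  by move=> w /= /contrapT.
move: (poisson_time0 n); apply: (@filterS2 _ _ (ae_filter_ringOfSetsType P)) => w w0 + t.
move=> /existsNP[p /not_implyP[_ gp]].
have mt u := measurable_simultaneous n%:R n%:R u.
have [tn|tn] := ltP n%:R t.
  rewrite (_ : [set _ | _] = set0) ?measure0//.
  by apply/seteqP; split => // x /= [/andP[xn _] xt]; move: tn; rewrite -xt ltNge xn.
(* The cells are open on the left and miss time 0, which is covered by [poisson_time0]. *)
have [t0|t0] := leP t 0.
  apply: (@le_trans _ _ (N w [set x : XX | box n%:R n%:R x /\ time x = 0])); last by rewrite w0.
  apply: le_measure; rewrite ?inE; [exact: mt|exact: mt|].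
  by move=> x /= [xb xt]; split => //; apply/eqP; rewrite eq_le time_ge0 xt t0.
pose q : R := n%:R / p.+1%:R.
have qn : p.+1%:R * q = n%:R by rewrite /q mulrC divfK ?pnatr_eq0.
have tq : exists k, t <= k%:R * q by exists p.+1; rewrite qn.
(* The least k with t <= k q designates the half-open cell which contains [t], here with k = j +
   1. *)
case: (ex_minnP tq) => -[|j] tj jmin; first by move: t0; rewrite ltNge (le_trans tj) ?mul0r.
have jp : (j < p.+1)%N by apply: jmin; rewrite qn.
have jt : j%:R * q < t by rewrite ltNge; apply/negP => /jmin; rewrite ltnn.
apply: (@le_trans _ _ (N w (cell p j))).
  apply: le_measure; rewrite ?inE; [exact: mt|exact: mcell|].
  by move=> x /= [/andP[_ xn] xt]; rewrite /cell /= xn xt jt tj.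
apply: contrapT => Nj; apply: gp; exists j => // -[e|e]; apply: Nj; rewrite [N w _]e//.
Qed.

End simplicity.

(** * Predictable sets and the compensation formula *)

Section predictable_sigma_algebra.
Context (R : realType) (d : nat).
Local Notation XX := (X R d).
Local Notation Om := (Omega R d).

Definition after (s : R) : set XX := [set x | s < time x].

Lemma measurable_after s : measurable (after s).
Proof.
rewrite (_ : after s = ~` upto s); first by apply: measurableC; exact: measurable_upto.
by apply/seteqP; split => x; rewrite /after /upto /= ltNge => /negP.
Qed.

(** The usual generators of the predictable sigma-algebra, an event known at time [s] times the
    instants after [s], with [B] added to record kinds, levels and marks. *)
Definition predictable_rect : set (set (Om * XX)) :=
  [set W | exists s A B, [/\ @filtration R d s A, measurable B &
             W = A `*` (B `&` after s)]].

(* Omega x X with its predictable sigma-algebra. *)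
Definition PX := g_sigma_algebraType predictable_rect.
HB.instance Definition _ := Measurable.on PX.

Definition sec (W : set (Om * XX)) (w : Om) : set XX := [set x | W (w, x)].

Lemma sec_rect A B w : sec (A `*` B) w = if w \in A then B else set0.
Proof.
apply/seteqP; split => x; rewrite /sec /=.
  by move=> [Aw Bx]; rewrite mem_set.
by case: ifP => // /set_mem.
Qed.

Lemma predictable_rectI : setI_closed predictable_rect.
Proof.
move=> _ _ [s [A [B [sA mB ->]]]] [t [A' [B' [tA' mB' ->]]]].
exists (Num.max s t), (A `&` A'), (B `&` B'); split.
- pose T := g_sigma_algebraType (@evaluation_sets R d (upto (Num.max s t))).
  apply: (@measurableI _ T); [apply: filtration_le sA|apply: filtration_le tA'];
  by rewrite le_max lexx ?orbT.
- exact: measurableI.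
- apply/seteqP; split => -[w x] /=; rewrite /after /= gt_max.
    by move=> [[Aw [Bx sx]] [Aw' [Bx' tx]]]; rewrite sx tx.
  by move=> [[Aw Aw'] [[Bx Bx'] /andP[sx tx]]].
Qed.

Lemma predictable_rect_past (B : set XX) : measurable B -> predictable_rect (setT `*` B).
Proof.
(* As times are nonnegative, [after (-1)] is the whole space: deterministic sets are predictable,
   including their part at time 0. *)
move=> mB; exists (-1), setT, B; split => //.
  exact: (@measurableT _ (g_sigma_algebraType (@evaluation_sets R d (upto (-1))))).
congr (_ `*` _); apply/seteqP; split => x; last by case.
by move=> Bx; split => //; rewrite /after /= (lt_le_trans _ (time_ge0 x))// ltrN10.
Qed.

(* Infinite counts are discarded, so that cnt C w is additive under differences. *)
Definition cnt (C : set XX) (w : Om) (B : set XX) : \bar R :=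
  if (N w C < +oo)%E then N w (B `&` C) else 0%E.

Lemma measurable_sec (W : set PX) w : measurable W -> measurable (sec W w).
Proof.
pose H := [set W : set (Om * XX) | measurable (sec W w)].
suff : (measurable : set (set PX)) `<=` H by apply.
apply: smallest_sub; [split|].
- by rewrite /H /= (_ : sec _ _ = set0).
- by move=> A HA; rewrite /H /= setTD; apply: measurableC.
- by move=> A HA; rewrite /H /=; apply: bigcupT_measurable.
- move=> _ [s [A [B [_ mB ->]]]]; rewrite /H /= sec_rect.
  by case: ifP => // _; apply: measurableI => //; exact: measurable_after.
Qed.

Section sections.
Context (D C : set XX).
Hypotheses (mC : measurable C) (CD : C `<=` D).
Let TD := g_sigma_algebraType (@evaluation_sets R d D).
Hypothesis filtration_or : forall s A, @filtration R d s A ->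
  measurable (A : set TD) \/ C `&` after s = set0.

Lemma measurable_cnt (B : set XX) : measurable B ->
  measurable_fun setT (fun w : TD => cnt C w B).
Proof.
move=> mB; have mN (A : set XX) : measurable A -> A `<=` D -> measurable_fun setT (fun w : TD => N w A).
  by move=> mA AD _ V mV; rewrite setTI; apply: sub_sigma_algebra; exists A => //; exists V.
apply: measurable_fun_ifT => //.
  by apply: measurable_fun_lte => //; exact: mN.
by apply: mN; [exact: measurableI|move=> x [_ /CD]].
Qed.

(** Measurability with respect to the counts inside [D]. A generator starting at [s] is either known
    from [D], or starts too late to meet [C] and contributes 0. With [D] the whole space this gives
    measurability in [w]; with [D] the points up to time q, it says that the count up to q is known
    at time q. *)
Lemma measurable_cnt_sec (W : set PX) : measurable W ->
  measurable_fun setT (fun w : TD => cnt C w (sec W w)).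
Proof.
pose H := [set W : set PX | measurable W /\ measurable_fun setT (fun w : TD => cnt C w (sec W w))].
suff GH : (measurable : set (set PX)) `<=` H by move=> mW; case: (GH _ mW).
apply: lambda_system_subset => //; first exact: predictable_rectI.
- split => //.
  + by split; [exact: measurableT|exact: (measurable_cnt measurableT)].
  + move=> A B BA [mA HA] [mB HB]; split; first exact: measurableD.
    rewrite (_ : (fun w => _) = (fun w : TD => cnt C w (sec A w) - cnt C w (sec B w))%E).
      exact: emeasurable_funB.
    apply/funext => w; rewrite /cnt; case: ifPn => [Coo|_]; last by rewrite sube0.
    have mAw := measurable_sec w mA; have mBw := measurable_sec w mB.
    rewrite (_ : sec (A `\` B) w `&` C = (sec A w `&` C) `\` (sec B w `&` C)); last first.
      apply/seteqP; split => x; rewrite /sec /=.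
        by move=> [[Ax Bx] Cx]; split => // -[].
      by move=> [[Ax Cx] nBC]; split => //; split => // Bx; apply: nBC.
    rewrite measureD; first last.
    - by apply: le_lt_trans Coo; apply: le_measure; rewrite ?inE//; exact: measurableI.
    - exact: measurableI.
    - exact: measurableI.
    by congr (_ - N w _)%E; apply/setIidr => x [Bx Cx]; split => //; exact: BA.
  + move=> F ndF HF; split; first by apply: bigcupT_measurable => n; case: (HF n).
    apply: (emeasurable_fun_cvg (fun n (w : TD) => cnt C w (sec (F n) w))).
    - by move=> n; case: (HF n).
    - move=> w _; rewrite /cnt; case: ifPn => [Coo|_]; last exact: cvg_cst.
      rewrite (_ : sec (\bigcup_i F i) w `&` C = \bigcup_i (sec (F i) w `&` C)); last by rewrite -setI_bigcupl.
      apply: nondecreasing_cvg_mu.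
      + by move=> n; apply: measurableI => //; apply: measurable_sec; case: (HF n).
      + apply: bigcupT_measurable => n; apply: measurableI => //.
        by apply: measurable_sec; case: (HF n).
      + move=> n n' nn'; apply/subsetPset => x [Fx Cx]; split => //.
        by move: Fx; apply: (subsetPset _ _ (ndF _ _ nn')).
- move=> _ [s [A [B [sA mB ->]]]]; split.
    by apply: sub_sigma_algebra; exists s, A, B.
  have mB' : measurable (B `&` after s) by apply: measurableI => //; exact: measurable_after.
  have [mA|Cs] := filtration_or sA; last first.
    rewrite (_ : (fun w => _) = cst 0%E)//; apply/funext => w; rewrite /cnt /= sec_rect.
    case: ifP => // _; case: ifP => _; last by rewrite set0I measure0.
    by rewrite -setIA (setIC _ C) Cs setI0 measure0.
  rewrite (_ : (fun w => _) = (fun w : TD => (\1_A w)%:E * cnt C w (B `&` after s))%E).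
    apply: emeasurable_funM; last exact: measurable_cnt.
    by apply/measurable_EFinP; exact: measurable_indic.
  apply/funext => w; rewrite sec_rect indicE; case: ifP => _; first by rewrite mul1e.
  by rewrite mul0e /cnt; case: ifP => // _; rewrite set0I measure0.
Qed.

End sections.
End predictable_sigma_algebra.

Section mixture.
Context (R : realType) (d : nat).
Local Notation XX := (X R d).
Local Notation Om := (Omega R d).
Local Notation PXX := (PX R d).
Context (P : probability Om R) (K : Om -> {measure set XX -> \bar R}).
Hypothesis mK : forall W : set PXX, measurable W ->
  measurable_fun setT (fun w : Om => K w (sec W w)).

(** The semidirect product P(dw) K(w, dx), on the predictable sigma-algebra. *)
Definition mix (W : set PXX) : \bar R := (\int[P]_w K w (sec W w))%E.

Let mix0 : mix set0 = 0%E.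
Proof. by rewrite /mix integral0_eq// => w _; rewrite (_ : sec _ _ = set0). Qed.

Let mix_ge0 W : (0 <= mix W)%E.
Proof. by apply: integral_ge0 => w _; exact: measure_ge0. Qed.

Let mix_sigma_additive : semi_sigma_additive mix.
Proof.
move=> F mF tF mUF.
rewrite [X in _ --> X](_ : _ = \sum_(n <oo) mix (F n))%E.
  by apply/cvg_closeP; split; [exact: is_cvg_nneseries|rewrite closeE].
rewrite -integral_nneseries//; last by move=> n; exact: mK.
apply: eq_integral => w _; rewrite (_ : sec _ _ = \bigcup_n sec (F n) w)//.
rewrite measure_bigcup//.
- by apply: eq_eseriesl => n; rewrite in_setT.
- by move=> n _; exact: measurable_sec.
- by move=> i j _ _ [x [xi xj]]; apply: tF => //; exists (w, x).
Qed.

HB.instance Definition _ := isMeasure.Build _ _ _ mix mix0 mix_ge0 mix_sigma_additive.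

Definition mix_measure : {measure set PXX -> \bar R} := mix.

Lemma measurable_pair (f : PXX -> \bar R) w : measurable_fun setT f ->
  measurable_fun setT (fun x : XX => f (w, x)).
Proof.
move=> mf _ V mV; rewrite setTI.
by have := measurable_sec w (mf measurableT V mV); rewrite setTI.
Qed.

Import HBNNSimple.

Let integral_simple (f : {nnsfun PXX >-> R}) w :
  (\int[K w]_x (f (w, x))%:E = \sum_(k \in range f) k%:E * K w (sec (f @^-1` [set k]) w))%E.
Proof.
under eq_integral => x _.
  rewrite (_ : (f (w, x))%:E = \sum_(k \in range f) (k%:E * (\1_(sec (f @^-1` [set k]) w) x)%:E)%E)%E; last first.
    by rewrite fimfunE -fsumEFin//; apply: eq_fsbigr => k _; rewrite EFinM.
  over.
have ms k : measurable (sec (f @^-1` [set k]) w) by exact: measurable_sec.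
rewrite ge0_integral_fsum//; last 2 first.
- by move=> r; apply: measurable_funeM; apply/measurable_EFinP; exact: measurable_indic.
- move=> r x _; have := nnfun_muleindic_ge0 f r (w, x).
  by rewrite !indicE.
apply: eq_fsbigr => k; rewrite inE => -[z _ <-].
by rewrite ge0_integralZl ?integral_indic ?setIT ?lee_fin//; apply/measurable_EFinP; exact: measurable_indic.
Qed.

Let measurable_simple (f : {nnsfun PXX >-> R}) :
  measurable_fun setT (fun w => (\int[K w]_x (f (w, x))%:E)%E).
Proof.
rewrite (funext (integral_simple f)); apply: emeasurable_fsum => // r.
by apply: measurable_funeM; exact: mK.
Qed.

Let mix_simple (f : {nnsfun PXX >-> R}) :
  (\int[mix]_z (f z)%:E = \int[P]_w \int[K w]_x (f (w, x))%:E)%E.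
Proof.
rewrite integralT_nnsfun sintegralE.
under [RHS]eq_integral do rewrite integral_simple.
rewrite ge0_integral_fsum//; last 2 first.
- by move=> r; apply: measurable_funeM; exact: mK.
- move=> r w _; have [r0|r0] := leP 0 r; first by rewrite mule_ge0.
  rewrite preimage_nnfun0// (_ : sec _ _ = set0) ?measure0 ?mule0//.
apply: eq_fsbigr => k; rewrite inE => -[z _ <-].
by rewrite ge0_integralZl ?lee_fin//; exact: mK.
Qed.

Lemma measurable_integral_mix (f : PXX -> \bar R) : measurable_fun setT f ->
  (forall z, 0 <= f z)%E -> measurable_fun setT (fun w => (\int[K w]_x f (w, x))%E).
Proof.
move=> mf f0; pose g := nnsfun_approx measurableT mf.
have nd a b : (a <= b)%N -> forall z, g a z <= g b z.
  by move=> ab z; exact/lefP/nd_nnsfun_approx.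
apply: (emeasurable_fun_cvg (fun n w => (\int[K w]_x (g n (w, x))%:E)%E)).
  by move=> n; exact: measurable_simple.
move=> w _; rewrite (_ : (\int[K w]_x f (w, x) = \int[K w]_x (limn (fun n => (g n (w, x))%:E)))%E).
  apply: cvg_monotone_convergence => //.
  - move=> n; apply: (@measurable_pair (EFin \o g n)); exact/measurable_EFinP.
  - by move=> n x _; rewrite lee_fin.
  - by move=> x _ a b ab; rewrite lee_fin; exact: nd.
by apply: eq_integral => x _; apply/esym/cvg_lim => //; exact: cvg_nnsfun_approx.
Qed.

Lemma integral_mix (f : PXX -> \bar R) : measurable_fun setT f ->
  (forall z, 0 <= f z)%E ->
  (\int[mix]_z f z = \int[P]_w \int[K w]_x f (w, x))%E.
Proof.
move=> mf f0; pose g := nnsfun_approx measurableT mf.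
have nd a b : (a <= b)%N -> forall z, g a z <= g b z.
  by move=> ab z; exact/lefP/nd_nnsfun_approx.
have gf z : (g n z)%:E @[n --> \oo] --> f z by exact: cvg_nnsfun_approx.
transitivity (limn (fun n => \int[mix]_z (g n z)%:E))%E.
  rewrite -monotone_convergence//.
  - by apply: eq_integral => z _; apply/esym/cvg_lim.
  - by move=> n; exact/measurable_EFinP.
  - by move=> n x _; rewrite lee_fin.
  - by move=> x _ a b ab; rewrite lee_fin; exact: nd.
under [X in limn X]eq_fun do rewrite mix_simple.
rewrite -monotone_convergence//.
- apply: eq_integral => w _; rewrite -monotone_convergence//.
  + by apply: eq_integral => x _; apply/cvg_lim => //; exact: gf.
  + move=> n; apply: (@measurable_pair (EFin \o g n)); exact/measurable_EFinP.
  + by move=> n x _; rewrite lee_fin.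
  + by move=> x _ a b ab; rewrite lee_fin; exact: nd.
- by move=> n w _; apply: integral_ge0 => x _; rewrite lee_fin.
- move=> w _ a b ab; apply: ge0_le_integral => //.
  + by move=> x _; rewrite lee_fin.
  + apply: (@measurable_pair (EFin \o g a)); exact/measurable_EFinP.
  + apply: (@measurable_pair (EFin \o g b)); exact/measurable_EFinP.
  + by move=> x _; rewrite lee_fin; exact: nd.
Qed.

End mixture.

Section restricted_measure.
Context d (T : measurableType d) (R : realType) (mu : {measure set T -> \bar R})
  (D : set T) (mD : measurable D).

Lemma ge0_integral_mrestr (f : T -> \bar R) : measurable_fun setT f ->
  (forall x, 0 <= f x)%E ->
  (\int[mrestr mu mD]_x f x = \int[mu]_(x in D) f x)%E.
Proof.
move=> mf f0; rewrite (@ge0_negligible_integral _ _ _ _ setT (~` D))//.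
- rewrite setTD setCK; apply: eq_measure_integral => A mA AD.
  by rewrite /= /mrestr setIidl.
- exact: measurableC.
- by rewrite /= /mrestr setICl measure0.
Qed.

End restricted_measure.

Section compensation.
Context (R : realType) (d : nat).
Local Notation XX := (X R d).
Local Notation Om := (Omega R d).
Local Notation PXX := (PX R d).
Context (nu : 'I_d.+1 -> probability R R) (P : probability Om R).
Hypothesis nu_ge0 : forall k, nu k `[0, +oo[%classic = 1%E.
Hypothesis P_poisson : poisson_random_measure P (intensity_measure nu).

(** The intensity obtained as an expectation: countable additivity is inherited from [N], and
    [meanE] identifies the values on measurable sets. *)
Definition mean (B : set XX) : \bar R := (\int[P]_w N w B)%E.

Let mean0 : mean set0 = 0%E.
Proof. by rewrite /mean integral0_eq// => w _; rewrite measure0. Qed.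

Let mean_ge0 B : (0 <= mean B)%E.
Proof. by apply: integral_ge0 => w _; exact: measure_ge0. Qed.

Let mean_sigma_additive : semi_sigma_additive mean.
Proof.
move=> F mF tF mUF.
rewrite [X in _ --> X](_ : _ = \sum_(n <oo) mean (F n))%E.
  by apply/cvg_closeP; split; [exact: is_cvg_nneseries|rewrite closeE].
rewrite -integral_nneseries//; last by move=> n; exact: measurable_N.
apply: eq_integral => w _; rewrite measure_bigcup//.
by apply: eq_eseriesl => n; rewrite in_setT.
Qed.

HB.instance Definition _ := isMeasure.Build _ _ _ mean mean0 mean_ge0 mean_sigma_additive.

Lemma meanE B : measurable B -> mean B = intensity_measure nu B.
Proof. exact: (poisson_mean (intensity_ge0 nu) P_poisson). Qed.

Lemma mean_box n : (mean (box n%:R n%:R) < +oo)%E.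
Proof. by rewrite meanE ?intensity_box ?ltry//; exact: measurable_box. Qed.

Lemma box_cover : \bigcup_n (box n%:R n%:R : set XX) = setT.
Proof.
apply/seteqP; split => // x _.
exists (Num.truncn (Num.max (time x) (level x))).+1 => //; rewrite /box /= -ge_max.
by rewrite ltW// truncnS_gt.
Qed.

Let mean_sigma_finite : sigma_finite setT mean.
Proof.
exists (fun n => box n%:R n%:R); first by rewrite box_cover.
by move=> n; split; [exact: measurable_box|exact: mean_box].
Qed.

HB.instance Definition _ := Measure_isSigmaFinite.Build _ _ _ mean mean_sigma_finite.

Lemma measurable_mean_sec (W : set PXX) : measurable W ->
  measurable_fun setT (fun w : Om => mean (sec W w)).
Proof.
move=> mW; have mW' : measurable (W : set (Om * XX)).
  move: W mW; apply: smallest_sub; first exact: sigma_algebra_measurable.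
  move=> _ [s [A [B [sA mB ->]]]]; apply: measurableX; first exact: filtration_sub sA.
  by apply: measurableI => //; exact: measurable_after.
have := measurable_fun_xsection mean mW'.
congr (measurable_fun _ _); apply/funext => w /=; congr mean.
by apply/seteqP; split => x; rewrite /xsection /sec /= inE.
Qed.

Definition tame (w : Om) := forall n : nat, (N w (box n%:R n%:R) < +oo)%E.

(* The configuration as a measure, replaced by 0 when it is not locally finite. *)
Definition tamed (w : Om) : {measure set XX -> \bar R} :=
  if `[< tame w >] then N w else mzero.

Lemma tame_ae : {ae P, forall w, tame w}.
Proof.
apply/ae_foralln => n; apply: (poisson_lty P_poisson); first exact: measurable_box.
by rewrite intensity_box// ltry.
Qed.

Lemma measurable_tamed (W : set PXX) : measurable W ->
  measurable_fun setT (fun w : Om => tamed w (sec W w)).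
Proof.
move=> mW; pose t (w : Om) : \bar R := (\1_[set w | tame w] w)%:E.
have mt : measurable [set w : Om | tame w].
  rewrite (_ : [set w | _] = \bigcap_n [set w : Om | (N w (box n%:R n%:R) < +oo)%E]).
    apply: bigcapT_measurable => n.
    have mn : measurable [set y : \bar R | (y < +oo)%E].
      rewrite (_ : [set _ | _] = ~` [set +oo%E]).
        by apply: measurableC; exact: emeasurable_set1.
      by apply/seteqP; split => y; rewrite /= ltey => /eqP.
    by apply: (measurable_N_preimage _ mn); exact: measurable_box.
  by apply/seteqP; split => w /= h n; [move=> _|]; exact: h.
apply: (emeasurable_fun_cvg (fun n w => t w * cnt (box n%:R n%:R) w (sec W w))%E).
  move=> n; apply: emeasurable_funM.
    by apply/measurable_EFinP; exact: measurable_indic.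
  apply: (@measurable_cnt_sec _ _ setT (box n%:R n%:R)) => //; first exact: measurable_box.
  by move=> s A sA; left; exact: filtration_sub sA.
move=> w _; rewrite /t indicE /tamed; case: asboolP => [tw|tw]; last first.
  by rewrite memNset//; under eq_fun do rewrite mul0e; exact: cvg_cst.
rewrite mem_set//; under eq_fun do rewrite mul1e /cnt tw.
rewrite -[X in N w X]setIT -box_cover setI_bigcupr.
have ms := measurable_sec w mW.
apply: nondecreasing_cvg_mu.
- by move=> n; apply: measurableI => //; exact: measurable_box.
- by apply: bigcupT_measurable => n; apply: measurableI => //; exact: measurable_box.
- move=> n m nm; apply/subsetPset => x [sx /andP[xn xl]]; split => //.
  by rewrite /box /= (le_trans xn) ?(le_trans xl) ?ler_nat.
Qed.

(** On a rectangle the compensation formula is the independence of an event of the past of [s] from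
    the count after [s]. *)
Lemma mix_rect (W : set PXX) : predictable_rect W ->
  mix P tamed W = mix P (fun=> mean) W.
Proof.
move=> [s [A [B [sA mB ->]]]]; have mA := filtration_sub sA.
have mB' : measurable (B `&` after s) by apply: measurableI => //; exact: measurable_after.
have mR : measurable (A `*` (B `&` after s) : set PXX).
  by apply: sub_sigma_algebra; exists s, A, B.
transitivity (\int[P]_(w in A) N w (B `&` after s))%E.
  rewrite integral_mkcond; apply: ge0_ae_eq_integral => //.
  - exact: measurable_tamed.
  - by apply/(measurable_restrictT _ _).1 => //; apply: measurable_funTS; exact: measurable_N.
  - by move=> w _; rewrite patchE; case: ifP.
  move: tame_ae; apply: (@filterS _ _ (ae_filter_ringOfSetsType P)) => w tw _.
  rewrite /tamed asboolT// sec_rect patchE; case: ifP => // _; exact: measure0.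
rewrite (filtration_mean (intensity_ge0 nu) P_poisson sA mB'); last first.
  by apply/seteqP; split => // x [[_ sx] xs]; move: sx; rewrite /after /= ltNge xs.
rewrite /mix (eq_integral (fun w => mean (B `&` after s) * (\1_A w)%:E)%E).
  rewrite ge0_integralZl//; last by apply/measurable_EFinP; exact: measurable_indic.
  by rewrite integral_indic// setIT -meanE// muleC.
move=> w _; rewrite sec_rect indicE; case: ifP => _; first by rewrite mule1.
by rewrite mule0 measure0.
Qed.

(** Both sides integrate [f] against a measure on Omega x X, P(dw) N(w, dx) or P(dw) mean(dx). These
    agree on the predictable rectangles, which are stable under intersection, and are finite on the
    products of Omega with the boxes, which exhaust the space. *)
Lemma compensation (f : PXX -> \bar R) : measurable_fun setT f ->
  (forall z, 0 <= f z)%E ->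
  (\int[P]_w \int[tamed w]_x f (w, x) = \int[P]_w \int[mean]_x f (w, x))%E.
Proof.
move=> mf f0.
rewrite -(integral_mix P measurable_tamed mf f0).
rewrite -(integral_mix P (K := fun=> mean) measurable_mean_sec mf f0).
apply: eq_set_function_integral => W mW _.
pose g n : set PXX := setT `*` box n%:R n%:R.
have rg n : predictable_rect (g n) by apply: predictable_rect_past; exact: measurable_box.
change (mix_measure P measurable_tamed W = mix_measure P (K := fun=> mean) measurable_mean_sec W).
apply: (@g_sigma_algebra_measure_unique _ _ PXX (@predictable_rect R d) _ g _ _ (mix_measure P measurable_tamed) (mix_measure P (K := fun=> mean) measurable_mean_sec)) => //.
- exact: sub_sigma_algebra.
- by apply/seteqP; split => // -[w x] _; have : setT x by []; rewrite -box_cover => -[n _ bx]; exists n.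
- exact: predictable_rectI.
- exact: mix_rect.
- move=> n; change (mix P tamed (g n) < +oo)%E; rewrite (mix_rect (rg n)) /mix.
  rewrite (eq_integral (cst (mean (box n%:R n%:R)))).
    by rewrite integral_cst// [X in (_ * X)%E]probability_setT mule1; exact: mean_box.
  by move=> w _; rewrite sec_rect in_setT.
Qed.

End compensation.

(** * Independence of the marks *)

Section marks.
Context (R : realType) (d : nat).
Local Notation XX := (X R d).
Local Notation Om := (Omega R d).
Local Notation PXX := (PX R d).
Context (nu : 'I_d.+1 -> probability R R) (P : probability Om R).
Hypothesis nu_ge0 : forall k, nu k `[0, +oo[%classic = 1%E.
Hypothesis P_poisson : poisson_random_measure P (intensity_measure nu).

(* Membership of a point of kind k does not depend on its mark. *)
Definition markless (k : 'I_d.+1) (S : set XX) :=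
  forall x, S x -> kind x = k /\
    forall y, kind y = k -> time y = time x -> level y = level x -> S y.

Lemma marklessE k S t th y : markless k S -> 0 <= t -> 0 <= th -> 0 <= y ->
  S (inX k t th y) = S (inX k t th 0).
Proof.
move=> mS t0 th0 y0; apply/propext; split => /mS[_]; apply;
  by rewrite ?/time ?/level ?/kind.
Qed.

Lemma mean_kind k (A : set XX) : measurable A -> (forall x, A x -> kind x = k) ->
  mean P A = (\int[lebesgue_measure]_(t in `[0%R, +oo[)
      \int[lebesgue_measure]_(th in `[0%R, +oo[)
      \int[nu k]_(y in `[0%R, +oo[) (\1_A (inX k t th y))%:E)%E.
Proof.
move=> mA Ak; rewrite (meanE P_poisson mA) intensityE.
pose F k' := (\int[lebesgue_measure]_(t in `[0%R, +oo[)
      \int[lebesgue_measure]_(th in `[0%R, +oo[)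
      \int[nu k']_(y in `[0%R, +oo[) (\1_A (inX k' t th y))%:E)%E.
rewrite -[LHS]/(\sum_(k' < d.+1) F k')%E -[RHS]/(F k).
rewrite (bigD1 k) // big1; first exact: adde0.
move=> k' kk'; rewrite /F integral0_eq// => t _; rewrite integral0_eq// => th _.
rewrite integral0_eq// => y _; rewrite indicE memNset// => /Ak/eqP.
by rewrite (negbTE kk').
Qed.

Let mR := measurableTypeR R.

Lemma measurable_slice k (S : set XX) : measurable S ->
  measurable_fun setT (fun u : mR * mR => (\1_S (inX k u.1 u.2 0))%:E : \bar R).
Proof.
move=> mS; apply/measurable_EFinP; apply: (measurableT_comp (measurable_indic mS)).
move=> _ _ [V mV <-]; rewrite !setTI.
have : measurable_fun setT (fun u : mR * mR => (k, `|u.1 : R|, `|u.2 : R|, `|0 : R|)).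
  by repeat (apply: measurable_fun_pair => //); apply: measurableT_comp => //.
by move=> /(_ measurableT _ mV); rewrite setTI.
Qed.

(** The length of the set of levels of kind [k] in [S] at time [t]; the mark 0 stands for all marks
    when [S] is [markless]. *)
Definition slice k (S : set XX) (t : R) : \bar R :=
  (\int[lebesgue_measure]_(th in `[0%R, +oo[) (\1_S (inX k t th 0))%:E)%E.

Lemma slice_ge0 k S t : (0 <= slice k S t)%E.
Proof. by apply: integral_ge0 => th _; rewrite lee_fin. Qed.

Lemma measurable_fun_slice k (S : set XX) : measurable S ->
  measurable_fun setT (slice k S : mR -> \bar R).
Proof.
move=> mS.
pose f (u : mR * mR) : \bar R := ((\1_S (inX k u.1 u.2 0))%:E * (\1_(`[0%R, +oo[%classic) (u.2 : R))%:E)%E.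
have mf : measurable_fun setT f.
  apply: emeasurable_funM; first exact: measurable_slice.
  apply/measurable_EFinP; apply: (measurableT_comp (measurable_indic _)) => //.
have -> : slice k S = fubini_F lebesgue_measure f.
  apply/funext => t; rewrite /slice /fubini_F [LHS]integral_mkcond.
  apply: eq_integral => th _; rewrite /f patchE /= !indicE.
  by case: ifP => _; rewrite ?mule1 ?mule0.
apply: measurable_fun_fubini_tonelli_F => //.
by move=> u; rewrite /f -EFinM lee_fin.
Qed.

Lemma mean_markless k (S : set XX) : measurable S -> markless k S ->
  mean P S = (\int[lebesgue_measure]_(t in `[0%R, +oo[) slice k S t)%E.
Proof.
move=> mS kS; rewrite (mean_kind (k := k) mS); last by move=> x /kS[].
apply: eq_integral => t /in_ge0 t0; apply: eq_integral => th /in_ge0 th0.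
transitivity (\int[nu k]_(y in `[0%R, +oo[) (cst (\1_S (inX k t th 0))%:E y))%E.
  apply: eq_integral => y /in_ge0 y0; rewrite /cst !indicE.
  congr (_%:R%:E); congr nat_of_bool.
  by apply/idP/idP; rewrite !in_setE (marklessE kS t0 th0 y0).
by rewrite integral_cst// [X in (_ * X)%E]nu_ge0 mule1.
Qed.

Lemma mean_mark k (S : set XX) (B : set R) : measurable S -> markless k S -> measurable B ->
  mean P (S `&` @mark R d @^-1` B) = (mean P S * nu k (B `&` `[0%R, +oo[))%E.
Proof.
move=> mS kS mB.
have mB' : measurable (S `&` @mark R d @^-1` B).
  by apply: measurableI => //; rewrite -[X in measurable X]setTI; exact: measurable_mark.
rewrite (mean_kind (k := k) mB'); last by move=> x [/kS[]].
rewrite (mean_markless mS kS); set c := nu k _.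
have mb := measurable_slice k mS.
rewrite -ge0_integralZr//; last 3 first.
- exact: (measurable_funTS (measurable_fun_slice k mS)).
- by move=> t _; exact: slice_ge0.
- exact: measure_ge0.
apply: eq_integral => t /in_ge0 t0.
rewrite /slice -ge0_integralZr//; last 2 first.
- have m2 : measurable_fun setT (fun th : mR => (t : mR, th)) by exact: measurable_fun_pair.
  exact: (measurable_funTS (measurableT_comp mb m2)).
- exact: measure_ge0.
apply: eq_integral => th /in_ge0 th0.
transitivity (\int[nu k]_(y in `[0%R, +oo[) ((\1_S (inX k t th 0))%:E * (\1_B y)%:E))%E.
  apply: eq_integral => y /in_ge0 y0.
  rewrite -EFinM !indicE -natrM mulnb; congr (_%:R%:E); congr nat_of_bool.
  apply/idP/andP => [/set_mem[Sx Bx]|[/set_mem Sx /set_mem Bx]].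
    split; apply/mem_set; first by rewrite -(marklessE kS t0 th0 y0).
    by move: Bx; rewrite /mark /= ger0_norm.
  by apply/mem_set; split; [rewrite marklessE|rewrite /mark /= ger0_norm].
rewrite ge0_integralZl//; last by apply/measurable_EFinP; exact: measurable_indic.
by rewrite integral_indic.
Qed.

Let markless_box k S n : markless k S -> markless k (S `&` box n%:R n%:R).
Proof.
move=> kS x [/kS[kx Sx] bx]; split => // y ky ty ly; split; first exact: Sx.
by rewrite /box /= ty ly.
Qed.

Lemma integral_mean_mark_le k (S : set XX) (g : R -> \bar R) :
  measurable S -> markless k S -> measurable_fun setT g -> (forall y, 0 <= g y)%E ->
  (\int[mean P]_(x in S) g (mark x) <=
   mean P S * \int[nu k]_(y in `[0%R, +oo[) g y)%E.
Proof.
move=> mS kS mg g0; pose Sn n := S `&` box n%:R n%:R.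
have mb n : measurable (box n%:R n%:R : set XX) by exact: measurable_box.
have mSn n : measurable (Sn n) by exact: measurableI.
have Snd : nondecreasing_seq Sn.
  move=> n m nm; apply/subsetPset => x [sx /andP[xn xl]]; split => //.
  by rewrite /box /= (le_trans xn) ?(le_trans xl) ?ler_nat.
have mgm : measurable_fun setT (fun x : XX => g (mark x)).
  by apply: measurableT_comp => //; exact: measurable_mark.
have le n : (\int[mean P]_(x in Sn n) g (mark x) <=
   mean P S * \int[nu k]_(y in `[0%R, +oo[) g y)%E.
  have Soo : (mean P (Sn n) < +oo)%E.
    apply: le_lt_trans (mean_box nu_ge0 P_poisson n).
    apply: (le_measure (mean P)); rewrite ?inE; [exact: mSn|exact: mb|exact: subIsetr].
  rewrite -ge0_integral_mrestr//.
  have mm : measurable_fun setT (@mark R d) by exact: measurable_mark.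
  rewrite -[leLHS]/(\int[mrestr (mean P) (mSn n)]_x (g \o @mark R d) x)%E.
  rewrite -[X in (\int[_]_(x in X) _ <= _)%E](preimage_setT (@mark R d)).
  rewrite -(ge0_integral_pushforward mm _ measurableT mg); last by move=> y _; exact: g0.
  have mI : measurable (`[0, +oo[%classic : set R) by [].
  have a0 : 0 <= fine (mean P (Sn n)) by exact/fine_ge0/measure_ge0.
  (* On a piece of finite mass, the image under the mark of the restricted intensity is a multiple
     of [nu k]; the pieces then increase to [S]. *)
  rewrite (eq_measure_integral (mscale (NngNum a0) (mrestr (nu k) mI))); last first.
    move=> B mB _; rewrite /= /mscale /= /pushforward /mrestr setIC fineK; last first.
      by rewrite ge0_fin_numE//; exact: measure_ge0.
    exact: (mean_mark (mSn n) (@markless_box k S n kS) mB).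
  rewrite ge0_integral_mscale//= ge0_integral_mrestr//.
  rewrite fineK; last by rewrite ge0_fin_numE//; exact: measure_ge0.
  apply: lee_wpmul2r; first exact: integral_ge0.
  by apply: (le_measure (mean P)); rewrite ?inE; [exact: mSn|exact: mS|exact: subIsetl].
have cv := @ge0_nondecreasing_set_cvg_integral _ _ _ Sn (fun x => g (mark x)) (mean P) Snd mSn
  (fun i => measurable_funTS mgm) (fun i x _ => g0 _).
have <- : \bigcup_n Sn n = S by rewrite -setI_bigcupr box_cover setIT.
rewrite -(cvg_lim _ cv)//; apply: lime_le; first by apply/cvg_ex; eexists; exact: cv.
by apply: nearW => n; rewrite -setI_bigcupr box_cover setIT; exact: le.
Qed.

Lemma mean_count (W : set PXX) : measurable W ->
  (\int[P]_w tamed w (sec W w) = \int[P]_w mean P (sec W w))%E.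
Proof.
move=> mW; have mi : measurable_fun setT (fun z : PXX => (\1_W z)%:E : \bar R).
  by apply/measurable_EFinP; exact: measurable_indic.
have i0 (z : PXX) : (0 <= (\1_W z)%:E :> \bar R)%E by rewrite lee_fin.
transitivity (\int[P]_w \int[tamed w]_x (\1_W (w, x))%:E)%E.
  apply: eq_integral => w _; rewrite -[sec W w]setIT -integral_indic//; exact: measurable_sec.
rewrite (compensation nu_ge0 P_poisson mi i0).
apply: eq_integral => w _; rewrite -[sec W w]setIT -[RHS]integral_indic//.
exact: measurable_sec.
Qed.

(** Compensation reduces the claim to the intensity, which is a product in the mark. A bound on the
    expected number of points whose mark lies in [B] thereby bounds the number of all points,
    provided that [B] has positive probability. *)
Lemma count_mark k (W : set PXX) (B : set R) : measurable W ->
  (forall w, markless k (sec W w)) -> measurable B ->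
  (\int[P]_w tamed w (sec W w `&` @mark R d @^-1` B) =
   (\int[P]_w tamed w (sec W w)) * nu k (B `&` `[0%R, +oo[))%E.
Proof.
move=> mW kW mB.
have mV : measurable (W `&` setT `*` (@mark R d @^-1` B) : set PXX).
  apply: measurableI => //; apply: sub_sigma_algebra; apply: predictable_rect_past.
  by rewrite -[X in measurable X]setTI; exact: measurable_mark.
have sV w : sec (W `&` setT `*` (@mark R d @^-1` B)) w = sec W w `&` @mark R d @^-1` B.
  by apply/seteqP; split => x; rewrite /sec /=; [case=> ? [] |case].
transitivity (\int[P]_w tamed w (sec (W `&` setT `*` (@mark R d @^-1` B)) w))%E.
  by apply: eq_integral => w _; rewrite sV.
rewrite !mean_count// -ge0_integralZr//; last first.
  exact: (measurable_mean_sec nu_ge0 P_poisson).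
by apply: eq_integral => w _; rewrite sV (mean_mark (k := k))//; exact: measurable_sec.
Qed.

Lemma integral_mark_le k (W : set PXX) (g : R -> \bar R) : measurable W ->
  (forall w, markless k (sec W w)) ->
  measurable_fun setT g -> (forall y, 0 <= g y)%E ->
  (\int[P]_w \int[tamed w]_(x in sec W w) g (mark x) <=
   (\int[P]_w tamed w (sec W w)) * \int[nu k]_(y in `[0%R, +oo[) g y)%E.
Proof.
move=> mW kW mg g0.
have mf : measurable_fun setT (fun z : PXX => g (mark z.2) * (\1_W z)%:E)%E.
  apply: emeasurable_funM; last by apply/measurable_EFinP; exact: measurable_indic.
  move=> _ V mV; rewrite setTI.
  rewrite (_ : _ @^-1` _ = setT `*` ((fun x : XX => g (mark x)) @^-1` V)); last first.
    by apply/seteqP; split => -[w x] //= [].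
  apply: sub_sigma_algebra; apply: predictable_rect_past.
  rewrite -[X in measurable X]setTI; apply: (measurableT_comp mg _) => //.
  exact: measurable_mark.
have := compensation nu_ge0 P_poisson mf _.
have E (m : {measure set XX -> \bar R}) w :
    (\int[m]_x (g (mark x) * (\1_W (w, x))%:E) = \int[m]_(x in sec W w) g (mark x))%E.
  rewrite [RHS]integral_mkcond; apply: eq_integral => x _.
  rewrite patchE indicE (_ : ((w, x) \in W) = (x \in sec W w)); last by apply/idP/idP; rewrite !inE.
  by case: ifP; rewrite ?mule1 ?mule0.
rewrite (eq_integral (fun w => \int[tamed w]_(x in sec W w) g (mark x))%E); last by move=> w _; exact: E.
move=> ->; last by move=> z; rewrite mule_ge0// lee_fin.
rewrite mean_count// -ge0_integralZr//; last 2 first.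
- exact: (measurable_mean_sec nu_ge0 P_poisson).
- exact: integral_ge0.
apply: ge0_le_integral => //.
- by move=> w _; apply: integral_ge0 => x _; rewrite mule_ge0// lee_fin.
- apply: (measurable_integral_mix (measurable_mean_sec nu_ge0 P_poisson) mf) => z.
  by rewrite mule_ge0// lee_fin.
- apply: emeasurable_funM => //.
  exact: (measurable_mean_sec nu_ge0 P_poisson).
- move=> w _; rewrite (E (mean P)); apply: (integral_mean_mark_le (k := k)) => //.
  exact: measurable_sec.
Qed.

End marks.

Lemma measurable_fun_lt d (T : measurableType d) (R : realType) (D : set T) (f g : T -> R) :
  measurable D -> measurable_fun D f -> measurable_fun D g ->
  measurable (D `&` [set x | f x < g x]).
Proof.
move=> mD mf mg; rewrite (_ : _ `&` _ = D `\` (D `&` [set x | g x <= f x])).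
  by apply: measurableD => //; exact: measurable_fun_le.
apply/seteqP; split => x [Dx]; first by rewrite /= ltNge => /negP fg; split => // -[_ /fg].
by move=> h; split => //=; rewrite ltNge; apply/negP => gf; apply: h.
Qed.

Section predictability.
Context (R : realType) (d : nat).
Local Notation XX := (X R d).
Local Notation Om := (Omega R d).
Local Notation PXX := (PX R d).

Let pos : set PXX := [set z | 0 < time z.2].

Lemma measurable_snd_PX d' (T : measurableType d') (f : XX -> T) : measurable_fun setT f ->
  measurable_fun setT (fun z : PXX => f z.2).
Proof.
move=> mf _ V mV; rewrite setTI.
rewrite (_ : _ @^-1` _ = setT `*` (f @^-1` V)); last first.
  by apply/seteqP; split => -[w x] //= [].
apply: sub_sigma_algebra; apply: predictable_rect_past.
by rewrite -[X in measurable X]setTI; exact: mf.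
Qed.

Let measurable_pos : measurable pos.
Proof.
rewrite -[pos]setTI; apply: measurable_fun_lt => //.
exact: (measurable_snd_PX (@measurable_time R d)).
Qed.

(** Pulls predictability on Omega x R_+ back along the time coordinate. Time 0 is left out: the sets
    A x {0} with A in the filtration at 0 have no counterpart among the generators of [PX]. *)
Lemma predictable_sets_time (W : set (Om * R)) : predictable_sets W ->
  measurable [set z : PXX | 0 < time z.2 /\ W (z.1, time z.2)].
Proof.
pose H := [set W : set (Om * R) | measurable [set z : PXX | 0 < time z.2 /\ W (z.1, time z.2)]].
suff : @predictable_sets R d `<=` H by apply.
apply: smallest_sub; [split|].
- rewrite /H /= (_ : [set _ | _] = set0)//.
  by apply/seteqP; split => z //= [].
- move=> A HA; rewrite /H /=.
  rewrite (_ : [set _ | _] = pos `\` [set z | 0 < time z.2 /\ A (z.1, time z.2)]).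
    exact: measurableD.
  apply/seteqP; split => z /=; rewrite /pos.
    by move=> [z0 [_ zA]]; split => // -[].
  move=> [z0 zA]; split => //; split; last by move=> ?; exact: zA.
  by split => //=; rewrite in_itv /= andbT ltW.
- move=> A HA; rewrite /H /=.
  rewrite (_ : [set _ | _] = \bigcup_n [set z | 0 < time z.2 /\ A n (z.1, time z.2)]).
    exact: bigcupT_measurable.
  apply/seteqP; split => z /=; first by move=> [z0 [n _ An]]; exists n.
  by move=> [n _ [z0 An]]; split => //; exists n.
- move=> _ [[A A0 <-]|[s [t [A [s0 As ->]]]]]; rewrite /H /=.
    rewrite (_ : [set _ | _] = set0)//.
    by apply/seteqP; split => z //= [+ [_ z0]]; rewrite z0 ltxx.
  apply: sub_sigma_algebra; exists s, A, (upto t); split => //.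
    exact: measurable_upto.
  apply/seteqP; split => -[w x] /=; rewrite in_itv /= /upto /after /=.
    by move=> [_ [Aw /andP[-> ->]]].
  by move=> [Aw [-> sx]]; rewrite sx; split => //; exact: le_lt_trans sx.
Qed.

Lemma measurable_predictable_time (Y : R -> Om -> R) : predictable Y ->
  measurable_fun pos (fun z : PXX => Y (time z.2) z.1).
Proof.
move=> pY _ B mB; have := predictable_sets_time (pY B mB).
rewrite [X in measurable X -> _](_ : _ = pos `&` (fun z : PXX => Y (time z.2) z.1) @^-1` B)//.
apply/seteqP; split => z /=; rewrite in_itv /= andbT; first by case=> ? [].
by move=> [z0 zB]; rewrite ltW.
Qed.

(** Restriction does not anticipate: the points of [rconf C w] up to [s] are among those of [w] up
    to [s]. Hence truncated intensities remain predictable. *)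
Lemma filtration_rconf (C : set XX) s (A : set Om) : measurable C ->
  @filtration R d s A -> @filtration R d s [set w | A (rconf C w)].
Proof.
move=> mC; pose H := [set A : set Om | @filtration R d s [set w | A (rconf C w)]].
suff : @filtration R d s `<=` H by apply.
pose T := g_sigma_algebraType (@evaluation_sets R d (upto s)).
apply: smallest_sub; [split|].
- exact: (@measurable0 _ T).
- move=> B HB; rewrite /H /= (_ : [set _ | _] = setT `\` [set w | B (rconf C w)])//.
  by apply: (@measurableD _ T) => //; exact: (@measurableT _ T).
- move=> B HB; rewrite /H /= (_ : [set _ | _] = \bigcup_n [set w | B n (rconf C w)])//.
  exact: (@bigcupT_measurable _ T).
- move=> _ [B [mB Bs] [V mV <-]]; rewrite /H /=.
  apply: sub_sigma_algebra; exists (B `&` C); last first.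
    by exists V => //; apply/seteqP; split => w /=; rewrite N_rconf.
  by split; [exact: measurableI|move=> x [/Bs]].
Qed.

Lemma measurable_rconf_PX (C : set XX) : measurable C ->
  measurable_fun setT (fun z : PXX => (rconf C z.1, z.2) : PXX).
Proof.
move=> mC; apply: (@measurability _ _ PXX PXX setT _ (@predictable_rect R d) erefl).
move=> _ [_ [s [A [B [sA mB ->]]]] <-]; rewrite setTI; apply: sub_sigma_algebra.
by exists s, [set w | A (rconf C w)], B; split => //; exact: filtration_rconf.
Qed.

Lemma measurable_predictable_rconf (C : set XX) (Y : R -> Om -> R) :
  measurable C -> predictable Y ->
  measurable_fun pos (fun z : PXX => Y (time z.2) (rconf C z.1)).
Proof.
move=> mC pY.
have := @measurable_comp _ _ _ PXX PXX _ pos (fun z : PXX => Y (time z.2) z.1) pos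
  (fun z : PXX => (rconf C z.1, z.2)).
apply => //; last 2 first.
- exact: measurable_predictable_time.
- exact: (measurable_funTS (measurable_rconf_PX mC)).
- by move=> _ [z z0 <-].
Qed.

(* The defect of convergence: points accepted by the process, but rejected by
   the process driven by the points of level at most M, whatever M is. *)
Definition missed (lambda : 'I_d.+1 -> R -> Om -> R) (T : R) : set PXX :=
  [set z | [/\ 0 < time z.2, time z.2 <= T,
    level z.2 <= lambda (kind z.2) (time z.2) z.1 &
    forall M : nat, lambda (kind z.2) (time z.2) (rconf (box T M%:R) z.1) < level z.2]].

Lemma measurable_missed lambda T : (forall k, predictable (lambda k)) ->
  measurable (missed lambda T).
Proof.
move=> pl.
have mk k : measurable [set z : PXX | kind z.2 = k].
  rewrite -[X in measurable X]setTI.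
  exact: (measurable_snd_PX (@measurable_kind R d) measurableT (Y := [set k])).
have mt : measurable [set z : PXX | time z.2 <= T].
  rewrite -[X in measurable X]setTI; apply: measurable_fun_le => //.
  exact: (measurable_snd_PX (@measurable_time R d)).
have ml D : measurable D -> measurable_fun D (fun z : PXX => level z.2).
  by move=> mD; apply: measurable_funTS; exact: (measurable_snd_PX (@measurable_level R d)).
rewrite (_ : missed _ _ = \bigcup_(k in [set: 'I_d.+1]) ([set z : PXX | kind z.2 = k] `&`
   ([set z : PXX | time z.2 <= T] `&`
   (pos `&` [set z : PXX | level z.2 <= lambda k (time z.2) z.1] `&`
   \bigcap_(M : nat) (pos `&` [set z : PXX | lambda k (time z.2) (rconf (box T M%:R) z.1) < level z.2]))))).
  apply: fin_bigcup_measurable => // k _.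
  apply: measurableI => //; apply: measurableI => //; apply: measurableI.
    apply: measurable_fun_le => //; [exact: ml|exact: measurable_predictable_time].
  apply: bigcapT_measurable => M; apply: measurable_fun_lt => //.
    by apply: measurable_predictable_rconf => //; exact: measurable_box.
  exact: ml.
apply/seteqP; split => z.
  by move=> [z0 zT za zM]; exists (kind z.2) => //; split => //; split => //; split => // M _; split => //; exact: zM.
move=> [_ _ [<- [zT [[z0 za] zM]]]]; split => //.
by move=> M; have [] := zM M Logic.I.
Qed.

(* Stops once more than K points of W have been seen; rational instants make
   the condition a countable one. *)
Definition stopped (W : set PXX) (K : nat) : set PXX :=
  [set z | forall (q : rat) (m : nat), ratr q < time z.2 ->
    (cnt (box (ratr q) m%:R) z.1 (sec W z.1) <= K%:R%:E)%E].

Lemma measurable_stopped (W : set PXX) K : measurable W -> measurable (stopped W K).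
Proof.
move=> mW; rewrite -[stopped _ _]setCK; apply: measurableC.
pose A (q : rat) m : set Om := [set w | (K%:R%:E < cnt (box (ratr q) m%:R) w (sec W w))%E].
(* The complement is a countable union of rectangles: the count up to some rational q exceeds [K],
   an event known at q, and the point comes after q. *)
rewrite (_ : ~` _ = \bigcup_(q : rat) \bigcup_m (A q m `*` (setT `&` after (ratr q)))); last first.
  apply/seteqP; split => -[w x] /=.
    move=> /existsNP[q /existsNP[m /not_implyP[qx /negP]]].
    by rewrite -ltNge => h; exists q => //; exists m.
  move=> [q _ [m _ [+ [_ qx]]]] /(_ q m qx).
  by rewrite /A /= ltNge => /negP.
apply: bigcupT_measurable_rat => q; apply: bigcupT_measurable => m.
apply: sub_sigma_algebra; exists (ratr q), (A q m), setT; split => //.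
pose TD := g_sigma_algebraType (@evaluation_sets R d (upto (ratr q))).
have mc : measurable_fun setT (fun w : TD => cnt (box (ratr q) m%:R) w (sec W w)).
  apply: measurable_cnt_sec mW; first exact: measurable_box.
    by move=> x /andP[].
  move=> s B sB; have [sq|qs] := leP s (ratr q); first by left; exact: filtration_le sB.
  right; apply/seteqP; split => // x [/andP[xq _] sx].
  by move: (lt_trans qs sx); rewrite ltNge xq.
have := @measurable_lte _ TD R setT measurableT (cst K%:R%:E) _ (measurable_cst _) mc.
by rewrite setTI.
Qed.

End predictability.

Lemma leq_in_count (T : eqType) (a b : pred T) (s : seq T) :
  {in s, forall y, a y -> b y} -> (count a s <= count b s)%N.
Proof.
elim: s => //= x s IHs ab; apply: leq_add.
  by have := ab x (mem_head _ _); case: (a x) => // ->.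
by apply: IHs => y ys; apply: ab; rewrite inE ys orbT.
Qed.

Lemma seq_max_exists (T : eqType) (R : realDomainType) (f : T -> R) (v : seq T) :
  v != [::] -> exists2 x, x \in v & {in v, forall y, f y <= f x}.
Proof.
elim: v => // a v IHv _; have [->|/IHv[x xv xmax]] := eqVneq v [::].
  by exists a; rewrite ?inE// => y; rewrite inE => /eqP ->.
have [ax|xa] := leP (f a) (f x).
  by exists x; [rewrite inE xv orbT|move=> y; rewrite inE => /predU1P[->//|/xmax]].
exists a; first by rewrite inE eqxx.
move=> y; rewrite inE => /predU1P[->//|/xmax yx]; exact: le_trans (ltW xa).
Qed.

(** * Stopped counts and sums over a configuration *)

Section stopping.
Context (R : realType) (d : nat).
Local Notation XX := (X R d).
Local Notation Om := (Omega R d).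
Local Notation PXX := (PX R d).

Lemma N_finite_count (s : seq XX) (A : set XX) :
  N (finite_config s : Om) A = (count (fun x => x \in A) s)%:R%:E.
Proof.
rewrite N_finiteE -sum1_count natr_sum -sumEFin [RHS]big_mkcond/=.
by apply: eq_bigr => x _; rewrite diracE; case: (x \in A).
Qed.

Lemma rat_gap (v : seq XX) (t : R) : exists2 q : rat, ratr q < t &
  {in v, forall y, time y < t -> time y <= ratr q}.
Proof.
elim: v => [|a v [q qt qv]].
  have /rat_in_itvoo[q] : t - 1 < t by rewrite ltrBlDr ltrDl.
  by rewrite in_itv /= => /andP[_ qt]; exists q.
have [at_|ta] := ltP (time a) t; last first.
  exists q => // y; rewrite inE => /predU1P[-> /(le_lt_trans ta)|/qv//].
  by rewrite ltxx.
have /rat_in_itvoo[p] : Num.max (ratr q) (time a) < t by rewrite gt_max qt.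
rewrite in_itv /= gt_max => /andP[/andP[qp ap] pt]; exists p => // y.
rewrite inE => /predU1P[-> _|/qv/[apply] yq]; first exact: ltW.
exact: le_trans (ltW qp).
Qed.

Lemma tame_box (w : Om) T M : tame w -> (N w (box T M) < +oo)%E.
Proof.
move=> tw; have [n _] : exists2 n : nat, True & Num.max T M <= n%:R.
  by exists (Num.truncn (Num.max T M)).+1 => //; rewrite ltW// truncnS_gt.
rewrite ge_max => /andP[Tn Mn]; apply: le_lt_trans (tw n).
apply: le_measure; rewrite ?inE; [exact: measurable_box|exact: measurable_box|].
by move=> x /andP[xT xM]; rewrite /box /= (le_trans xT) ?(le_trans xM).
Qed.

Lemma N_box_le (w : Om) (A : set XX) (c : \bar R) : measurable A ->
  (forall n : nat, (N w (A `&` box n%:R n%:R) <= c)%E) -> (N w A <= c)%E.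
Proof.
move=> mA Ac; rewrite -[A]setIT -box_cover setI_bigcupr.
have mb n : measurable (A `&` box n%:R n%:R : set XX).
  by apply: measurableI => //; exact: measurable_box.
have cv : (N w \o (fun n => A `&` box n%:R n%:R)) n @[n --> \oo] -->
    N w (\bigcup_n (A `&` box n%:R n%:R)).
  apply: nondecreasing_cvg_mu => //; first exact: bigcupT_measurable.
  move=> n m nm; apply/subsetPset => x [sx /andP[xn xl]]; split => //.
  by rewrite /box /= (le_trans xn) ?(le_trans xl) ?ler_nat.
rewrite -(cvg_lim _ cv)//; apply: lime_le; first by apply/cvg_ex; eexists; exact: cv.
by apply: nearW => n; exact: Ac.
Qed.

(** Consider the latest stopped point in a box. A rational instant just before it separates it from
    the earlier ones, of which there are therefore at most [K]; by simplicity no other point shares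
    its time. Hence K + 1 and not K. *)
Lemma stopped_count (W : set PXX) K (w : Om) : measurable W -> tame w ->
  (forall (n : nat) t, (N w [set x : XX | box n%:R n%:R x /\ time x = t] <= 1)%E) ->
  (N w (sec W w `&` sec (stopped W K) w) <= K.+1%:R%:E)%E.
Proof.
move=> mW tw simple.
have mA : measurable (sec W w `&` sec (stopped W K) w).
  by apply: measurableI; apply: measurable_sec => //; exact: measurable_stopped.
apply: N_box_le => // n; set A := sec W w `&` _.
have [s [es sb]] := rconf_finite (tw n).
rewrite -N_rconf es N_finite_count lee_fin ler_nat -size_filter.
set v := [seq _ <- _ | _].
have [->//|v0] := eqVneq v [::].
have [x xv xmax] := seq_max_exists (@time R d) v0.
rewrite -(count_predC (fun y => time y < time x) v) -addn1 leq_add//.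
  have [q qx qv] := rat_gap v (time x).
  have := xv; rewrite mem_filter => /andP[/set_mem[_ /(_ q n qx)] + _].
  rewrite /= /cnt tame_box// => qK.
  suff : ((count (fun y => (time y < time x)%R) v)%:R%:E <= K%:R%:E :> \bar R)%E by rewrite lee_fin ler_nat.
  apply: le_trans qK.
  apply: (@le_trans _ _ (N w (sec W w `&` box (ratr q) n%:R `&` box n%:R n%:R))); last first.
    apply: le_measure; rewrite ?inE; last exact: subIsetl.
    - by do 2?apply: measurableI; [exact: measurable_sec|exact: measurable_box|exact: measurable_box].
    - by apply: measurableI; [exact: measurable_sec|exact: measurable_box].
  rewrite -N_rconf es N_finite_count lee_fin ler_nat /v count_filter.
  apply: leq_in_count => y ys /andP[yx yA]; apply/mem_set.
  have yv : y \in v by rewrite mem_filter yA.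
  split; first by move/set_mem: yA => -[].
  by rewrite /box /= qv//=; have /andP[] := sb y ys.
have := simple n (time x); rewrite (_ : [set _ | _] = [set y | time y = time x] `&` box n%:R n%:R); last first.
  by apply/seteqP; split => y /= [].
rewrite -N_rconf es N_finite_count lee_fin -[1]/(1%:R) ler_nat.
apply: leq_trans; rewrite /v count_filter; apply: leq_in_count => y ys /=.
move=> /andP[yx yA]; apply/mem_set => /=; apply/eqP.
by rewrite eq_le xmax ?mem_filter ?yA//= leNgt.
Qed.

Lemma stopped_full (W : set PXX) (w : Om) : measurable W -> (N w (sec W w) < +oo)%E ->
  exists K, forall x, stopped W K (w, x).
Proof.
move=> mW Woo; have [|[K eK]] := N_nat w (sec W w).
  by move=> e; move: Woo; rewrite e ltxx.
exists K => x q m _ /=; rewrite /cnt; case: ifP => _; last by rewrite lee_fin.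
rewrite -eK; apply: le_measure; rewrite ?inE; last exact: subIsetl.
- by apply: measurableI; [exact: measurable_sec|exact: measurable_box].
- exact: measurable_sec.
Qed.

(** Tonelli's theorem for an arbitrary configuration, even one that is not locally finite: the
    integral against [N w] is a series over the points, which commutes with the other integral. *)
Lemma N_Fubini (w : Om) d' (T : measurableType d') (m : {measure set T -> \bar R})
  (A : set T) (B : set XX) (g : T -> XX -> \bar R) :
  measurable A -> measurable B ->
  (forall t x, 0 <= g t x)%E ->
  (forall t, measurable_fun B (g t)) ->
  (forall x, B x -> measurable_fun A (g ^~ x)) ->
  measurable_fun B (fun x => \int[m]_(t in A) g t x)%E ->
  (\int[m]_(t in A) \int[N w]_(x in B) g t x =
   \int[N w]_(x in B) \int[m]_(t in A) g t x)%E.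
Proof.
move=> mA mB g0 mgt mgx mi; have [s es] := config_seqE w.
have i0 x : (0 <= \int[m]_(t in A) g t x)%E by exact: integral_ge0.
rewrite (N_integralE es mB (fun x _ => i0 x) mi).
transitivity (\int[m]_(t in A) \sum_(n <oo) oapp (g t \_ B) 0 (s n))%E.
  by apply: eq_integral => t _; rewrite (N_integralE es mB (fun x _ => g0 t x) (mgt t)).
rewrite integral_nneseries//.
- apply: eq_eseriesr => n _; case: (s n) => [x|] /=; last by rewrite integral0.
  rewrite patchE; case: ifPn => xB.
    by apply: eq_integral => t _; rewrite patchE xB.
  by rewrite integral0_eq// => t _; rewrite patchE (negbTE xB).
- move=> n; case: (s n) => [x|] /=; last exact: measurable_cst.
  have [xB|xB] := boolP (x \in B).
    rewrite (_ : (fun t => _) = g ^~ x); last by apply/funext => t; rewrite patchE xB.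
    by apply: mgx; exact: set_mem.
  rewrite (_ : (fun t => _) = cst 0%E); first exact: measurable_cst.
  by apply/funext => t; rewrite patchE (negbTE xB).
- move=> n t _; case: (s n) => [x|] //=; rewrite patchE; case: ifP => // _.
Qed.

End stopping.

Section translation.
Context (R : realType).
Let mR := measurableTypeR R.

Lemma measurable_translate (s : R) : measurable_fun setT ((fun t => t - s) : mR -> mR).
Proof. by apply: (@measurable_funB _ mR R setT id (cst s)). Qed.

Lemma lebesgue_measure_translate (s : R) (A : set mR) : measurable A ->
  lebesgue_measure [set t | A (t - s)] = lebesgue_measure A.
Proof.
move=> mA; have mt := @measurable_translate.
rewrite [RHS](@lebesgue_measure_unique _ (pushforward lebesgue_measure (fun t : mR => t - s : mR)))//.
move=> _ [[a b] _ <-]; transitivity (lebesgue_measure `]a + s, b + s]%classic); last first.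
  congr (lebesgue_measure _).
  by apply/seteqP; split => t /=; rewrite !in_itv /= ltrBrDr lerBlDr.
by rewrite !lebesgue_measure_itv /= !lte_fin ltrD2r -!EFinB opprD addrACA subrr addr0.
Qed.

Lemma ge0_integral_translate (s : R) (f : R -> \bar R) : measurable_fun setT (f : mR -> \bar R) ->
  (forall t, 0 <= f t)%E ->
  (\int[@lebesgue_measure R]_t f (t - s)%R = \int[lebesgue_measure]_t f t)%E.
Proof.
move=> mf f0; have := ge0_integral_pushforward (measurable_translate s) lebesgue_measure measurableT mf (fun y _ => f0 y).
rewrite preimage_setT => /esym e; rewrite [LHS]e.
apply: eq_measure_integral; first exact: measurable_translate.
by move=> mt A mA _; exact: lebesgue_measure_translate.
Qed.

End translation.

Section kernel_integrals.
Context (R : realType) (d : nat).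
Local Notation XX := (X R d).
Local Notation Om := (Omega R d).
Let mR := measurableTypeR R.

Variable h : R -> R -> \bar R.
Hypothesis mh : measurable_fun setT (fun u : mR * R => h u.1 u.2).
Hypothesis h0 : forall u y, (0 <= h u y)%E.

Let mjoint : measurable_fun setT (fun u : XX * mR => h (u.2 - time u.1) (mark u.1)).
Proof.
apply: (measurableT_comp mh (_ : measurable_fun setT (fun u : XX * mR => ((u.2 - time u.1 : mR), mark u.1)))).
apply: measurable_fun_pair.
  apply: (@measurable_funB _ _ R setT snd (fun u : XX * mR => time u.1)); first exact: measurable_snd.
  exact: (measurableT_comp (@measurable_time R d) measurable_fst).
exact: (measurableT_comp (@measurable_mark R d) measurable_fst).
Qed.

Lemma measurable_kernel_time (x : XX) :
  measurable_fun setT (fun t : mR => h (t - time x) (mark x)).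
Proof.
have m2 : measurable_fun setT (fun t : mR => (x, t)) by exact: measurable_fun_pair.
exact: (measurableT_comp mjoint m2).
Qed.

Lemma measurable_kernel_point (t : R) :
  measurable_fun setT (fun x : XX => h (t - time x) (mark x)).
Proof.
have m2 : measurable_fun setT (fun x : XX => (x, t : mR)) by exact: measurable_fun_pair.
exact: (measurableT_comp mjoint m2).
Qed.

Lemma measurable_kernel_integral (A : set mR) : measurable A ->
  measurable_fun setT (fun x : XX =>
    \int[@lebesgue_measure R]_(t in A) h (t - time x)%R (mark x))%E.
Proof.
move=> mA.
pose f (u : XX * mR) : \bar R := (h (u.2 - time u.1) (mark u.1) * (\1_A u.2)%:E)%E.
have mf : measurable_fun setT f.
  apply: emeasurable_funM mjoint _; apply/measurable_EFinP.
  apply: (measurableT_comp (measurable_indic mA)); exact: measurable_snd.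
rewrite (_ : (fun x => _) = fubini_F lebesgue_measure f).
  apply: measurable_fun_fubini_tonelli_F => //.
  by move=> u; rewrite /f mule_ge0// lee_fin.
apply/funext => x; rewrite /fubini_F [LHS]integral_mkcond; apply: eq_integral => t _.
by rewrite /f patchE /= indicE; case: ifP; rewrite ?mule1 ?mule0.
Qed.

Lemma N_Fubini_kernel (w : Om) (A : set mR) (B : set XX) : measurable A -> measurable B ->
  (\int[@lebesgue_measure R]_(t in A) \int[N w]_(x in B) h (t - time x)%R (mark x) =
   \int[N w]_(x in B) \int[@lebesgue_measure R]_(t in A) h (t - time x)%R (mark x))%E.
Proof.
move=> mA mB; apply: (N_Fubini _ _ (g := fun (t : mR) x => h (t - time x) (mark x))) => //.
- by move=> t; apply: measurable_funTS; exact: measurable_kernel_point.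
- by move=> x _; apply: measurable_funTS; exact: measurable_kernel_time.
- by apply: measurable_funTS; exact: measurable_kernel_integral.
Qed.

Lemma kernel_integral_le (x : XX) (A : set mR) : measurable A ->
  (\int[@lebesgue_measure R]_(t in A) h (t - time x)%R (mark x) <=
   \int[@lebesgue_measure R]_u h u (mark x))%E.
Proof.
move=> mA.
have m1 : measurable_fun setT (fun u : mR => h u (mark x)).
  have m2 : measurable_fun setT (fun u : mR => (u, mark x)) by exact: measurable_fun_pair.
  exact: (measurableT_comp mh m2).
rewrite -(ge0_integral_translate (time x) m1)//.
apply: ge0_subset_integral => //; exact: measurable_kernel_time.
Qed.

End kernel_integrals.

Lemma measurable_N_kernel (R : realType) (d : nat) (h : R -> R -> \bar R)
  (w : Omega R d) (B : set (X R d)) :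
  measurable_fun setT (fun u : measurableTypeR R * R => h u.1 u.2) ->
  (forall u y, 0 <= h u y)%E -> measurable B ->
  measurable_fun setT (fun t : measurableTypeR R =>
    \int[N w]_(x in B) h ((t : R) - time x)%R (mark x))%E.
Proof.
move=> mh h0 mB; have [s es] := config_seqE w.
rewrite (_ : (fun t => _) = (fun t : measurableTypeR R =>
    \sum_(n <oo) oapp ((fun x => h ((t : R) - time x)%R (mark x)) \_ B) 0 (s n))%E); last first.
  apply/funext => t; apply: (N_integralE es mB) => //.
  by apply: measurable_funTS; exact: (measurable_kernel_point mh).
apply: ge0_emeasurable_sum.
  by move=> n t _ _; case: (s n) => [x|] //=; rewrite patchE; case: ifP.
move=> n _; case: (s n) => [x|] /=; last exact: measurable_cst.
have [xB|xB] := boolP (x \in B).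
  rewrite (_ : (fun t => _) = (fun t : measurableTypeR R => h ((t : R) - time x)%R (mark x))).
    exact: (measurable_kernel_time mh).
  by apply/funext => t; rewrite patchE xB.
rewrite (_ : (fun t => _) = cst 0%E); first exact: measurable_cst.
by apply/funext => t; rewrite patchE (negbTE xB).
Qed.

(** * Points carrying a heavy mark *)

Section pathwise.
Context (R : realType) (d : nat).
Local Notation XX := (X R d).
Local Notation Om := (Omega R d).
Let mR := measurableTypeR R.
Context (nu : 'I_d.+1 -> probability R R) (P : probability Om R)
  (zeta phi : 'I_d.+1 -> 'I_d.+1 -> R -> R -> R) (mu : 'I_d.+1 -> R -> R)
  (lambda Z : 'I_d.+1 -> R -> Om -> R).
Hypothesis kernel_phi : is_self_excitation_kernel nu phi.
Hypothesis mu_ge0 : forall i (t : R), 0 <= t -> 0 <= mu i t.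
Hypothesis MSPD_Z : is_MSPD P zeta mu phi lambda Z.

Let kphi : is_kernel nu phi. Proof. by case: kernel_phi. Qed.
Let plambda : forall k, predictable (lambda k). Proof. by case: MSPD_Z. Qed.

(* The absolute values only serve to make the kernel total. *)
Definition total_kernel i k (u y : R) : R := phi i k `|u| `|y|.

Lemma total_kernel_ge0 i k u y : 0 <= total_kernel i k u y.
Proof. by have [_ + _] := kphi i k; apply. Qed.

Lemma measurable_total_kernel i k :
  measurable_fun setT (fun u : mR * R => total_kernel i k u.1 u.2).
Proof.
have [mp _ _] := kphi i k.
apply: (@measurable_comp _ _ _ _ _ _ [set ty : R * R | 0 <= ty.1 /\ 0 <= ty.2]
  (fun ty => phi i k ty.1 ty.2) setT (fun u : mR * R => (`|u.1 : R|, `|u.2|))) => //.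
- rewrite (_ : [set _ | _] = `[0, +oo[%classic `*` `[0, +oo[%classic).
    by apply: measurableX.
  by apply/seteqP; split => t /=; rewrite !in_itv /= !andbT.
- by move=> _ [u _ <-] /=.
- by apply: measurable_fun_pair; apply: measurableT_comp => //;
    apply: measurableT_comp => //; move=> _ V mV; rewrite setTI.
Qed.

(* The ages at which a point of kind j and mark y adds more than 1 / (n + 1)
   to the i-th intensity. *)
Definition high i j (eps : R) n (y : R) : set mR :=
  [set u | 0 < (u : R) <= eps /\ n.+1%:R^-1 < total_kernel i j u y].

(** With c = 1 / (n + 1) the threshold in [high], the ages fill more than 2 c: an amount c may be
    lost when the times of unbounded intensity are discarded, and c is left. *)
Definition heavy i j (eps : R) n : set R :=
  [set y | ((n.+1%:R^-1 + n.+1%:R^-1)%:E < lebesgue_measure (high i j eps n y))%E].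

Lemma measurable_high_joint i j eps n :
  measurable [set u : mR * R | high i j eps n u.2 u.1].
Proof.
rewrite (_ : [set _ | _] = (`]0%R, eps]%classic `*` setT) `&`
  (setT `&` [set u : mR * R | n.+1%:R^-1 < total_kernel i j u.1 u.2])); last first.
  apply/seteqP; split => u; rewrite /high /= in_itv /=; first by case.
  by case=> -[? _] [_].
apply: measurableI; first exact: measurableX.
apply: measurable_fun_lt => //; exact: measurable_total_kernel.
Qed.

Lemma measurable_high i j eps n y : measurable (high i j eps n y).
Proof.
have := @measurable_ysection _ _ _ R _ y (measurable_high_joint i j eps n).
congr measurable; apply/seteqP; split => u; rewrite /ysection /= ?inE//.
Qed.

Lemma measurable_heavy i j eps n : measurable (heavy i j eps n).
Proof.
have := @measurable_lte _ R R setT measurableT (cst (n.+1%:R^-1 + n.+1%:R^-1)%:E) _ (measurable_cst _)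
  (measurable_fun_ysection (@lebesgue_measure R) (measurable_high_joint i j eps n)).
rewrite setTI; congr measurable; apply/funext => y; congr (_ < _)%E.
congr lebesgue_measure; apply/seteqP; split => u; rewrite /ysection /= ?inE//.
Qed.

Lemma heavy_finite i j eps n b w (V : set XX) : 0 < eps ->
  MSPD_equations zeta mu phi lambda Z w -> measurable V ->
  (forall x, V x -> [/\ time x <= b, accepted lambda w x, kind x = j &
     heavy i j eps n (mark x)]) ->
  (N w V < +oo)%E.
Proof.
move=> eps0 eqw mV hV; set c : R := n.+1%:R^-1.
have c0 : 0 < c by rewrite invr_gt0.
(* Contains all instants at which a point born before [b] has an age in ]0, eps]. *)
pose J : set mR := `[0%R, b + eps]%classic; pose F (t : R) := lambda i t w.
have mJ : measurable J by exact: (@measurable_itv R).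
have Joo : (lebesgue_measure J < +oo)%E.
  by rewrite /J lebesgue_measure_itv; case: ifP => _; rewrite ?ltry// -EFinB ltry.
have mF : measurable_fun J F.
  have : measurable_fun (J : set R) F.
    apply: measurable_funS (measurable_predictable w (plambda i)).
      rewrite (_ : [set _ | _] = `[0, +oo[%classic)//.
      by apply/seteqP; split => t /=; rewrite in_itv /= andbT.
    by move=> t; rewrite /J /= in_itv /= => /andP[].
  exact: id.
pose B (K : nat) : set mR := J `&` [set t | K%:R < F t].
have mB K : measurable (B K) by exact: measurable_fun_lt.
(* The intensity is finite at every time, so the sets [B K] decrease to the empty set inside an
   interval of finite length. *)
have [K BK] : exists K, (lebesgue_measure (B K) < c%:E)%E.
  have cv : lebesgue_measure (B K) @[K --> \oo] --> lebesgue_measure (\bigcap_K B K).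
    apply: nonincreasing_cvg_mu => //.
    - apply: le_lt_trans Joo; apply: le_measure; rewrite ?inE//; exact: subIsetl.
    - exact: bigcapT_measurable.
    - move=> p q pq; apply/subsetPset => t [Jt qt]; split => //=.
      by apply: le_lt_trans qt; rewrite ler_nat.
  have e0 : \bigcap_K B K = set0.
    apply/seteqP; split => // t /(_ (Num.truncn (F t)).+1 Logic.I)[_] /=.
    by rewrite ltNge ltW// truncnS_gt.
  rewrite e0 measure0 in cv.
  have /cv[K _ /(_ K (leqnn K)) BK] : nbhs (0%E : \bar R) [set y | (y < c%:E)%E].
    by apply: open_nbhs_nbhs; split; [exact: open_ereal_lt_ereal|rewrite /= lte_fin].
  by exists K.
pose G := J `\` B K.
have mG : measurable G by exact: measurableD.
have GJ : G `<=` J by move=> t [].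
have GF t : G t -> 0 <= t /\ F t <= K%:R.
  move=> [Jt Bt]; split; first by move: Jt; rewrite /J /= in_itv /= => /andP[].
  by rewrite leNgt; apply/negP => Kt; apply: Bt.
pose h (u y : R) : \bar R := (c%:E * (\1_(high i j eps n y) u)%:E)%E.
have h0 u y : (0 <= h u y)%E by rewrite /h -EFinM lee_fin mulr_ge0// ltW.
have mh : measurable_fun setT (fun u : mR * R => h u.1 u.2).
  apply: measurable_funeM; apply/measurable_EFinP.
  exact: (measurable_indic (measurable_high_joint i j eps n)).
have low t : G t -> (\int[N w]_(x in V) h (t - time x)%R (mark x) <= (F t)%:E)%E.
  move=> /GF[t0 _]; have [_ ->] := eqw i t t0.
  rewrite (excitationE _ _ _ plambda kphi).
  have mE : measurable (upto t `&` accepted lambda w).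
    by apply: measurableI; [exact: measurable_upto|exact: measurable_accepted].
  apply: (@le_trans _ _ (\int[N w]_(x in upto t `&` accepted lambda w) (kern phi i t x)%:E)%E); last first.
    by rewrite leeDr// lee_fin mu_ge0.
  rewrite integral_mkcond [leRHS]integral_mkcond; apply: ge0_le_integral => //.
  - by move=> x _; rewrite patchE; case: ifP.
  - apply/(measurable_restrictT _ _).1 => //; apply: measurable_funTS.
    exact: measurable_kernel_point.
  - apply/(measurable_restrictT _ _).1 => //; apply/measurable_EFinP.
    apply: (measurable_funS _ _ (measurable_kern i kphi)); [exact: measurable_upto|exact: subIsetl].
  move=> x _; rewrite patchE; case: ifPn => [/set_mem Vx|_]; last first.
    by rewrite patchE; case: ifP => // /set_mem[xt _]; rewrite lee_fin (kern_ge0 _ kphi).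
  have [xb xa xj xh] := hV x Vx; rewrite /h indicE.
  case: (boolP (_ \in high _ _ _ _ _)) => [/set_mem[/andP[tx _] ch]|_]; last first.
    rewrite mule0 patchE; case: ifP => // /set_mem[xt _].
    by rewrite lee_fin (kern_ge0 _ kphi).
  rewrite mule1 patchE ifT; last by apply/mem_set; split => //; rewrite /upto /= -subr_ge0 ltW.
  rewrite lee_fin /kern xj ltW//; apply: lt_le_trans ch _.
  by rewrite /total_kernel !ger0_norm// ?mark_ge0// ltW.
have high_int x : V x -> ((c * c)%:E <= \int[@lebesgue_measure R]_(t in G) h (t - time x)%R (mark x))%E.
  move=> Vx; have [_ _ _ xh] := hV x Vx.
  pose A : set mR := [set t | high i j eps n (mark x) (t - time x)].
  have mA : measurable A.
    have := measurable_translate (time x) measurableT (measurable_high i j eps n (mark x)).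
    by rewrite setTI.
  have AJ : A `<=` J.
    move=> t [/andP[xt te] _]; rewrite /J /= in_itv /=; apply/andP; split.
      by rewrite (le_trans (time_ge0 x))// -subr_ge0 ltW.
    have [xb _ _ _] := hV x Vx; rewrite -(subrK (time x) t) addrC lerD//.
  have leA : ((c + c)%:E < lebesgue_measure A)%E.
    by rewrite (lebesgue_measure_translate (time x) (measurable_high i j eps n (mark x))).
  (* [A] has measure greater than 2 c, and leaving [G] costs less than c. *)
  have leGA : (c%:E <= lebesgue_measure (G `&` A))%E.
    rewrite leNgt; apply/negP => lt; move: leA; rewrite ltNge => /negP; apply.
    apply: (@le_trans _ _ (lebesgue_measure (G `&` A) + lebesgue_measure (B K))%E).
      apply: (@le_trans _ _ (lebesgue_measure ((G `&` A) `|` B K))).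
        apply: le_measure; rewrite ?inE//.
          by apply: measurableU => //; exact: measurableI.
        move=> t At; have [tB|tB] := pselect (B K t); [by right|left].
        by split => //; split => //; exact: AJ.
      by apply: measureU2 => //; exact: measurableI.
    by rewrite EFinD leeD// ltW.
  rewrite (eq_integral (fun t => c%:E * (\1_A t)%:E)%E); last first.
    by move=> t _; rewrite /h !indicE.
  rewrite ge0_integralZl//; last 2 first.
  - by apply/measurable_EFinP; exact: measurable_indic.
  - by rewrite lee_fin ltW.
  by rewrite integral_indic// setIC EFinM lee_wpmul2l// lee_fin ltW.
have fin : ((c * c)%:E * N w V < +oo)%E.
  apply: (@le_lt_trans _ _ (\int[@lebesgue_measure R]_(t in G) (K%:R)%:E)%E); last first.
    rewrite integral_cst// lte_mul_pinfty//.
    apply: le_lt_trans Joo; apply: le_measure; rewrite ?inE//.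
  apply: (@le_trans _ _ (\int[@lebesgue_measure R]_(t in G) \int[N w]_(x in V) h (t - time x)%R (mark x))%E); last first.
    apply: ge0_le_integral => //.
    - by move=> t _; exact: integral_ge0.
    - by apply: measurable_funTS; exact: measurable_N_kernel.
    - by move=> t Gt; apply: le_trans (low t Gt) _; rewrite lee_fin; have [] := GF t Gt.
  rewrite (N_Fubini_kernel mh h0)// -integral_cst//.
  apply: ge0_le_integral => //.
  - by move=> x _; rewrite lee_fin mulr_ge0// ltW.
  - by apply: measurable_funTS; exact: measurable_kernel_integral.
rewrite ltey; apply/eqP => e; move: fin; rewrite e gt0_muley ?ltxx//.
by rewrite lte_fin mulr_gt0.
Qed.

Definition burst i j (eps u y : R) : \bar R :=
  ((total_kernel i j u y)%:E * (\1_(`]0%R, eps]%classic) u)%:E)%E.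

Lemma burst_ge0 i j eps u y : (0 <= burst i j eps u y)%E.
Proof. by rewrite /burst -EFinM lee_fin mulr_ge0// total_kernel_ge0. Qed.

Lemma measurable_burst i j eps :
  measurable_fun setT (fun u : mR * R => burst i j eps u.1 u.2).
Proof.
apply: emeasurable_funM; first by apply/measurable_EFinP; exact: measurable_total_kernel.
apply/measurable_EFinP; by apply: (measurableT_comp (measurable_indic _)).
Qed.

(* The expected number of points of kind i directly triggered within time eps
   by a point of kind j and mark y. *)
Definition load i j (eps y : R) : \bar R :=
  (\int[@lebesgue_measure R]_u burst i j eps u y)%E.

Lemma load_ge0 i j eps y : (0 <= load i j eps y)%E.
Proof. by apply: integral_ge0 => u _; exact: burst_ge0. Qed.

Lemma measurable_load i j eps : measurable_fun setT (load i j eps).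
Proof.
have := @measurable_fun_fubini_tonelli_G _ _ mR R R lebesgue_measure
  (fun u : mR * R => burst i j eps u.1 u.2) (measurable_burst i j eps) (fun u => burst_ge0 _ _ _ _ _).
exact: id.
Qed.

(** For m >= n the set [high] of index n is contained in that of index m, of measure at most 2 / (m
    + 1) as [y] is not heavy. All these sets are thus negligible, and the kernel vanishes almost
    everywhere on ]0, eps]. *)
Lemma load_light i j eps y : (forall n, ~ heavy i j eps n y) -> load i j eps y = 0%E.
Proof.
move=> light.
have high0 n : lebesgue_measure (high i j eps n y) = 0%E.
  apply/eqP; rewrite eq_le measure_ge0 andbT; apply/lee_addgt0Pr => e e0; rewrite add0e.
  (* Large enough for 2 / (m + 1) <= e, and at least [n] for the inclusion. *)
  pose m := maxn n (Num.truncn (2 / e)).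
  apply: (@le_trans _ _ (lebesgue_measure (high i j eps m y))).
    apply: le_measure; rewrite ?inE; [exact: measurable_high|exact: measurable_high|].
    move=> u [u0 nu']; split => //; apply: le_lt_trans nu'.
    by rewrite lef_pV2 ?posrE// ler_nat ltnS leq_maxl.
  have /negP := light m; rewrite /heavy /= -leNgt => /le_trans; apply.
  rewrite lee_fin -mulr2n -[X in X <= _]mulr_natl ler_pdivrMr// -ler_pdivrMl// mulrC.
  apply: (@le_trans _ _ (Num.truncn (2 / e)).+1%:R); first by rewrite ltW// truncnS_gt.
  by rewrite ler_nat ltnS leq_maxr.
rewrite /load (@ge0_ae_eq_integral _ _ _ (@lebesgue_measure R) setT _ (cst 0%E))//.
- by rewrite integral0.
- have m2 : measurable_fun setT (fun u : mR => (u, y)) by exact: measurable_fun_pair.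
  exact: (measurableT_comp (measurable_burst i j eps) m2).
- by move=> u _; exact: burst_ge0.
have : (@lebesgue_measure R).-negligible (\bigcup_n high i j eps n y).
  apply: negligible_bigcup => n; exists (high i j eps n y); split => //.
    exact: measurable_high.
  exact: high0.
move=> /(negligibleS _); apply => u /= /not_implyP[_ /eqP ne]; move: ne; rewrite /burst indicE.
case: (boolP (_ \in _)) => [/set_mem|]; last by rewrite mule0 eqxx.
rewrite /= in_itv /= => u0; rewrite mule1 => /eqP ne.
have t0 : 0 < total_kernel i j u y.
  by rewrite lt_neqAle total_kernel_ge0 andbT; apply/eqP => e; apply: ne; rewrite -e.
exists (Num.truncn ((total_kernel i j u y)^-1)) => //; split => //.
by rewrite invf_plt ?posrE// truncnS_gt.
Qed.

Lemma load_light_mean i j eps : (forall n, nu j (heavy i j eps n `&` `[0%R, +oo[) = 0%E) ->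
  (\int[nu j]_(y in `[0%R, +oo[) load i j eps y = 0)%E.
Proof.
move=> h0; rewrite (@ge0_ae_eq_integral _ _ _ (nu j) _ _ (cst 0%E))//.
- by rewrite integral0.
- by apply: measurable_funTS; exact: measurable_load.
- by move=> y _; exact: load_ge0.
have : (nu j).-negligible (\bigcup_n (heavy i j eps n `&` `[0%R, +oo[)).
  apply: negligible_bigcup => n; exists (heavy i j eps n `&` `[0%R, +oo[); split => //.
    by apply: measurableI => //; exact: measurable_heavy.
  exact: h0.
move=> /(negligibleS _); apply => y /= /not_implyP[y0 ne]; apply: contrapT => h; apply: ne.
apply: load_light => n hn; apply: h; exists n => //.
Qed.

Lemma measurable_mean_kernel k j :
  measurable_fun setT ((fun u => \int[nu j]_(y in `[0%R, +oo[) (total_kernel k j u y)%:E)%E : mR -> \bar R).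
Proof.
pose f (u : mR * R) : \bar R := ((total_kernel k j u.1 u.2)%:E * (\1_(`[0%R, +oo[%classic) u.2)%:E)%E.
have mf : measurable_fun setT f.
  apply: emeasurable_funM; first by apply/measurable_EFinP; exact: measurable_total_kernel.
  by apply/measurable_EFinP; apply: (measurableT_comp (measurable_indic _)).
rewrite (_ : (fun u => _) = fubini_F (nu j) f).
  apply: measurable_fun_fubini_tonelli_F => //.
  by move=> u; rewrite /f -EFinM lee_fin mulr_ge0// total_kernel_ge0.
apply/funext => u; rewrite /fubini_F [LHS]integral_mkcond; apply: eq_integral => y _.
by rewrite /f patchE /= indicE; case: ifP; rewrite ?mule1 ?mule0.
Qed.

Lemma mean_load k j eps :
  (\int[nu j]_(y in `[0%R, +oo[) load k j eps y =
   \int[@lebesgue_measure R]_u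
     ((\int[nu j]_(y in `[0%R, +oo[) (total_kernel k j u y)%:E) * (\1_(`]0%R, eps]%classic) u)%:E))%E.
Proof.
pose f (u : mR * R) : \bar R := (burst k j eps u.1 u.2 * (\1_(`[0%R, +oo[%classic) u.2)%:E)%E.
have f0 u : (0 <= f u)%E by rewrite /f mule_ge0// ?burst_ge0// lee_fin.
have mf : measurable_fun setT f.
  apply: emeasurable_funM; first exact: measurable_burst.
  by apply/measurable_EFinP; apply: (measurableT_comp (measurable_indic _)).
transitivity (\int[nu j]_y \int[@lebesgue_measure R]_u f (u, y))%E.
  rewrite integral_mkcond; apply: eq_integral => y _; rewrite patchE.
  rewrite /f /= indicE; case: ifP => _; last by rewrite integral0_eq// => u _; rewrite mule0.
  by apply: eq_integral => u _; rewrite mule1.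
rewrite -(@fubini_tonelli _ _ mR R R lebesgue_measure (nu j) f mf f0).
apply: eq_integral => u _.
have m1 : measurable_fun setT (fun y : R => (total_kernel k j u y)%:E).
  have m2 : measurable_fun setT (fun y : R => (u : mR, y)) by exact: measurable_fun_pair.
  by apply/measurable_EFinP; exact: (measurableT_comp (measurable_total_kernel k j) m2).
rewrite -ge0_integralZr//; last 2 first.
- exact: measurable_funTS.
- by move=> y _; rewrite lee_fin total_kernel_ge0.
rewrite [RHS]integral_mkcond; apply: eq_integral => y _; rewrite patchE /f /burst /=.
by rewrite !indicE; case: (y \in _); rewrite ?mule1 ?mule0.
Qed.

(** Dominated convergence: the kernel has finite total mass, and every fixed age u > 0 leaves ]0, 1
    / (n + 1)] eventually. *)
Lemma small_load k j (e : R) : 0 < e ->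
  \forall n \near \oo, (\int[nu j]_(y in `[0%R, +oo[) load k j n.+1%:R^-1 y < e%:E)%E.
Proof.
move=> e0; have [_ [mass _] _] := kernel_phi.
pose g (u : R) : \bar R := (\int[nu j]_(y in `[0%R, +oo[) (total_kernel k j u y)%:E)%E.
have mg : measurable_fun setT (g : mR -> \bar R) by exact: measurable_mean_kernel.
have g0 u : (0 <= g u)%E by apply: integral_ge0 => y _; rewrite lee_fin total_kernel_ge0.
have gfin : (\int[@lebesgue_measure R]_(u in `[0%R, +oo[) g u < +oo)%E.
  apply: le_lt_trans (mass k j); rewrite le_eqVlt; apply/orP; left; apply/eqP.
  apply: eq_integral => u /in_ge0 u0; apply: eq_integral => y /in_ge0 y0.
  by rewrite /total_kernel !ger0_norm.
pose gn (n : nat) (u : R) : \bar R := (g u * (\1_(`]0%R, n.+1%:R^-1]%classic) u)%:E)%E.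
have mgn n : measurable_fun setT (gn n : mR -> \bar R).
  apply: emeasurable_funM => //; apply/measurable_EFinP.
  exact: (measurable_indic (_ : measurable (_ : set mR))).
have cv : (\int[@lebesgue_measure R]_(u in `[0%R, +oo[) gn n u)%E @[n --> \oo] --> (0 : \bar R)%E.
  pose lm : {measure set mR -> \bar R} := @lebesgue_measure R.
  pose D0 : set mR := `[0%R, +oo[%classic.
  have f_f : {ae lm, forall u, D0 u -> gn ^~ u @ \oo --> (0 : \bar R)%E}.
    apply: aeW => u _; apply: cvg_near_cst.
    have [u0|u0] := leP u 0.
      apply: nearW => n; rewrite /gn indicE memNset ?mule0//= in_itv /= => /andP[].
      by rewrite ltNge u0.
    exists (Num.truncn u^-1) => // n /= nu'; rewrite /gn indicE memNset ?mule0//=.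
    rewrite in_itv /= => /andP[_]; rewrite leNgt => /negP; apply.
    rewrite invf_plt ?posrE//; apply: lt_le_trans (truncnS_gt _) _.
    by rewrite ler_nat ltnS.
  have ig : lm.-integrable D0 g.
    apply/integrableP; split; first exact: measurable_funTS.
    by under eq_integral => u _ do rewrite gee0_abs//.
  have f_g : {ae lm, forall u n, D0 u -> (`|gn n u| <= g u)%E}.
    apply: aeW => u n _; rewrite gee0_abs ?mule_ge0// ?lee_fin// /gn indicE.
    by case: (_ \in _); rewrite ?mule1 ?mule0.
  have mgD n : measurable_fun D0 (gn n) by exact: measurable_funTS.
  have [_ _] := dominated_convergence (measurable_itv _ : measurable D0) mgD (measurable_cst 0%E) f_f ig f_g.
  by rewrite integral0.
have /cv : nbhs (0%E : \bar R) [set y | (y < e%:E)%E].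
  by apply: open_nbhs_nbhs; split; [exact: open_ereal_lt_ereal|rewrite /= lte_fin].
move=> [m _ hm]; exists m => // n /hm /=; congr (_ < _)%E; rewrite mean_load.
rewrite integral_mkcond; apply: eq_integral => u _; rewrite patchE /gn.
case: ifPn => //; rewrite !indicE => /negP u0; rewrite memNset ?mule0//= in_itv /= => /andP[u1 _].
by apply: u0; apply/mem_set; rewrite /= in_itv /= ltW.
Qed.

End pathwise.

(** * The points missed by the truncations *)

Section truncation.
Context (R : realType) (d : nat).
Local Notation XX := (X R d).
Local Notation Om := (Omega R d).
Let mR := measurableTypeR R.
Context (nu : 'I_d.+1 -> probability R R) (P : probability Om R)
  (zeta phi : 'I_d.+1 -> 'I_d.+1 -> R -> R -> R) (mu : 'I_d.+1 -> R -> R)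
  (lambda Z : 'I_d.+1 -> R -> Om -> R).
Hypothesis kernel_phi : is_self_excitation_kernel nu phi.
Hypothesis MSPD_Z : is_MSPD P zeta mu phi lambda Z.
Variables (T : R) (w : Om).
Hypothesis w_tame : tame w.
Hypothesis w_MSPD : MSPD_equations zeta mu phi lambda Z w.
Hypothesis w_time0 : N w [set x : XX | time x = 0] = 0%E.

Let kphi : is_kernel nu phi. Proof. by case: kernel_phi. Qed.
Let plambda : forall k, predictable (lambda k). Proof. by case: MSPD_Z. Qed.

Definition accepted_box (M : R) : set XX :=
  accepted lambda (rconf (box T M) w) `&` box T M.

Lemma measurable_accepted_box M : measurable (accepted_box M).
Proof. by apply: measurableI; [exact: measurable_accepted|exact: measurable_box]. Qed.

(** A tame configuration has finitely many points in the box, so this holds for all [M] at once,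
    without an exceptional event. *)
Lemma MSPD_rconf M : MSPD_equations zeta mu phi lambda Z (rconf (box T M) w).
Proof.
have [s [-> _]] := rconf_finite (tame_box T M w_tame).
exact: (MSPD_finite MSPD_Z).
Qed.

Lemma intensity_rconf_le i t M : 0 <= t ->
  lambda i t (rconf (box T M) w) <= lambda i t w.
Proof.
move=> t0; have [s [es _]] := rconf_finite (tame_box T M w_tame); rewrite es.
apply: (intensity_le kernel_phi MSPD_Z) => // A mA; rewrite -es N_rconf.
apply: le_measure; rewrite ?inE; [|exact: mA|exact: subIsetl].
by apply: measurableI => //; exact: measurable_box.
Qed.

Lemma box_le M M' : M <= M' -> box T M `<=` (box T M' : set XX).
Proof. by move=> MM x /andP[xT xM]; rewrite /box /= xT (le_trans xM). Qed.

Lemma intensity_rconf_mono i t M M' : 0 <= t -> M <= M' ->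
  lambda i t (rconf (box T M) w) <= lambda i t (rconf (box T M') w).
Proof.
move=> t0 MM; have [s [es _]] := rconf_finite (tame_box T M w_tame); rewrite es.
apply: (intensity_le kernel_phi MSPD_Z) => //; first exact: MSPD_rconf.
move=> A mA; rewrite -es !N_rconf.
apply: le_measure; rewrite ?inE; last by apply: setIS; exact: box_le.
  by apply: measurableI => //; exact: measurable_box.
by apply: measurableI => //; exact: measurable_box.
Qed.

Lemma accepted_box_mono M M' : M <= M' -> accepted_box M `<=` accepted_box M'.
Proof.
move=> MM x [xa xb]; split; last exact: box_le xb.
by apply: le_trans xa _; exact: intensity_rconf_mono (time_ge0 x) MM.
Qed.

Lemma accepted_box_sub M : accepted_box M `<=` accepted lambda w.
Proof.
move=> x [xa _]; apply: le_trans xa _; exact: intensity_rconf_le (time_ge0 x).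
Qed.

Lemma accepted_cover : upto T `&` accepted lambda w `<=`
  (\bigcup_n accepted_box n%:R) `|` (sec (missed lambda T) w `|` [set x | time x = 0]).
Proof.
move=> x [xT xa]; have [x0|x0] := leP (time x) 0.
  by right; right; apply/eqP; rewrite eq_le x0 time_ge0.
have [[M xM]|/forallNP h] :=
  pselect (exists M : nat, level x <= lambda (kind x) (time x) (rconf (box T M%:R) w)); last first.
  by right; left; split => // M; rewrite ltNge; apply/negP.
left; exists (maxn M (Num.truncn (level x)).+1) => //; split.
  apply: le_trans xM _; apply: intensity_rconf_mono; first exact: ltW.
  by rewrite ler_nat leq_maxl.
apply/andP; split => //; apply: (@le_trans _ _ (Num.truncn (level x)).+1%:R).
  by rewrite ltW// truncnS_gt.
by rewrite ler_nat leq_maxr.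
Qed.

Lemma integral_accepted_box g i t M : is_kernel nu g ->
  excitation g lambda i t (rconf (box T M) w) =
  (\int[N w]_(x in upto t `&` accepted_box M) (kern g i t x)%:E)%E.
Proof.
move=> kg; have mA : measurable (upto t `&` accepted lambda (rconf (box T M) w)).
  by apply: measurableI; [exact: measurable_upto|exact: measurable_accepted].
rewrite (excitationE _ _ _ plambda kg) rconf_integralE ?setIA//.
- exact: measurable_box.
- by move=> x [xt _]; rewrite lee_fin (kern_ge0 _ kg).
- apply/measurable_EFinP; apply: measurable_funS (measurable_kern i kg).
    exact: measurable_upto.
  exact: subIsetl.
Qed.

Let measurable_kern_in g i t (A : set XX) : is_kernel nu g ->
  measurable_fun (upto t `&` A) (fun x => (kern g i t x)%:E).
Proof.
move=> kg; apply/measurable_EFinP; apply: measurable_funS (measurable_kern i kg).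
  exact: measurable_upto.
exact: subIsetl.
Qed.

Lemma integral_accepted_box_cvg g i t : is_kernel nu g ->
  (\int[N w]_(x in upto t `&` accepted_box n%:R) (kern g i t x)%:E)%E @[n --> \oo] -->
  (\int[N w]_(x in upto t `&` \bigcup_n accepted_box n%:R) (kern g i t x)%:E)%E.
Proof.
move=> kg; rewrite setI_bigcupr; apply: ge0_nondecreasing_set_cvg_integral.
- move=> n m nm; apply/subsetPset; apply: setIS; apply: accepted_box_mono.
  by rewrite ler_nat.
- move=> n; apply: measurableI; [exact: measurable_upto|exact: measurable_accepted_box].
- by move=> n; exact: measurable_kern_in.
- by move=> n x [xt _]; rewrite lee_fin (kern_ge0 _ kg).
Qed.

Lemma integral_accepted_le g i t : is_kernel nu g -> t <= T ->
  (\int[N w]_(x in upto t `&` accepted lambda w) (kern g i t x)%:E <=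
   \int[N w]_(x in upto t `&` \bigcup_n accepted_box n%:R) (kern g i t x)%:E +
   \int[N w]_(x in upto t `&` sec (missed lambda T) w) (kern g i t x)%:E)%E.
Proof.
move=> kg tT; pose A := upto t `&` \bigcup_n accepted_box n%:R.
pose B := upto t `&` sec (missed lambda T) w; pose C : set XX := upto t `&` [set x | time x = 0].
have mU : measurable (\bigcup_n accepted_box n%:R).
  by apply: bigcupT_measurable => n; exact: measurable_accepted_box.
have mA : measurable A by apply: measurableI => //; exact: measurable_upto.
have mB : measurable B.
  apply: measurableI; first exact: measurable_upto.
  by apply: measurable_sec; exact: measurable_missed.
have mt0 : measurable [set x : XX | time x = 0].
  by rewrite -[X in measurable X]setTI; exact: (measurable_time measurableT (Y := [set 0])).
have mC : measurable C by apply: measurableI => //; exact: measurable_upto.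
have C0 : N w C = 0%E.
  apply/eqP; rewrite eq_le measure_ge0 andbT -w_time0.
  by apply: le_measure; rewrite ?inE//; exact: subIsetr.
pose f x : \bar R := (kern g i t x)%:E.
have f0 x : upto t x -> (0 <= f x)%E by move=> xt; rewrite lee_fin (kern_ge0 _ kg).
pose D := upto t `&` accepted lambda w.
have mD : measurable D.
  by apply: measurableI; [exact: measurable_upto|exact: measurable_accepted].
have DABC : D `<=` A `|` (B `|` C).
  move=> x [xt xa]; have xT : upto T x by exact: le_trans tT.
  by have [?|[?|?]] := accepted_cover (conj xT xa); [left|right; left|right; right].
have mf E : measurable_fun (upto t `&` E) f by exact: measurable_kern_in.
have -> : (\int[N w]_(x in D) f x = \int[N w]_(x in D `\` C) f x)%E.
  rewrite -ge0_negligible_integral//; first exact: mf.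
  by move=> x [xt _]; exact: f0.
have DAB : D `\` C `<=` A `|` B by move=> x [/DABC[|[]]]; [left|right|].
have fr (E : set XX) : E `<=` upto t -> measurable E -> measurable_fun E f.
  by move=> Et mE; have <- : upto t `&` E = E by exact/setIidr.
apply: (@le_trans _ _ (\int[N w]_(x in A `|` B) f x)%E).
  apply: ge0_subset_integral => //.
  - exact: measurableD.
  - exact: measurableU.
  - by apply: fr; [move=> x [[]|[]]|exact: measurableU].
  - by move=> x [[xt _]|[xt _]]; exact: f0.
have -> : A `|` B = A `|` (B `\` A).
  apply/seteqP; split => x [xA|xB]; [by left| |by left|by right; case: xB].
  by have [?|?] := pselect (A x); [left|right].
have mBA : measurable (B `\` A) by exact: measurableD.
rewrite ge0_integral_setU//.
- rewrite leeD2l//; apply: ge0_subset_integral => //.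
  by move=> x [xt _]; exact: f0.
- by apply: fr; [move=> x [[]|[[]]]|exact: measurableU].
- by move=> x [[xt _]|[[xt _] _]]; exact: f0.
- by apply/disj_setPS => x [xA [_ xnA]]; exact: xnA.
Qed.

(** The missed levels lie above the truncated intensity [r M] for every [M] and below [lambda]. As M
    grows, [r M] increases to [mu] plus the contribution of all points accepted by some truncation;
    what [lambda] has in excess comes from missed points. *)
Lemma slice_missed k t : 0 < t -> t <= T ->
  (slice k (sec (missed lambda T) w) t <=
   \int[N w]_(x in upto t `&` sec (missed lambda T) w) (kern phi k t x)%:E)%E.
Proof.
move=> t0 tT.
have [_ lw] := w_MSPD k (ltW t0).
rewrite (excitationE _ _ _ plambda kphi) in lw.
pose r (M : nat) : R := lambda k t (rconf (box T M%:R) w).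
have rE M : (r M)%:E = ((mu k t)%:E + \int[N w]_(x in upto t `&` accepted_box M%:R) (kern phi k t x)%:E)%E.
  have [_] := MSPD_rconf M%:R k (ltW t0).
  by rewrite (integral_accepted_box _ _ _ kphi).
have rle M : r M <= lambda k t w by exact: intensity_rconf_le (ltW t0).
have sle M : (slice k (sec (missed lambda T) w) t <= (lambda k t w - r M)%:E)%E.
  rewrite (_ : slice _ _ _ = \int[@lebesgue_measure R]_(th in `[0%R, +oo[) (\1_(sec (missed lambda T) w) (inX k t th 0))%:E)%E//.
  apply: (@le_trans _ _ (\int[@lebesgue_measure R]_(th in `[0%R, +oo[) (\1_(`]r M, lambda k t w]%classic) th)%:E)%E).
    apply: ge0_le_integral => //.
    - have m2 : measurable_fun setT (fun th : mR => (t : mR, th)) by exact: measurable_fun_pair.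
      apply: measurable_funTS; apply: (measurableT_comp (measurable_slice k _) m2).
      by apply: measurable_sec; exact: measurable_missed.
    - apply: measurable_funTS; apply/measurable_EFinP.
      exact: (measurable_indic (_ : measurable (_ : set mR))).
    - move=> th /=; rewrite in_itv /= andbT => th0; rewrite lee_fin !indicE ler_nat.
      case: (boolP (_ \in sec _ _)) => // /set_mem; rewrite /sec /missed /=.
      rewrite /time /level /kind /= !ger0_norm ?(ltW t0)// => -[_ _ a b].
      by rewrite mem_set// /= in_itv /= b a.
  rewrite integral_indic//.
  apply: (@le_trans _ _ (lebesgue_measure `]r M, lambda k t w]%classic)).
    by apply: le_measure; rewrite ?inE//; exact: measurableI.
  rewrite lebesgue_measure_itv /= lte_fin; case: ifP => _; first by rewrite -EFinB.
  by rewrite lee_fin subr_ge0.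
(* The slice is bounded by [lambda] minus [r 0], so that the subtraction takes place among real
   numbers. *)
have sfin : slice k (sec (missed lambda T) w) t \is a fin_num.
  rewrite ge0_fin_numE ?slice_ge0//; exact: le_lt_trans (sle 0%N) (ltry _).
rewrite -(fineK sfin); set s := fine _.
have sle' M : s <= lambda k t w - r M by rewrite -lee_fin /s fineK.
have Ule : (\int[N w]_(x in upto t `&` \bigcup_n accepted_box n%:R) (kern phi k t x)%:E <=
    (lambda k t w - s - mu k t)%:E)%E.
  have cv := @integral_accepted_box_cvg phi k t kphi.
  rewrite -(cvg_lim _ cv)//; apply: lime_le; first by apply/cvg_ex; eexists; exact: cv.
  apply: nearW => M; rewrite -(leeD2lE (x := (mu k t)%:E))// -rE -EFinD lee_fin.
  by have := sle' M; lra.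
have mle := @integral_accepted_le phi k t kphi tT.
have : ((lambda k t w)%:E <= (mu k t)%:E + ((lambda k t w - s - mu k t)%:E +
    \int[N w]_(x in upto t `&` sec (missed lambda T) w) (kern phi k t x)%:E))%E.
  by rewrite [leLHS]lw leeD2l//; apply: le_trans mle _; exact: leeD2r.
have : (0 <= \int[N w]_(x in upto t `&` sec (missed lambda T) w) (kern phi k t x)%:E)%E.
  by apply: integral_ge0 => x [xt _]; rewrite lee_fin (kern_ge0 _ kphi).
(* If the missed points contribute an infinite amount, the bound is trivial. *)
case: (\int[N w]_(x in _) _)%E => [v _| _ _|//]; last by rewrite leey.
by rewrite -!EFinD !lee_fin => h; lra.
Qed.

End truncation.

Section kinds.
Context (R : realType) (d : nat).
Local Notation XX := (X R d).
Local Notation Om := (Omega R d).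
Local Notation PXX := (PX R d).

Definition of_kind (k : 'I_d.+1) : set XX := [set x | kind x = k].

Lemma measurable_of_kind k : measurable (of_kind k).
Proof.
rewrite -[X in measurable X]setTI.
exact: (measurable_kind measurableT (Y := [set k])).
Qed.

Lemma measure_kind_le (m : {measure set XX -> \bar R}) (A : set XX) : measurable A ->
  (m A <= \sum_(k < d.+1) m (A `&` of_kind k))%E.
Proof.
move=> mA; pose F (n : nat) := A `&` of_kind (inord n).
have mF n : measurable (F n) by apply: measurableI => //; exact: measurable_of_kind.
rewrite (eq_bigr (fun k : 'I_d.+1 => m (F k))); last by move=> k _; rewrite /F inord_val.
apply: le_trans (Boole_inequality m (fun n _ => mF n)).
apply: le_measure; rewrite ?inE//.
  by rewrite -bigcup_mkord; apply: fin_bigcup_measurable.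
move=> x Ax; rewrite -bigcup_mkord; exists (kind x) => /=; first exact: ltn_ord.
by rewrite /F inord_val.
Qed.

Lemma measurable_integral_mark (P : probability Om R) (nu : 'I_d.+1 -> probability R R)
    (W : set PXX) (g : R -> \bar R) :
  poisson_random_measure P (intensity_measure nu) ->
  (forall k, nu k `[0, +oo[%classic = 1%E) ->
  measurable W -> measurable_fun setT g -> (forall y, 0 <= g y)%E ->
  measurable_fun setT (fun w => (\int[tamed w]_(x in sec W w) g (mark x))%E).
Proof.
move=> P_poisson nu_ge0 mW mg g0.
have mf : measurable_fun setT (fun z : PXX => g (mark z.2) * (\1_W z)%:E)%E.
  apply: emeasurable_funM; last by apply/measurable_EFinP; exact: measurable_indic.
  by apply: (measurable_snd_PX (f := fun x => g (mark x))); apply: (measurableT_comp mg); exact: measurable_mark.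
have f0 z : (0 <= g (mark z.2) * (\1_W z)%:E)%E by rewrite mule_ge0// lee_fin.
have := measurable_integral_mix (@measurable_tamed R d) mf f0.
congr (measurable_fun _ _); apply/funext => w.
rewrite [RHS]integral_mkcond; apply: eq_integral => x _.
rewrite patchE indicE (_ : ((w, x) \in W) = (x \in sec W w)); last by apply/idP/idP; rewrite !inE.
by case: ifP; rewrite ?mule1 ?mule0.
Qed.

End kinds.

(** * Missed points in one time window *)

Section window.
Context (R : realType) (d : nat).
Local Notation XX := (X R d).
Local Notation Om := (Omega R d).
Local Notation PXX := (PX R d).
Let mR := measurableTypeR R.
Context (nu : 'I_d.+1 -> probability R R) (P : probability Om R)
  (zeta phi : 'I_d.+1 -> 'I_d.+1 -> R -> R -> R) (mu : 'I_d.+1 -> R -> R)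
  (lambda Z : 'I_d.+1 -> R -> Om -> R).
Hypothesis nu_ge0 : forall k, nu k `[0, +oo[%classic = 1%E.
Hypothesis P_poisson : poisson_random_measure P (intensity_measure nu).
Hypothesis kernel_phi : is_self_excitation_kernel nu phi.
Hypothesis mu_ge0 : forall i (t : R), 0 <= t -> 0 <= mu i t.
Hypothesis MSPD_Z : is_MSPD P zeta mu phi lambda Z.
Variable T : R.

Let kphi : is_kernel nu phi. Proof. by case: kernel_phi. Qed.
Let plambda : forall k, predictable (lambda k). Proof. by case: MSPD_Z. Qed.

Definition regular (w : Om) : Prop :=
  [/\ tame w, MSPD_equations zeta mu phi lambda Z w,
    N w [set x : XX | time x = 0] = 0%E &
    forall (n : nat) t, (N w [set x : XX | box n%:R n%:R x /\ time x = t] <= 1)%E].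

Lemma regular_ae : {ae P, forall w, regular w}.
Proof.
have h0 : {ae P, forall w, forall n : nat, N w [set x : XX | box n%:R n%:R x /\ time x = 0] = 0%E}.
  by apply/ae_foralln => n; exact: (poisson_time0 nu_ge0 P_poisson).
have h1 : {ae P, forall w, forall (n : nat) t, (N w [set x : XX | box n%:R n%:R x /\ time x = t] <= 1)%E}.
  by apply/ae_foralln => n; exact: (poisson_simple nu_ge0 P_poisson).
have h2 := tame_ae nu_ge0 P_poisson.
have h3 := MSPD_ae MSPD_Z.
have h01 := @filterI _ _ (ae_filter_ringOfSetsType P) _ _ h0 h1.
move: h01 h2 h3; apply: (@filterS3 _ _ (ae_filter_ringOfSetsType P)) => w [w0 w1] w2 w3.
split => //.
have mt0 : measurable [set x : XX | time x = 0].
  by rewrite -[X in measurable X]setTI; exact: (measurable_time measurableT (Y := [set 0])).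
apply/eqP; rewrite eq_le measure_ge0 andbT; apply: N_box_le => // n.
by rewrite -(w0 n) le_eqVlt; apply/orP; left; apply/eqP; congr (N w _);
  apply/seteqP; split => x [].
Qed.

Variables (a eps : R).
Hypothesis a_ge0 : 0 <= a.
Hypothesis eps_gt0 : 0 < eps.

Let b k j := (\int[nu j]_(y in `[0%R, +oo[) load phi k j eps y)%E.
Hypothesis b_small : forall j, (\sum_(k < d.+1) b k j <= (2^-1)%:E)%E.

Let null w := N w (sec (missed lambda T) w `&` upto a) = 0%E.
Hypothesis past_null : {ae P, forall w, null w}.

Let mmissed w : measurable (sec (missed lambda T) w).
Proof. by apply: measurable_sec; exact: measurable_missed. Qed.

(* For each kind j, marks which are seen with positive probability unless the
   points of kind j trigger nothing, and which occur finitely often. *)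
Lemma heavy_choice : exists p : 'I_d.+1 -> 'I_d.+1 * nat, forall j,
  (0 < nu j (heavy phi (p j).1 j eps (p j).2 `&` `[0%R, +oo[))%E \/ forall k, b k j = 0%E.
Proof.
suff H j : exists p : 'I_d.+1 * nat,
    (0 < nu j (heavy phi p.1 j eps p.2 `&` `[0%R, +oo[))%E \/ forall k, b k j = 0%E.
  by exists (fun j => sval (cid (H j))) => j; exact: svalP (cid (H j)).
have [[i [n h]]|h] :=
  pselect (exists i n, (0 < nu j (heavy phi i j eps n `&` `[0%R, +oo[))%E).
  by exists (i, n); left.
exists (ord0, 0%N); right => k; apply: (load_light_mean kernel_phi) => n.
apply/eqP; rewrite eq_le measure_ge0 andbT leNgt; apply/negP => h'.
by apply: h; exists k, n.
Qed.

Variable p : 'I_d.+1 -> 'I_d.+1 * nat.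
Hypothesis pP : forall j,
  (0 < nu j (heavy phi (p j).1 j eps (p j).2 `&` `[0%R, +oo[))%E \/ forall k, b k j = 0%E.
Let Y j := heavy phi (p j).1 j eps (p j).2.

Let mY j : measurable (Y j).
Proof. exact: (measurable_heavy kernel_phi). Qed.

Let Win : set PXX := missed lambda T `&` [set z | a < time z.2 <= a + eps].

Let mWin : measurable Win.
Proof.
apply: measurableI; first exact: measurable_missed.
rewrite (_ : [set z | _] = (fun z : PXX => time z.2) @^-1` `]a, a + eps]%classic).
  rewrite -[X in measurable X]setTI.
  exact: (measurable_snd_PX (@measurable_time R d) measurableT (measurable_itv _)).
by apply/seteqP; split => z; rewrite /= in_itv.
Qed.

(** The missed points of the window whose mark is heavy for their kind: their number is finite by
    [heavy_finite], and they are the ones counted by the stopping rule. *)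
Let HV : set PXX := Win `&` \bigcup_(j in [set: 'I_d.+1])
  [set z | kind z.2 = j /\ Y j (mark z.2)].

Let mHV : measurable HV.
Proof.
apply: measurableI => //; apply: fin_bigcup_measurable => // j _.
rewrite (_ : [set z | _] = (fun z : PXX => z.2) @^-1` (of_kind j `&` @mark R d @^-1` Y j))//.
rewrite -[X in measurable X]setTI; apply: (measurable_snd_PX (@measurable_id _ XX setT)) => //.
apply: measurableI; first exact: measurable_of_kind.
by rewrite -[X in measurable X]setTI; exact: measurable_mark.
Qed.

(** The stopping rule looks at strictly earlier points of [HV] only, so [W] is predictable and
    ignores the mark of the point under consideration, although [HV] itself depends on marks. *)
Let W k K : set PXX := Win `&` [set z | kind z.2 = k] `&` stopped HV K.

Let mW k K : measurable (W k K).
Proof.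
apply: measurableI; last exact: measurable_stopped.
apply: measurableI => //; rewrite -[X in measurable X]setTI.
exact: (measurable_snd_PX (@measurable_kind R d) measurableT (Y := [set k])).
Qed.

Let W_markless k K w : markless k (sec (W k K) w).
Proof.
move=> x [[[[x0 xT xa xM] xw] xk] xs]; split => // y yk yt yl; split.
  by split => //; split; [split; rewrite /= ?yt ?yl ?yk -?xk//|rewrite /= yt].
by move=> q m; rewrite /= yt; exact: xs.
Qed.

Let HV_finite w : regular w -> (N w (sec HV w) < +oo)%E.
Proof.
move=> [_ eqw _ _]; have mHw : measurable (sec HV w) by exact: measurable_sec.
apply: le_lt_trans (measure_kind_le (N w) mHw) _; apply: lte_sum_pinfty => j _.
apply: (heavy_finite kernel_phi mu_ge0 MSPD_Z (i := (p j).1) (j := j) (n := (p j).2) (b := T) eps_gt0 eqw).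
  by apply: measurableI => //; exact: measurable_of_kind.
by move=> x [[[[x0 xT xa _] _] [j' _ [xk xY]]] xj]; split => //; rewrite -xj xk.
Qed.

(** If the rule has not stopped at [t], it had not stopped at any earlier point, so every missed
    point of ]a, t] lies in some [W j K] and has age at most [eps]. Points up to [a] are excluded by
    [null], and points at [t] itself contribute [phi] at age 0, which vanishes. *)
Let mix_kinds k K w t : regular w -> null w -> a < t -> t <= a + eps -> t <= T ->
  (forall (q : rat) (m : nat), ratr q < t ->
    (cnt (box (ratr q) m%:R) w (sec HV w) <= K%:R%:E)%E) ->
  (\int[N w]_(x in upto t `&` sec (missed lambda T) w) (kern phi k t x)%:E <=
   \sum_(j < d.+1) \int[N w]_(x in sec (W j K) w)
     burst phi k j eps (t - time x)%R (mark x))%E.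
Proof.
move=> _ wn at_ tae tT tK.
have mU : measurable (upto t `&` sec (missed lambda T) w).
  by apply: measurableI => //; exact: measurable_upto.
have mV : measurable (sec (missed lambda T) w `&` upto a).
  by apply: measurableI => //; exact: measurable_upto.
have mk : measurable_fun (upto t `&` sec (missed lambda T) w) (fun x => (kern phi k t x)%:E).
  apply/measurable_EFinP; apply: measurable_funS (measurable_kern k kphi); first exact: measurable_upto.
  exact: subIsetl.
have k0 x : upto t x -> (0 <= (kern phi k t x)%:E)%E by move=> xt; rewrite lee_fin (kern_ge0 _ kphi).
rewrite (ge0_negligible_integral _ _ _ _ wn)//; last by move=> x [xt _]; exact: k0.
set D := _ `\` _; have mD : measurable D by exact: measurableD.
have mS j : measurable (sec (W j K) w) by exact: measurable_sec.
have mb j : measurable_fun setT (fun x : XX => burst phi k j eps (t - time x)%R (mark x)).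
  exact: (measurable_kernel_point (measurable_burst kernel_phi k j eps)).
under eq_bigr => j _ do rewrite integral_mkcond.
rewrite -ge0_integral_sum//; last 2 first.
- by move=> j; apply/(measurable_restrictT _ _).1 => //; exact: measurable_funTS.
- by move=> j x _; rewrite patchE; case: ifP => // _; exact: (burst_ge0 kernel_phi).
rewrite integral_mkcond; apply: ge0_le_integral => //.
- by move=> x _; rewrite patchE; case: ifP => // /set_mem[[xt _] _]; exact: k0.
- apply/(measurable_restrictT _ _).1 => //; apply: measurable_funS mk => //.
  exact: subDsetl.
- apply: emeasurable_sum => j; apply/(measurable_restrictT _ _).1 => //.
  exact: measurable_funTS.
move=> x _.
have s0 j : (0 <= ((fun x : XX => burst phi k j eps (t - time x)%R (mark x)) \_ (sec (W j K) w)) x)%E.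
  by rewrite patchE; case: ifP => // _; exact: (burst_ge0 kernel_phi).
rewrite patchE; case: ifPn => [/set_mem[[xt xm] xna]|_]; last exact: sume_ge0.
rewrite (bigD1 (kind x))//=; apply: (@le_trans _ _ (((fun y : XX => burst phi k (kind x) eps (t - time y)%R (mark y)) \_ (sec (W (kind x) K) w)) x)); last first.
  by rewrite leeDl//; exact: sume_ge0.
have ax : a < time x by rewrite ltNge; apply/negP => xa; apply: xna.
rewrite patchE ifT; last first.
  apply/mem_set; split; [split; [split|]|] => //=.
    by rewrite ax; exact: le_trans tae.
  by move=> q m qx; apply: tK; exact: lt_le_trans xt.
have [xt'|tx] := ltP (time x) t; last first.
  rewrite (kern_phi_diag kernel_phi); last by apply/eqP; rewrite eq_le tx andbT.
  exact: (burst_ge0 kernel_phi).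
rewrite /burst indicE mem_set ?mule1; last first.
  by rewrite /= in_itv /= subr_gt0 xt' /= lerBlDr; apply: le_trans tae _; rewrite addrC lerD2l ltW.
by rewrite lee_fin /total_kernel /kern !ger0_norm// ?mark_ge0// subr_ge0.
Qed.

(** When [t] is outside the window, beyond [T] or after the stopping, the slice is empty; otherwise
    [slice_missed] applies. *)
Let slice_W k K w t : regular w -> null w -> 0 <= t ->
  (slice k (sec (W k K) w) t <=
   \sum_(j < d.+1) \int[N w]_(x in sec (W j K) w)
     burst phi k j eps (t - time x)%R (mark x))%E.
Proof.
move=> rw wn t0; have [tw eqw w0 _] := rw.
have rhs0 : (0 <= \sum_(j < d.+1) \int[N w]_(x in sec (W j K) w)
     burst phi k j eps (t - time x)%R (mark x))%E.
  by apply: sume_ge0 => j _; apply: integral_ge0 => x _; exact: (burst_ge0 kernel_phi).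
have [[/andP[at_ tae] tT tK]|h] := pselect [/\ a < t <= a + eps, t <= T &
    forall (q : rat) (m : nat), ratr q < t ->
    (cnt (box (ratr q) m%:R) w (sec HV w) <= K%:R%:E)%E]; last first.
  rewrite /slice integral0_eq// => th _; rewrite indicE memNset// => -[[[[_ xT _ _] xw] _] xs].
  have e : time (inX k t th 0) = t by rewrite /time /= ger0_norm.
  by apply: h; split; [rewrite -e|rewrite -e|move=> q m qt; apply: xs; rewrite /= e].
apply: le_trans (mix_kinds k rw wn at_ tae tT tK).
apply: le_trans (slice_missed kernel_phi MSPD_Z tw eqw w0 k (le_lt_trans a_ge0 at_) tT).
have mi (S : set XX) : measurable S -> measurable_fun (`[0%R, +oo[%classic : set mR)
    (fun th => (\1_S (inX k t th 0))%:E : \bar R).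
  move=> mS; have m2 : measurable_fun setT (fun th : mR => (t : mR, th)) by exact: measurable_fun_pair.
  by apply: measurable_funTS; exact: (measurableT_comp (measurable_slice k mS) m2).
apply: ge0_le_integral => //.
- by apply: mi; exact: measurable_sec.
- exact: mi.
- move=> th _; rewrite lee_fin !indicE ler_nat.
  case: (boolP (_ \in sec (W _ _) _)) => // /set_mem[[[xm _] _] _].
  by rewrite mem_set.
Qed.

(** Integrate [slice_W] over time and exchange: each point of [W j K] contributes at most its load,
    by translation to its birth time. *)
Let mean_W k K w : regular w -> null w ->
  (mean P (sec (W k K) w) <=
   \sum_(j < d.+1) \int[tamed w]_(x in sec (W j K) w) load phi k j eps (mark x))%E.
Proof.
move=> rw wn; have mS j : measurable (sec (W j K) w) by exact: measurable_sec.
rewrite (mean_markless nu_ge0 P_poisson (mS k) (@W_markless k K w)).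
pose G j (t : mR) : \bar R := (\int[N w]_(x in sec (W j K) w) burst phi k j eps (t - time x)%R (mark x))%E.
have mG j : measurable_fun setT (G j).
  apply: measurable_N_kernel => //; first exact: (measurable_burst kernel_phi).
  exact: (burst_ge0 kernel_phi).
have G0 j t : (0 <= G j t)%E by apply: integral_ge0 => x _; exact: (burst_ge0 kernel_phi).
apply: (@le_trans _ _ (\int[@lebesgue_measure R]_(t in `[0%R, +oo[) \sum_(j < d.+1) G j t)%E).
  apply: ge0_le_integral => //.
  - by move=> t _; exact: slice_ge0.
  - by apply: measurable_funTS; exact: measurable_fun_slice.
  - by apply: measurable_funTS; exact: emeasurable_sum.
  - by move=> t; rewrite /= in_itv /= andbT => t0; exact: slice_W.
rewrite ge0_integral_sum//; last by move=> j; exact: measurable_funTS.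
apply: lee_sum => j _; rewrite /tamed asboolT; last by case: rw.
rewrite /G (N_Fubini_kernel (measurable_burst kernel_phi k j eps) (burst_ge0 kernel_phi k j eps))//.
apply: ge0_le_integral => //.
- by move=> x _; apply: integral_ge0 => t _; exact: (burst_ge0 kernel_phi).
- apply: measurable_funTS; apply: (measurable_kernel_integral (measurable_burst kernel_phi k j eps)) => //.
  exact: (burst_ge0 kernel_phi).
- apply: measurable_funTS; apply: (measurableT_comp (measurable_load kernel_phi k j eps)).
  exact: measurable_mark.
- move=> x _; apply: (kernel_integral_le (measurable_burst kernel_phi k j eps)) => //.
  exact: (burst_ge0 kernel_phi).
Qed.

Let u k K := (\int[P]_w tamed w (sec (W k K) w))%E.

Let u_ge0 k K : (0 <= u k K)%E.
Proof. by apply: integral_ge0 => w _; exact: measure_ge0. Qed.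

Let regular_null : {ae P, forall w, regular w /\ null w}.
Proof. exact: (@filterI _ _ (ae_filter_ringOfSetsType P) _ _ regular_ae past_null). Qed.

(** Expectation of [mean_W]: compensation turns the left side into [u k K], and the independence of
    the marks factors each term on the right. *)
Let u_le k K : (u k K <= \sum_(j < d.+1) u j K * b k j)%E.
Proof.
have mI j : measurable_fun setT (fun w => (\int[tamed w]_(x in sec (W j K) w) load phi k j eps (mark x))%E).
  apply: (measurable_integral_mark P_poisson nu_ge0) => //; first exact: (measurable_load kernel_phi).
  exact: (load_ge0 kernel_phi).
have I0 j w : (0 <= \int[tamed w]_(x in sec (W j K) w) load phi k j eps (mark x))%E.
  by apply: integral_ge0 => x _; exact: (load_ge0 kernel_phi).
rewrite /u (mean_count nu_ge0 P_poisson)//.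
apply: (@le_trans _ _ (\int[P]_w \sum_(j < d.+1) \int[tamed w]_(x in sec (W j K) w) load phi k j eps (mark x))%E).
  apply: ae_ge0_le_integral => //.
  - exact: (measurable_mean_sec nu_ge0 P_poisson).
  - by move=> w _; exact: sume_ge0.
  - exact: emeasurable_sum.
  move: regular_null; apply: (@filterS _ _ (ae_filter_ringOfSetsType P)) => w [rw wn] _.
  exact: mean_W.
rewrite ge0_integral_sum//; apply: lee_sum => j _.
apply: (integral_mark_le nu_ge0 P_poisson (k := j)) => //.
- exact: (measurable_load kernel_phi).
- exact: (load_ge0 kernel_phi).
Qed.

(** At most K + 1 points of [W j K] carry a mark in [Y j], and their expected number is [u j K]
    times the positive probability of such a mark. *)
Let u_good j K : (0 < nu j (Y j `&` `[0%R, +oo[))%E -> (u j K < +oo)%E.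
Proof.
move=> nu0; have := count_mark nu_ge0 P_poisson (mW j K) (@W_markless j K) (mY j).
rewrite -/(u j K) => e; rewrite ltey; apply/eqP => uoo; move: e.
rewrite uoo gt0_mulye// => e.
suff : (\int[P]_w tamed w (sec (W j K) w `&` @mark R d @^-1` Y j) <= K.+1%:R%:E)%E by rewrite e.
have mV : measurable (W j K `&` setT `*` (@mark R d @^-1` Y j) : set PXX).
  apply: measurableI => //; apply: sub_sigma_algebra; apply: predictable_rect_past.
  by rewrite -[X in measurable X]setTI; exact: measurable_mark.
have sV w : sec (W j K `&` setT `*` (@mark R d @^-1` Y j)) w = sec (W j K) w `&` @mark R d @^-1` Y j.
  by apply/seteqP; split => x; rewrite /sec /=; [case=> ? [] |case].
have -> : (K.+1%:R%:E = \int[P]_w (cst K.+1%:R%:E w))%E.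
  by rewrite integral_cst// [X in (_ * X)%E]probability_setT mule1.
apply: ae_ge0_le_integral => //.
- have := measurable_tamed mV; congr (measurable_fun _ _); apply/funext => w.
  by rewrite sV.
- by move=> w _; rewrite lee_fin.
- move: regular_ae; apply: (@filterS _ _ (ae_filter_ringOfSetsType P)) => w rw _.
  have [tw _ _ simple] := rw; rewrite /tamed asboolT//.
  apply: le_trans (stopped_count K mHV tw simple).
  apply: le_measure; rewrite ?inE.
  + by rewrite -sV; exact: measurable_sec.
  + by apply: measurableI; apply: measurable_sec => //; exact: measurable_stopped.
  + move=> x [[[xw xk] xs] xY]; split => //; split => //; exists j => //.
Qed.

Let b_lty k j : (b k j < +oo)%E.
Proof.
apply: le_lt_trans (ltry (2^-1)); apply: le_trans (b_small j).
rewrite (bigD1 k)//= leeDl//; apply: sume_ge0 => i _; apply: integral_ge0 => y _.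
exact: (load_ge0 kernel_phi).
Qed.

Let b_ge0 k j : (0 <= b k j)%E.
Proof. by apply: integral_ge0 => y _; exact: (load_ge0 kernel_phi). Qed.

Let u_lty k K : (u k K < +oo)%E.
Proof.
apply: le_lt_trans (u_le k K) _; apply: lte_sum_pinfty => j _.
(* For a kind which triggers nothing the term is 0 whatever [u j K] is, since infinity times 0 is
   0. *)
have [/u_good uj|->] := pP j; last by rewrite mule0.
by rewrite lte_mul_pinfty// ge0_fin_numE.
Qed.

Let u_eq0 k K : u k K = 0%E.
Proof.
pose U := (\sum_(k < d.+1) u k K)%E.
have U0 : (0 <= U)%E by exact: sume_ge0.
have Uoo : (U < +oo)%E by exact: lte_sum_pinfty.
(* Summing over [k] produces the column sums of [b], the ones bounded in [b_small]. *)
have UU : (U <= U * (2^-1)%:E)%E.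
  apply: (@le_trans _ _ (\sum_(k < d.+1) \sum_(j < d.+1) u j K * b k j)%E).
    by apply: lee_sum => i _; exact: u_le.
  rewrite exchange_big /= ge0_sume_distrl//; apply: lee_sum => j _.
  by rewrite -ge0_sume_distrr// lee_wpmul2l.
have Ufin : U \is a fin_num by rewrite ge0_fin_numE.
have Ule : (U <= 0)%E.
  move: U0 UU; rewrite -(fineK Ufin) -EFinM !lee_fin => ? ?; lra.
apply/eqP; rewrite eq_le u_ge0 andbT; apply: le_trans Ule.
by rewrite /U (bigD1 k)//= leeDl//; exact: sume_ge0.
Qed.

(** Almost surely [W k K] has no point for all [k] and [K] simultaneously, there being countably
    many. As [HV] is finite, a [K] depending on [w] is never exceeded, and for it the sets [W k K]
    make up the whole window. *)
Lemma missed_window : {ae P, forall w, N w (sec (missed lambda T) w `&` upto (a + eps)) = 0%E}.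
Proof.
have uae : {ae P, forall w, forall k K, tamed w (sec (W k K) w) = 0%E}.
  have h k K : {ae P, forall w, tamed w (sec (W k K) w) = 0%E}.
    have mt := measurable_tamed (mW k K).
    have := (ae_eq_integral_abs P measurableT mt).1.
    under eq_integral => w _ do rewrite gee0_abs//.
    move=> /(_ (u_eq0 k K)); apply: (@filterS _ _ (ae_filter_ringOfSetsType P)) => w.
    exact.
  have h' k : {ae P, forall w, forall K, tamed w (sec (W k K) w) = 0%E} by exact/ae_foralln.
  have := @filter_forall _ _ _ _ (ae_filter_ringOfSetsType P) h'.
  exact: id.
move: regular_null uae; apply: (@filterS2 _ _ (ae_filter_ringOfSetsType P)) => w [rw wn] uw.
have [tw _ _ _] := rw; have [K sK] := stopped_full mHV (HV_finite rw).
have mU t : measurable (sec (missed lambda T) w `&` upto t).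
  by apply: measurableI => //; exact: measurable_upto.
apply/eqP; rewrite eq_le measure_ge0 andbT.
have mS : measurable (sec Win w) by exact: measurable_sec.
apply: (@le_trans _ _ (N w (sec (missed lambda T) w `&` upto a) + N w (sec Win w))%E).
  apply: (@le_trans _ _ (N w ((sec (missed lambda T) w `&` upto a) `|` sec Win w))).
    apply: le_measure; rewrite ?inE//; first exact: measurableU.
    move=> x [xm xt]; have [xa|ax] := leP (time x) a; [by left|right].
    by split => //=; rewrite ax.
  by apply: measureU2.
rewrite wn add0e; apply: le_trans (measure_kind_le (N w) mS) _.
rewrite big1// => k _; apply/eqP; rewrite eq_le measure_ge0 andbT.
have := uw k K; rewrite /tamed asboolT// => <-; apply: le_measure; rewrite ?inE.
- by apply: measurableI => //; exact: measurable_of_kind.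
- exact: measurable_sec.
- by move=> x [xw xk]; split => //; exact: sK.
Qed.

End window.

(** * Convergence of the truncations *)

Section convergence.
Context (R : realType) (d : nat).
Local Notation XX := (X R d).
Local Notation Om := (Omega R d).
Context (nu : 'I_d.+1 -> probability R R) (P : probability Om R)
  (zeta phi : 'I_d.+1 -> 'I_d.+1 -> R -> R -> R) (mu : 'I_d.+1 -> R -> R)
  (lambda Z : 'I_d.+1 -> R -> Om -> R).
Hypothesis nu_ge0 : forall k, nu k `[0, +oo[%classic = 1%E.
Hypothesis P_poisson : poisson_random_measure P (intensity_measure nu).
Hypothesis kernel_zeta : is_kernel nu zeta.
Hypothesis kernel_phi : is_self_excitation_kernel nu phi.
Hypothesis mu_ge0 : forall i (t : R), 0 <= t -> 0 <= mu i t.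
Hypothesis MSPD_Z : is_MSPD P zeta mu phi lambda Z.
Variable T : R.

Let plambda : forall k, predictable (lambda k). Proof. by case: MSPD_Z. Qed.

Lemma missed_null : {ae P, forall w, N w (sec (missed lambda T) w) = 0%E}.
Proof.
(* There are d + 1 kinds, so loads below [e] add up to at most 1/2. *)
pose e : R := (2 * d.+1%:R)^-1.
have e0 : 0 < e by rewrite invr_gt0 mulr_gt0.
have [n hn] : exists n, forall j k,
    (\int[nu j]_(y in `[0%R, +oo[) load phi k j n.+1%:R^-1 y < e%:E)%E.
  have h j : \forall n \near \oo, forall k,
      (\int[nu j]_(y in `[0%R, +oo[) load phi k j n.+1%:R^-1 y < e%:E)%E.
    by apply: filter_forall => k; exact: (small_load kernel_phi).
  have [n _ hn] := @filter_forall _ _ _ _ (@eventually_filter) h.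
  by exists n; exact: (hn n (leqnn n)).
pose eps : R := n.+1%:R^-1; have eps0 : 0 < eps by rewrite invr_gt0.
have b_small j : (\sum_(k < d.+1) \int[nu j]_(y in `[0%R, +oo[) load phi k j eps y <= (2^-1)%:E)%E.
  apply: (@le_trans _ _ (\sum_(k < d.+1) e%:E)%E); first by apply: lee_sum => k _; exact/ltW/hn.
  by rewrite sumEFin lee_fin sumr_const card_ord -[X in X <= _]mulr_natr /e invfM -mulrA mulVf// mulr1.
have [p pP] := heavy_choice kernel_phi eps.
(* The admissible window length depends on [phi] and [nu] only, so the same [eps] serves for every
   window and finitely many windows reach [T]. The induction starts for free, since missed points
   have positive times. *)
have main m : {ae P, forall w, N w (sec (missed lambda T) w `&` upto (m%:R * eps)) = 0%E}.
  elim: m => [|m IHm].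
    apply: aeW => w; rewrite (_ : _ `&` _ = set0) ?measure0//.
    apply/seteqP; split => // x [[x0 _ _ _]]; rewrite /upto /= mul0r leNgt.
    by move=> /negP.
  rewrite -natr1 mulrDl mul1r.
  apply: (missed_window nu_ge0 P_poisson kernel_phi mu_ge0 MSPD_Z _ eps0 b_small IHm pP).
  by rewrite mulr_ge0// ltW.
have := main (Num.truncn (T / eps)).+1.
apply: (@filterS _ _ (ae_filter_ringOfSetsType P)) => w <-; congr (N w _).
apply/seteqP; split => [x xm|x []//]; split => //.
have [_ xT _ _] := xm; apply: le_trans xT _.
by rewrite -ler_pdivrMr// ltW// truncnS_gt.
Qed.

Variables (i : 'I_d.+1) (w : Om).
Hypothesis T_ge0 : 0 <= T.
Hypothesis w_regular : regular zeta phi mu lambda Z w.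
Hypothesis w_missed : N w (sec (missed lambda T) w) = 0%E.

Let w_tame : tame w. Proof. by case: w_regular. Qed.
Let w_MSPD : MSPD_equations zeta mu phi lambda Z w. Proof. by case: w_regular. Qed.
Let w_time0 : N w [set x : XX | time x = 0] = 0%E. Proof. by case: w_regular. Qed.

Let Zbox M : (Z i T (rconf (box T M) w))%:E =
  (\int[N w]_(x in upto T `&` accepted_box lambda T w M) (kern zeta i T x)%:E)%E.
Proof.
have [-> _] := MSPD_rconf MSPD_Z T w_tame M i T_ge0.
exact: (integral_accepted_box MSPD_Z).
Qed.

Let mA M : measurable (upto T `&` accepted_box lambda T w M).
Proof.
apply: measurableI; first exact: measurable_upto.
exact: (measurable_accepted_box MSPD_Z).
Qed.

Let mk (A : set XX) : measurable_fun (upto T `&` A) (fun x => (kern zeta i T x)%:E).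
Proof.
apply/measurable_EFinP; apply: measurable_funS (measurable_kern i kernel_zeta).
  exact: measurable_upto.
exact: subIsetl.
Qed.

Let k0 x : upto T x -> (0 <= (kern zeta i T x)%:E)%E.
Proof. by move=> xT; rewrite lee_fin (kern_ge0 _ kernel_zeta). Qed.

Lemma process_rconf_mono M M' : M <= M' ->
  Z i T (rconf (box T M) w) <= Z i T (rconf (box T M') w).
Proof.
move=> MM; rewrite -lee_fin !Zbox; apply: ge0_subset_integral => //.
- by move=> x [xT _]; exact: k0.
- by apply: setIS; exact: (accepted_box_mono kernel_phi MSPD_Z).
Qed.

Lemma process_rconf_le M : Z i T (rconf (box T M) w) <= Z i T w.
Proof.
rewrite -lee_fin Zbox; have [-> _] := w_MSPD i T_ge0.
rewrite (excitationE _ _ _ plambda kernel_zeta); apply: ge0_subset_integral => //.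
- by apply: measurableI; [exact: measurable_upto|exact: measurable_accepted].
- by move=> x [xT _]; exact: k0.
- by apply: setIS; exact: (accepted_box_sub kernel_phi MSPD_Z).
Qed.

(** Monotone convergence gives the sum over the points accepted by some truncation. By
    [integral_accepted_le] it differs from the full sum only through the missed points, which are
    null for [w]. *)
Lemma process_rconf_cvgn : Z i T (rconf (box T n%:R) w) @[n --> \oo] --> Z i T w.
Proof.
have cv := @integral_accepted_box_cvg _ _ _ _ _ _ _ _ _ kernel_phi MSPD_Z T w w_tame zeta i T kernel_zeta.
have mU : measurable (\bigcup_n accepted_box lambda T w n%:R).
  by apply: bigcupT_measurable => n; exact: (measurable_accepted_box MSPD_Z).
have e : (\int[N w]_(x in upto T `&` \bigcup_n accepted_box lambda T w n%:R) (kern zeta i T x)%:E)%E =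
    (Z i T w)%:E.
  have [-> _] := w_MSPD i T_ge0; rewrite (excitationE _ _ _ plambda kernel_zeta).
  apply/eqP; rewrite eq_le; apply/andP; split.
    apply: ge0_subset_integral => //.
    - by apply: measurableI => //; exact: measurable_upto.
    - by apply: measurableI; [exact: measurable_upto|exact: measurable_accepted].
    - by move=> x [xT _]; exact: k0.
    - apply: setIS => x [n _]; exact: (accepted_box_sub kernel_phi MSPD_Z).
  have := integral_accepted_le kernel_phi MSPD_Z w_tame w_time0 i kernel_zeta (lexx T).
  rewrite (_ : \int[N w]_(x in upto T `&` sec _ _) _ = 0)%E ?adde0//.
  have mm : measurable (sec (missed lambda T) w).
    by apply: measurable_sec; exact: measurable_missed.
  have mI : measurable (upto T `&` sec (missed lambda T) w).
    by apply: measurableI => //; exact: measurable_upto.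
  rewrite (ge0_negligible_integral _ _ _ _ w_missed)//; last by move=> x [xT _]; exact: k0.
  rewrite (_ : _ `\` _ = set0) ?integral_set0//.
  by apply/seteqP; split => // x [[_ xm]].
rewrite e in cv.
rewrite (_ : (fun n : nat => _) = fine \o (fun n : nat =>
    \int[N w]_(x in upto T `&` accepted_box lambda T w n%:R) (kern zeta i T x)%:E)%E).
  exact: fine_cvg cv.
by apply/funext => n; rewrite /= -Zbox.
Qed.

(** Real levels follow from integer ones, because the truncated values increase with [M] and stay
    below the limit. *)
Lemma process_rconf_cvg : Z i T (rconf (box T M) w) @[M --> +oo] --> Z i T w.
Proof.
apply/cvgrPdist_le => e e0.
have /cvgrPdist_le/(_ e e0)[n _ /(_ n (leqnn n)) hn] := process_rconf_cvgn.
exists n%:R; split; first exact: num_real.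
move=> M nM; apply: le_trans hn.
rewrite !ger0_norm ?subr_ge0 ?process_rconf_le// lerD2l lerN2.
exact/process_rconf_mono/ltW.
Qed.

End convergence.

Theorem theorem4p1 (R : realType) (d : nat)
  (nu : 'I_d.+1 -> probability R R)
  (nu_ge0 : forall k, nu k `[0, +oo[%classic = 1%E)
  (P : probability (Omega R d) R)
  (P_poisson : poisson_random_measure P (intensity_measure nu))
  (zeta phi : 'I_d.+1 -> 'I_d.+1 -> R -> R -> R)
  (mu : 'I_d.+1 -> R -> R)
  (kernel_zeta : is_kernel nu zeta)
  (kernel_phi : is_self_excitation_kernel nu phi)
  (mu_ge0 : forall i (t : R), 0 <= t -> 0 <= mu i t)
  (measurable_mu : forall i, measurable_fun [set t : R | 0 <= t] (mu i))
  (lambda Z : 'I_d.+1 -> R -> Omega R d -> R)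
  (MSPD_Z : is_MSPD P zeta mu phi lambda Z)
  (T : R) (T_ge0 : 0 <= T) (i : 'I_d.+1) :
  {ae P, forall w, exists S : R -> R,
    (forall M : R, 0 <= M ->
      (fun m => \sum_(0 <= n < m)
         ((n.+1)`!%:R^-1)%:E *
         factorial_integral (@truncated_Top R d T M (Z i T) n.+1) w)%E
        @ \oo --> (S M)%:E) /\
    S M @[M --> +oo] --> Z i T w}
  /\
  (forall n (x : n.-tuple (X R d)) (xn : X R d),
     uniq (rcons x xn) ->
     all (fun z => time z <= T) (rcons x xn) ->
     sorted (fun a b => time a <= time b) (rcons x xn) ->
     Top [tuple of rcons x xn] (Z i T) =
       zeta i (kind xn) (T - time xn) (mark xn) *
       Top x (fun w => (level xn <= lambda (kind xn) (time xn) w)%R%:R)).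
Proof.
split; last first.
  move=> n x xn _ xT xs.
  exact: (Top_process_rcons kernel_zeta kernel_phi MSPD_Z).
have mZ := MSPD_measurable MSPD_Z i T_ge0.
have Z0 : Z i T (finite_config [::]) = 0.
  by rewrite (process_finite kernel_zeta MSPD_Z)// big_nil.
move: (missed_null nu_ge0 P_poisson kernel_phi mu_ge0 MSPD_Z T)
  (regular_ae nu_ge0 P_poisson MSPD_Z).
apply: (@filterS2 _ _ (ae_filter_ringOfSetsType P)) => w w_missed w_regular.
exists (fun M => Z i T (rconf (box T M) w)); split.
  move=> M _; have [tw _ _ _] := w_regular.
  by have := pseudo_chaotic_expansion mZ (tame_box T M tw); rewrite Z0 subr0.
exact: (process_rconf_cvg kernel_zeta kernel_phi MSPD_Z).
Qed.
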